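(* Assume the Generalized Riemann Hypothesis for Dirichlet $L$-functions. Let $E(x)$ denote the number of elite primes $p \le x$. Then $E(x) = O(x^{5/6})$ as $x \to \infty$.
   Context: For $n \ge 0$ the $n$-th Fermat number is $F_n = 2^{2^n}+1$. A prime $p$ is called an elite prime if there exists $N$ such that $F_n$ is a quadratic nonresidue modulo $p$ for all $n \ge N$. *)

(* Defs.v *)
From Stdlib Require Import Reals.
From Coquelicot Require Import Coquelicot.
From mathcomp Require Import all_boot.
From mathcomp Require Import boolp.

Set Implicit Arguments.
Unset Strict Implicit.
Unset Printing Implicit Defensive.

Definition fermat (n : nat) : nat := (2 ^ (2 ^ n) + 1)%N.

Definition quadratic_nonresidue (p a : nat) : Prop :=
  coprime a p /\ ~ (exists x : nat, x ^ 2 = a %[mod p])%N.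

Definition elite_prime (p : nat) : Prop :=
  prime p /\
  exists N : nat, forall n : nat, (N <= n)%N -> quadratic_nonresidue p (fermat n).

(* [Int_part] is the floor; a negative [x] gives the range {0}, which contains
   no prime. *)
Definition elite_count (x : R) : nat :=
  count (fun p => `[< elite_prime p >]) (iota 0 (Z.to_nat (Int_part x)).+1).

Definition Cexp (z : C) : C :=
  ((exp (Re z) * cos (Im z))%R, (exp (Re z) * sin (Im z))%R).

(* n ^ (- s) for n >= 1. *)
Definition nat_Cpow_opp (n : nat) (s : C) : C :=
  Cexp (Copp (Cmult s (RtoC (ln (INR n))))).

Definition dirichlet_character (q : nat) (chi : nat -> C) : Prop :=
  [/\ forall n : nat, chi (n + q)%N = chi n,
      forall m n : nat, chi (m * n)%N = Cmult (chi m) (chi n)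
    & forall n : nat, chi n <> RtoC 0 <-> coprime n q].

(* [L] is the L-function of [chi] on the half-plane Re s > 0, which contains the
   critical strip: it is the Dirichlet series for Re s > 1, and is holomorphic
   except possibly at s = 1 (a pole when [chi] is principal).  These conditions
   determine [L] on Re s > 0, s <> 1; its values elsewhere are irrelevant. *)
Definition is_dirichlet_L (chi : nat -> C) (L : C -> C) : Prop :=
  (forall s : C, (1 < Re s)%R ->
     @is_series C_AbsRing C_NormedModule
       (fun k : nat => Cmult (chi k.+1) (nat_Cpow_opp k.+1 s)) (L s)) /\
  (forall s : C, (0 < Re s)%R -> s <> RtoC 1 ->
     @ex_derive C_AbsRing C_NormedModule L s).

(* All characters are included, also imprimitive and principal ones (q = 1 is
   the Riemann hypothesis): the Euler factors by which an imprimitive L-function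
   differs from the primitive one vanish only on Re s = 0. *)
Definition GRH : Prop :=
  forall (q : nat) (chi : nat -> C) (L : C -> C),
    (0 < q)%N -> dirichlet_character q chi -> is_dirichlet_L chi L ->
    forall s : C, (0 < Re s < 1)%R -> L s = RtoC 0 -> Re s = (1 / 2)%R.

(* Main.v *)
(** For n >= y the Fermat number F_n is a nonresidue modulo every elite prime p
    with 2^y not dividing p - 1, because F_n modulo p is then purely periodic in
    n >= y.  By reciprocity chi_n(p) = (p / F_n) = (F_n / p) is a character modulo
    F_n, so that the product of the 1 - chi_n(p) over y <= n < y + m is 2^m at
    those p and nonnegative at all primes.  Expanded, it is a signed sum of
    characters chi_S over S in [y, y + m), where chi_S is nonprincipal for S
    nonempty since the F_n are coprime and are not squares.

    Let x = e^N and K = N^2, and weigh p^j by ln(p) w(p^j), where w(n) is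
    n^(-N) (ln n)^K / K! divided by its maximum; w is at least 1/e on [x, e x]
    and O(min(1, (x/n)^2)).  The set S = {} contributes O(x) by Chebyshev.  For the
    other S the sum is, up to sign, the K-th Taylor coefficient at s = N of
    L'/L(s, chi_S).  Under GRH, L has no zero on the disc |s - N| <= r =
    N - 1/2 - 1/N, so the coefficient is O(K r^(-K) log Q) with Q = 2^(2^(y+m)).
    By Stirling this is O(N^2 x^(1/2) log Q) after normalisation.

    With 2^y ~ x^(1/6) and 2^m ~ x^(1/6) / N, both contributions, and the number
    of p = 1 mod 2^y, give O(x^(5/6)) elite primes in [x, e x]; sum over N. *)

Require Import Defs.
From Stdlib Require Import Reals Lra Psatz Factorial.
From Coquelicot Require Import Coquelicot.
From mathcomp Require Import all_boot.
From mathcomp Require Import boolp.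
From mathcomp Require Import zify Rstruct.
From mathcomp Require all_order all_fingroup all_algebra all_solvable all_field.
From mathcomp Require complex ring.

Set Implicit Arguments.
Unset Strict Implicit.
Unset Printing Implicit Defensive.
Local Open Scope R_scope.

(** * Series *)

(** The exponent balances three costs: x / 2^y for the primes 1 modulo 2^y, x / 2^m for the trivial
    character, and x^(1/2) 2^(y+m) for the others, because the conductors are doubly exponential and
    log Q enters linearly. They meet at 2^y = 2^m = x^(1/6); the 1/N in 2^m and the division by ln p
    >= N absorb the remaining powers of N = ln x.

    Cauchy estimates are replaced by algebra. L(N - z) is a power series with explicit coefficients;
    compactness passes its lack of zeros on the disc to a partial sum, and this polynomial P factors
    over the complex numbers. Its logarithmic coefficient is a power sum of inverse roots, which is
    isolated by averaging ln |P| over roots of unity against 1 + cos and 1 - cos. Both kernels are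
    nonnegative, so an upper bound for |P| on the circle and a lower bound for P(0) suffice.

    The hypothesis concerns 0 < Re s < 1, but the disc also crosses the line Re s = 1. Nonvanishing
    there is classical: the 3-4-1 inequality off the real axis, and Monsky's argument at s = 1. *)

Lemma RsumS n (F : nat -> R) :
  \big[Rplus/0]_(i < n.+1) F i = \big[Rplus/0]_(i < n) F i + F n.
Proof. by rewrite big_ord_recr. Qed.

Lemma sum_n_big (f : nat -> R) n : sum_n f n = \big[Rplus/0]_(i < n.+1) f i.
Proof.
elim: n => [|n IHn]; first by rewrite sum_O big_ord_recl big_ord0 Rplus_0_r.
by rewrite sum_Sn big_ord_recr IHn.
Qed.

Lemma Rsum_le (I : Type) (r : seq I) (P : pred I) (F G : I -> R) :
  (forall i, P i -> F i <= G i) ->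
  \big[Rplus/0]_(i <- r | P i) F i <= \big[Rplus/0]_(i <- r | P i) G i.
Proof. by move=> FG; elim/big_ind2: _ => //; try lra; move=> *; lra. Qed.

Lemma Rsum_ge0 (I : Type) (r : seq I) (P : pred I) (F : I -> R) :
  (forall i, P i -> 0 <= F i) -> 0 <= \big[Rplus/0]_(i <- r | P i) F i.
Proof. by move=> FG; elim/big_ind: _ => //; try lra; move=> *; lra. Qed.

Lemma Rabs_bigsum (I : Type) (r : seq I) (P : pred I) (F : I -> R) :
  Rabs (\big[Rplus/0]_(i <- r | P i) F i) <= \big[Rplus/0]_(i <- r | P i) Rabs (F i).
Proof.
elim/big_ind2: _ => [|x1 x2 y1 y2 h1 h2|i _]; rewrite ?Rabs_R0; try lra.
by apply: Rle_trans (Rabs_triang _ _) _; lra.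
Qed.

Lemma Rsum_const n (c : R) : \big[Rplus/0]_(i < n) c = INR n * c.
Proof.
elim: n => [|n IHn]; first by rewrite big_ord0 /=; lra.
by rewrite big_ord_recr IHn S_INR /=; lra.
Qed.

Lemma Rsum_opp (I : Type) (r : seq I) (P : pred I) (F : I -> R) :
  \big[Rplus/0]_(i <- r | P i) (- F i) = - \big[Rplus/0]_(i <- r | P i) F i.
Proof. by elim/big_ind2: _ => [|x1 x2 y1 y2 -> ->|//]; lra. Qed.

Lemma ex_series_abs (a : nat -> R) :
  ex_series (fun n => Rabs (a n)) -> ex_series a.
Proof. exact: ex_series_Rabs. Qed.

Lemma ex_series_dom (a b : nat -> R) :
  (forall n, Rabs (a n) <= b n) -> ex_series b -> ex_series a.
Proof. by move=> ab eb; apply: (ex_series_le a b) => // n; exact: ab. Qed.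

Lemma Series_dom (a b : nat -> R) :
  (forall n, Rabs (a n) <= b n) -> ex_series b -> Rabs (Series a) <= Series b.
Proof.
move=> ab eb.
have ea : ex_series (fun n => Rabs (a n)).
  by apply: ex_series_dom eb => n; rewrite Rabs_Rabsolu.
apply: Rle_trans (Series_Rabs _ ea) _; apply: Series_le => // n.
by split; [exact: Rabs_pos | exact: ab].
Qed.

Lemma Series_ge0 (a : nat -> R) : (forall n, 0 <= a n) -> ex_series a -> 0 <= Series a.
Proof.
move=> a0 ea.
have := is_lim_seq_le (fun _ => 0) _ 0 (Series a) _ (is_lim_seq_const 0) (Series_correct _ ea).
by apply=> n; rewrite sum_n_big; apply: Rsum_ge0 => i _; apply: a0.
Qed.

Lemma is_series_bound (a : nat -> R) (l B : R) :
  (forall n, \big[Rplus/0]_(i < n) a i <= B) -> is_series a l -> l <= B.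
Proof.
move=> aB al; have := is_lim_seq_le _ (fun _ => B) l B.
apply; [|exact: al|exact: is_lim_seq_const].
by move=> n; rewrite sum_n_big.
Qed.

Lemma partial_le_Series (a : nat -> R) n :
  (forall i, 0 <= a i) -> ex_series a -> \big[Rplus/0]_(i < n) a i <= Series a.
Proof.
move=> a0 ea; have H := is_lim_seq_incr_compare _ _ (Series_correct _ ea).
case: n => [|n]; first by rewrite big_ord0; apply: Series_ge0.
rewrite -sum_n_big; apply: H => m; rewrite sum_Sn /plus /=.
by have := a0 m.+1; lra.
Qed.

Lemma ex_series_bounded (a : nat -> R) (B : R) :
  (forall i, 0 <= a i) -> (forall n, \big[Rplus/0]_(i < n) a i <= B) -> ex_series a.
Proof.
move=> a0 aB.
have : ex_finite_lim_seq (sum_n a).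
  apply: (ex_finite_lim_seq_incr _ B) => n.
    by rewrite sum_Sn /plus /=; have := a0 n.+1; lra.
  by rewrite sum_n_big; apply: aB.
by case=> l hl; exists l.
Qed.

Lemma telescope_bound (a g : nat -> R) n :
  (forall i, a i <= g i - g i.+1) -> (forall i, 0 <= g i) ->
  \big[Rplus/0]_(i < n) a i <= g 0%N.
Proof.
move=> ag g0; suff : \big[Rplus/0]_(i < n) a i <= g 0%N - g n.
  by have := g0 n; lra.
elim: n => [|n IHn].
  by rewrite big_ord0; lra.
by rewrite RsumS; have := ag n; lra.
Qed.

Lemma telescope_series (a g : nat -> R) :
  (forall i, 0 <= a i <= g i - g i.+1) -> (forall i, 0 <= g i) ->
  ex_series a /\ Series a <= g 0%N.
Proof.
move=> ag g0.
have ag' i : a i <= g i - g i.+1 by case: (ag i).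
have ea : ex_series a.
  apply: (@ex_series_bounded _ (g 0%N)) => [i|n]; first by case: (ag i).
  exact: telescope_bound.
split=> //; apply: is_series_bound (Series_correct _ ea) => n.
exact: telescope_bound.
Qed.

Lemma ex_series_inv_sq : ex_series (fun k => / INR k.+1 ^ 2).
Proof.
have [] // := @telescope_series (fun k => / INR k.+1 ^ 2) (fun k => 2 / INR k.+1).
- move=> i; have i0 : 0 <= INR i by apply: pos_INR.
  rewrite !S_INR; split; first by apply/Rlt_le/Rinv_0_lt_compat; nra.
  have -> : 2 / (INR i + 1) - 2 / (INR i + 1 + 1) = / ((INR i + 1) * (INR i + 1 + 1) / 2).
    by field; lra.
  by apply: Rinv_le_contravar; nra.
move=> i; have i0 : 0 <= INR i by apply: pos_INR.
by rewrite S_INR; apply: Rdiv_le_0_compat; lra.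
Qed.

Lemma Series_tail_split (a : nat -> R) n : ex_series a ->
  Series a = \big[Rplus/0]_(i < n) a i + Series (fun k => a (n + k)%N).
Proof.
move=> ea; case: n => [|n].
  by rewrite big_ord0 Rplus_0_l; apply: Series_ext.
rewrite (Series_incr_n _ n.+1) //; last by lia.
by congr (_ + _); rewrite -sum_n_big sum_n_Reals.
Qed.

Lemma ex_series_shift (a : nat -> R) n : ex_series a -> ex_series (fun k => a (n + k)%N).
Proof. by move=> ea; apply/(ex_series_incr_n a n). Qed.

Lemma tail_lim0 (a : nat -> R) : ex_series a ->
  is_lim_seq (fun n => Series (fun k => a (n + k)%N)) 0.
Proof.
move=> ea.
apply: (is_lim_seq_ext (fun n => Series a - \big[Rplus/0]_(i < n) a i)).
  by move=> n; rewrite (Series_tail_split n ea); lra.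
have -> : Rbar.Finite 0 = Rbar.Finite (Series a - Series a) by congr Rbar.Finite; lra.
apply: is_lim_seq_minus'; first exact: is_lim_seq_const.
apply/is_lim_seq_incr_1/(is_lim_seq_ext (sum_n a)); first by move=> n; rewrite sum_n_big.
exact: (Series_correct _ ea).
Qed.

Lemma is_lim_seq_epsP (u : nat -> R) (l : R) :
  is_lim_seq u l <-> (forall eps, 0 < eps -> exists N, forall n, (N <= n)%N -> Rabs (u n - l) < eps).
Proof.
split.
  move=> /is_lim_seq_spec H eps e0; have [N HN] := H (mkposreal _ e0).
  by exists N => n Nn; apply: HN; lia.
move=> H; apply/is_lim_seq_spec => eps; have [N HN] := H eps (cond_pos eps).
by exists N => n Nn; apply: HN; lia.
Qed.

Lemma is_lim_seq_big n (u : nat -> nat -> R) (l : nat -> R) :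
  (forall k, is_lim_seq (fun M => u M k) (l k)) ->
  is_lim_seq (fun M => \big[Rplus/0]_(k < n) u M k) (\big[Rplus/0]_(k < n) l k).
Proof.
move=> ul; elim: n => [|n IHn].
  rewrite big_ord0; apply: is_lim_seq_ext (is_lim_seq_const 0) => M.
  by rewrite big_ord0.
rewrite big_ord_recr /=.
apply: (is_lim_seq_ext (fun M => \big[Rplus/0]_(k < n) u M k + u M n)).
  by move=> M; rewrite big_ord_recr.
exact: is_lim_seq_plus'.
Qed.

Lemma Tannery (u : nat -> nat -> R) (l c : nat -> R) :
  (forall M k, Rabs (u M k) <= c k) -> ex_series c ->
  (forall k, is_lim_seq (fun M => u M k) (l k)) ->
  is_lim_seq (fun M => Series (u M)) (Series l).
Proof.
move=> uc ec ul.
have lc k : Rabs (l k) <= c k.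
  have := is_lim_seq_le _ (fun _ => c k) _ _ (fun M => uc M k) (is_lim_seq_abs _ _ (ul k)) (is_lim_seq_const _).
  by [].
have eu M : ex_series (u M) by apply: ex_series_dom ec.
have el : ex_series l by apply: ex_series_dom ec.
apply/is_lim_seq_epsP => eps e0.
have /is_lim_seq_epsP/(_ (eps / 4)) [|n Hn] := tail_lim0 ec; first by lra.
have /is_lim_seq_epsP/(_ (eps / 4)) [|M0 HM] := @is_lim_seq_big n _ _ ul; first by lra.
exists M0 => M MM; have {}HM := HM _ MM.
rewrite (Series_tail_split n (eu M)) (Series_tail_split n el).
have h1 := Series_dom (fun k => uc M (n + k)%N) (ex_series_shift n ec).
have h2 := Series_dom (fun k => lc (n + k)%N) (ex_series_shift n ec).
have h3 := Hn n (leqnn n).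
move: HM h1 h2 h3; rewrite Rminus_0_r => HM h1 h2 /Rabs_def2[h3 h4].
split_Rabs; lra.
Qed.

Lemma dvdn_block p M (G : nat -> R) : (0 < p)%N ->
  \big[Rplus/0]_(k < p * M) (if (p %| k.+1)%N then G k.+1 else 0) =
  \big[Rplus/0]_(m < M) G (p * m.+1)%N.
Proof.
move=> p0; elim: M => [|M IHM]; first by rewrite muln0 !big_ord0.
rewrite (RsumS M (fun m => G (p * m.+1)%N)) -IHM mulnSr big_split_ord /=; congr Rplus.
case: p p0 {IHM} => // p _; rewrite big_ord_recr /= big1 ?Rplus_0_l => [|i _].
  by rewrite (_ : (p.+1 * M + p).+1 = (p.+1 * M.+1)%N) ?dvdn_mulr ?mulnSr //; lia.
rewrite -addnS dvdn_addr ?dvdn_mulr //.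
by case: ifP => // /dvdn_leq -/(_ isT); have := ltn_ord i; lia.
Qed.

(** The partial sums of length p M on the left are those of length M on the right, so the limits
    agree. Used to sieve out the multiples of p and to expand Lambert series. *)
Lemma series_multiples p (G : nat -> R) : (0 < p)%N ->
  ex_series (fun k => Rabs (G k.+1)) ->
  ex_series (fun m => Rabs (G (p * m.+1)%N)) /\
  Series (fun k => if (p %| k.+1)%N then G k.+1 else 0) = Series (fun m => G (p * m.+1)%N).
Proof.
move=> p0 eG.
have e1 : ex_series (fun m => Rabs (G (p * m.+1)%N)).
  apply: (@ex_series_bounded _ (Series (fun k => Rabs (G k.+1)))) => [i|n].
    exact: Rabs_pos.
  rewrite -(dvdn_block n (fun j => Rabs (G j)) p0).
  apply: Rle_trans (partial_le_Series (p * n) _ eG); last by move=> ?; exact: Rabs_pos.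
  by apply: Rsum_le => i _; case: ifP => _; [exact: Rle_refl | exact: Rabs_pos].
split=> //.
have e2 : ex_series (fun k => if (p %| k.+1)%N then G k.+1 else 0).
  by apply: ex_series_dom eG => k; case: ifP => _; [lra | rewrite Rabs_R0; exact: Rabs_pos].
have l1 : is_lim_seq _ (Rbar.Finite _) := Series_correct _ e2.
have l2 : is_lim_seq _ (Rbar.Finite _) := Series_correct _ (ex_series_abs e1).
have l3 : is_lim_seq (fun M => sum_n (fun k => if (p %| k.+1)%N then G k.+1 else 0) (p * M.+1).-1)
            (Series (fun k => if (p %| k.+1)%N then G k.+1 else 0)).
  apply: (is_lim_seq_subseq (sum_n _) _ (fun M => (p * M.+1).-1) _ l1).
  by apply: eventually_subseq => n; nia.
have l4 : is_lim_seq (fun M => sum_n (fun k => if (p %| k.+1)%N then G k.+1 else 0) (p * M.+1).-1)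
            (Series (fun m => G (p * m.+1)%N)).
  apply: (is_lim_seq_ext (sum_n (fun m => G (p * m.+1)%N))); last exact: l2.
  by move=> n; rewrite !sum_n_big prednK ?muln_gt0 ?p0 // dvdn_block.
by have := is_lim_seq_unique _ _ l3; rewrite (is_lim_seq_unique _ _ l4) => -[].
Qed.

(** * The complex exponential and log |1 - rho e^(i phi)| *)

Lemma INR_fact_pos k : 0 < INR (fact k).
Proof. exact: INR_fact_lt_0. Qed.

Lemma is_series_exp x : is_series (fun k => x ^ k / INR (fact k)) (exp x).
Proof.
apply: is_series_ext (is_exp_Reals x) => k.
by rewrite /scal /= /mult /= pow_n_pow.
Qed.

Lemma pow_fact_le_exp x k : 0 <= x -> x ^ k / INR (fact k) <= exp x.
Proof.
move=> x0.
have p i : 0 <= x ^ i / INR (fact i).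
  by apply: Rdiv_le_0_compat; [exact: pow_le | exact: INR_fact_pos].
rewrite -(is_series_unique _ _ (@is_series_exp x)).
apply: Rle_trans (@partial_le_Series _ k.+1 p _); last by exists (exp x); exact: is_series_exp.
rewrite (RsumS k (fun k => x ^ k / INR (fact k))).
have : 0 <= \big[Rplus/0]_(i < k) (x ^ i / INR (fact i)) by apply: Rsum_ge0.
by move=> h; lra.
Qed.

Lemma CV_radius_gt (a : nat -> R) (r M x : R) :
  (forall n, Rabs (a n * r ^ n) <= M) -> Rabs x < r -> Rbar_lt (Rabs x) (CV_radius a).
Proof.
move=> aM xr; apply: (Rbar_lt_le_trans _ r) => //.
by apply: (proj1 (CV_radius_bounded a)); exists M.
Qed.

Lemma const_of_derive0 (f : R -> R) (b : R) : 0 <= b ->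
  (forall t, 0 <= t <= b -> is_derive f t 0) -> f b = f 0.
Proof.
move=> [b0|<-] // Hf; symmetry; exact: eq_is_derive.
Qed.

Lemma Rabs_Re_pow (w : C) k : Rabs (Re (w ^ k)%C) <= Cmod w ^ k.
Proof. by rewrite -Cmod_pow; exact: re_le_Cmod. Qed.

Lemma Rabs_Im_le (z : C) : Rabs (Im z) <= Cmod z.
Proof.
by apply: Rle_trans (proj1 (sqrt_plus_sqr z.1 z.2)); exact: Rmax_r.
Qed.

Lemma Rabs_Im_pow (w : C) k : Rabs (Im (w ^ k)%C) <= Cmod w ^ k.
Proof. by rewrite -Cmod_pow; exact: Rabs_Im_le. Qed.

Lemma Re_mult (u v : C) : Re (u * v)%C = Re u * Re v - Im u * Im v.
Proof. by []. Qed.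

Lemma Im_mult (u v : C) : Im (u * v)%C = Re u * Im v + Im u * Re v.
Proof. by []. Qed.

Section CexpSeries.
Variable w : C.
Let x := Re w.
Let y := Im w.
Let aR k := Re (w ^ k)%C / INR (fact k).
Let aI k := Im (w ^ k)%C / INR (fact k).

Lemma Cexp_coef_bound (a : nat -> R) r n : 0 <= r ->
  (forall k, Rabs (a k) <= Cmod w ^ k) -> Rabs (a n / INR (fact n) * r ^ n) <= exp (Cmod w * r).
Proof.
move=> r0 ab; apply: Rle_trans (pow_fact_le_exp n _); last first.
  by apply: Rmult_le_pos => //; exact: Cmod_ge_0.
have f0 := INR_fact_pos n.
rewrite Rabs_mult Rabs_div ?(Rabs_pos_eq (INR _)) ?(Rabs_pos_eq (r ^ n)); [|by apply: pow_le|by lra|by lra].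
rewrite Rpow_mult_distr /Rdiv Rmult_assoc (Rmult_comm (/ _)) -!Rmult_assoc.
apply: Rmult_le_compat_r; first by apply/Rlt_le/Rinv_0_lt_compat.
by apply: Rmult_le_compat_r; [exact: pow_le | exact: ab].
Qed.

Lemma Cexp_CV t (a : nat -> R) : (forall k, Rabs (a k) <= Cmod w ^ k) ->
  Rbar_lt (Rabs t) (CV_radius (fun k => a k / INR (fact k))).
Proof.
move=> ab; apply: (@CV_radius_gt _ (Rabs t + 1) (exp (Cmod w * (Rabs t + 1)))); last lra.
by move=> n; apply: Cexp_coef_bound => //; have := Rabs_pos t; lra.
Qed.

(** [PSeries aR t] and [PSeries aI t] are the components of the series for exp (t w) with t real;
    the system is the equation E' = w E. *)
Lemma Cexp_PSderive t :
  is_derive (PSeries aR) t (x * PSeries aR t - y * PSeries aI t) /\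
  is_derive (PSeries aI) t (y * PSeries aR t + x * PSeries aI t).
Proof.
have cR := Cexp_CV t (Rabs_Re_pow w); have cI := Cexp_CV t (Rabs_Im_pow w).
have eR := CV_radius_inside _ _ cR; have eI := CV_radius_inside _ _ cI.
have S k c : INR k.+1 * (c / INR (fact k.+1)) = c / INR (fact k).
  rewrite -[fact k.+1]/(k.+1 * fact k)%coq_nat mult_INR; field.
  by have := INR_fact_pos k; have := pos_INR k; rewrite S_INR; lra.
split.
- rewrite (_ : _ - _ = PSeries (PS_derive aR) t); first exact: is_derive_PSeries.
  rewrite -2!PSeries_scal -PSeries_minus; [|by apply: ex_pseries_scal => //; exact: Rmult_comm|by apply: ex_pseries_scal => //; exact: Rmult_comm].
  apply: PSeries_ext => k.
  change (x * aR k + - (y * aI k) = INR k.+1 * (Re (w ^ k.+1)%C / INR (fact k.+1))).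
  by rewrite S Cpow_S ?Re_mult ?Im_mult /aR /aI /x /y /Rdiv; ring.
rewrite (_ : _ + _ = PSeries (PS_derive aI) t); first exact: is_derive_PSeries.
rewrite -2!PSeries_scal -PSeries_plus; [|by apply: ex_pseries_scal => //; exact: Rmult_comm|by apply: ex_pseries_scal => //; exact: Rmult_comm].
apply: PSeries_ext => k.
change (y * aR k + x * aI k = INR k.+1 * (Im (w ^ k.+1)%C / INR (fact k.+1))).
by rewrite S Cpow_S ?Re_mult ?Im_mult /aR /aI /x /y /Rdiv; ring.
Qed.

Lemma Cexp_PSeries : PSeries aR 1 = Re (Cexp w) /\ PSeries aI 1 = Im (Cexp w).
Proof.
(* [D1] and [D2] are the real and imaginary parts of exp (- t w) times the series. They are constant
   in t, hence 1 and 0, and undoing the rotation and the scaling at t = 1 gives the claim. *)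
pose D1 t := exp (- x * t) * (PSeries aR t * cos (y * t) + PSeries aI t * sin (y * t)).
pose D2 t := exp (- x * t) * (PSeries aI t * cos (y * t) - PSeries aR t * sin (y * t)).
have d1 t : is_derive D1 t 0.
  have [dR dI] := Cexp_PSderive t.
  rewrite /D1; auto_derive; first by repeat split; eexists; eassumption.
  by rewrite (is_derive_unique _ _ _ dR) (is_derive_unique _ _ _ dI); ring.
have d2 t : is_derive D2 t 0.
  have [dR dI] := Cexp_PSderive t.
  rewrite /D2; auto_derive; first by repeat split; eexists; eassumption.
  by rewrite (is_derive_unique _ _ _ dR) (is_derive_unique _ _ _ dI); ring.
have h1 := @const_of_derive0 _ 1 Rle_0_1 (fun t _ => d1 t).
have h2 := @const_of_derive0 _ 1 Rle_0_1 (fun t _ => d2 t).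
move: h1 h2; rewrite /D1 /D2 !PSeries_0 !Rmult_0_r !Rmult_1_r cos_0 sin_0 exp_0.
rewrite {2 4}/aR {2 4}/aI /= !Rmult_0_r !Rmult_1_r Rmult_1_l.
have e : exp x * exp (- x) = 1 by rewrite -exp_plus Rplus_opp_r exp_0.
have cs := sin2_cos2 y; rewrite /Rsqr in cs.
set E := exp (- x) in e *; set P := PSeries aR 1; set Q := PSeries aI 1.
move=> h1 h2; rewrite -/x -/y; split.
  have -> : P = (exp x * E) * P * (sin y * sin y + cos y * cos y) by rewrite e cs; ring.
  have -> : exp x * E * P * (sin y * sin y + cos y * cos y) = exp x * (cos y * (E * (P * cos y + Q * sin y)) - sin y * (E * (Q * cos y - P * sin y))) by ring.
  by rewrite h1 h2; field.
have -> : Q = (exp x * E) * Q * (sin y * sin y + cos y * cos y) by rewrite e cs; ring.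
have -> : exp x * E * Q * (sin y * sin y + cos y * cos y) = exp x * (sin y * (E * (P * cos y + Q * sin y)) + cos y * (E * (Q * cos y - P * sin y))) by ring.
by rewrite h1 h2; field.
Qed.

End CexpSeries.

Lemma is_series_Cexp (w : C) :
  is_series (fun k => Re (w ^ k)%C / INR (fact k)) (Re (Cexp w)) /\
  is_series (fun k => Im (w ^ k)%C / INR (fact k)) (Im (Cexp w)).
Proof.
have [<- <-] := Cexp_PSeries w; split.
  have := PSeries_correct _ _ (CV_radius_inside _ _ (Cexp_CV 1 (Rabs_Re_pow w))).
  by apply: is_series_ext => k; rewrite pow_n_pow /scal /= /mult /= pow1 Rmult_1_l.
have := PSeries_correct _ _ (CV_radius_inside _ _ (Cexp_CV 1 (Rabs_Im_pow w))).
by apply: is_series_ext => k; rewrite pow_n_pow /scal /= /mult /= pow1 Rmult_1_l.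
Qed.

Lemma Cexp_plus (a b : C) : Cexp (a + b)%C = (Cexp a * Cexp b)%C.
Proof.
case: a b => a1 a2 [b1 b2]; rewrite /Cexp /Cmult /= exp_plus cos_plus sin_plus.
by f_equal; ring.
Qed.

Lemma Cmod_Cexp (z : C) : Cmod (Cexp z) = exp (Re z).
Proof.
rewrite /Cexp /Cmod /=.
have -> : forall e c s : R, e * c * (e * c * 1) + e * s * (e * s * 1) = Rsqr e * (Rsqr s + Rsqr c).
  by move=> *; rewrite /Rsqr; ring.
by rewrite sin2_cos2 Rmult_1_r sqrt_Rsqr //; apply/Rlt_le/exp_pos.
Qed.

Section LogCos.
Variable phi : R.
Let a k := cos (INR k * phi) / INR k.

Lemma cos_step k : cos (INR k.+2 * phi) = 2 * cos phi * cos (INR k.+1 * phi) - cos (INR k * phi).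
Proof.
have -> : INR k.+2 * phi = INR k.+1 * phi + phi by rewrite (S_INR k.+1); ring.
have -> : INR k * phi = INR k.+1 * phi - phi by rewrite (S_INR k); ring.
by rewrite cos_plus cos_minus; ring.
Qed.

Lemma cos_geom_partial t n :
  (1 - 2 * t * cos phi + t ^ 2) * \big[Rplus/0]_(k < n.+1) (cos (INR k.+1 * phi) * t ^ k) =
  cos phi - t - t ^ n.+1 * cos (INR n.+2 * phi) + t ^ n.+2 * cos (INR n.+1 * phi).
Proof.
elim: n => [|n IHn].
  by rewrite (RsumS 0 (fun k => cos (INR k.+1 * phi) * t ^ k)) big_ord0 (cos_step 0) /= Rmult_1_l Rmult_0_l cos_0; ring.
rewrite (RsumS n.+1 (fun k => cos (INR k.+1 * phi) * t ^ k)) Rmult_plus_distr_l IHn (cos_step n.+1) /=; ring.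
Qed.

Lemma quad_pos t : Rabs t < 1 -> 0 < 1 - 2 * t * cos phi + t ^ 2.
Proof.
move=> /Rabs_def2 t1; have c := COS_bound phi.
have : 2 * t * cos phi <= 2 * Rabs t.
  apply: Rle_trans (Rle_abs _) _; rewrite !Rabs_mult (Rabs_pos_eq 2); last lra.
  have : Rabs (cos phi) <= 1 by split_Rabs; lra.
  by have := Rabs_pos t; nra.
have : Rabs t ^ 2 = t ^ 2 by rewrite pow2_abs.
have : Rabs t < 1 by split_Rabs; lra.
by have := Rabs_pos t; nra.
Qed.

Lemma cos_geom t : Rabs t < 1 ->
  is_series (fun k => cos (INR k.+1 * phi) * t ^ k) ((cos phi - t) / (1 - 2 * t * cos phi + t ^ 2)).
Proof.
move=> t1; have q := quad_pos t1.
have gt0 := is_lim_seq_geom t t1.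
have bnd (u : nat -> nat) : is_lim_seq (fun n => t ^ n * cos (INR (u n) * phi)) 0.
  apply/is_lim_seq_abs_0.
  apply: (is_lim_seq_le_le (fun _ => 0) _ (fun n => Rabs t ^ n)); last first.
  - by apply: is_lim_seq_geom; rewrite Rabs_Rabsolu.
  - exact: is_lim_seq_const.
  move=> n; split; first exact: Rabs_pos.
  rewrite Rabs_mult -RPow_abs -{2}(Rmult_1_r (Rabs t ^ n)).
  apply: Rmult_le_compat_l; first by apply: pow_le; exact: Rabs_pos.
  by have := COS_bound (INR (u n) * phi) => c; split_Rabs; lra.
have l1 : is_lim_seq (fun n => (cos phi - t) - t ^ n.+1 * cos (INR n.+2 * phi) + t ^ n.+2 * cos (INR n.+1 * phi)) (cos phi - t - 0 + 0).
  apply: is_lim_seq_plus'; first apply: is_lim_seq_minus'.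
  - exact: is_lim_seq_const.
  - exact: (is_lim_seq_incr_1 (fun n => t ^ n * cos (INR n.+1 * phi)) 0).1 (bnd S).
  by have /is_lim_seq_incr_1/is_lim_seq_incr_1 := bnd predn.
have : is_lim_seq (sum_n (fun k => cos (INR k.+1 * phi) * t ^ k)) (/ (1 - 2 * t * cos phi + t ^ 2) * (cos phi - t - 0 + 0)).
  apply: is_lim_seq_ext (is_lim_seq_scal_l _ _ _ l1) => n.
  by rewrite sum_n_big -cos_geom_partial; field; lra.
by rewrite (_ : _ * _ = (cos phi - t) / (1 - 2 * t * cos phi + t ^ 2)) //; field; lra.
Qed.

Lemma logcos_CV t : Rabs t < 1 -> Rbar_lt (Rabs t) (CV_radius a).
Proof.
apply: (@CV_radius_gt _ 1 1) => n; rewrite pow1 Rmult_1_r /a.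
(* [a 0] is a division by zero, which has the value 0. *)
case: n => [|n]; first by rewrite /= /Rdiv Rinv_0 Rmult_0_r Rabs_R0; lra.
have n0 := pos_INR n; rewrite S_INR Rabs_div; last lra.
rewrite (Rabs_pos_eq (INR n + 1)); last lra.
apply/Rle_div_l; first lra.
have c := COS_bound ((INR n + 1) * phi).
by split_Rabs; lra.
Qed.

(** As functions of t, the series and - ln |1 - t e^(i phi)| have the same derivative Re (e^(i phi)
    / (1 - t e^(i phi))), which [cos_geom] expands, and both vanish at t = 0. *)
Lemma is_series_logcos rho : 0 <= rho < 1 ->
  is_series (fun j => rho ^ j.+1 * cos (INR j.+1 * phi) / INR j.+1)
    (- ln (1 - 2 * rho * cos phi + rho ^ 2) / 2).
Proof.
move=> [r0 r1].
have tr t : 0 <= t <= rho -> Rabs t < 1 by move=> ?; split_Rabs; lra.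
pose f t := PSeries a t + ln (1 - 2 * t * cos phi + t ^ 2) / 2.
have df t : 0 <= t <= rho -> is_derive f t 0.
  move=> /tr t1; have q := quad_pos t1.
  have d1 := is_derive_PSeries _ _ (logcos_CV t1).
  have e : PSeries (PS_derive a) t = (cos phi - t) / (1 - 2 * t * cos phi + t ^ 2).
    apply: is_series_unique; apply: is_series_ext (cos_geom t1) => k.
    change (cos (INR k.+1 * phi) * t ^ k = INR k.+1 * (cos (INR k.+1 * phi) / INR k.+1) * t ^ k).
    field; by have := pos_INR k; rewrite S_INR; lra.
  rewrite /f; auto_derive; first by split; [eexists; exact: d1|].
  by rewrite (is_derive_unique _ _ _ d1) e; field; rewrite /= in q; lra.
have := const_of_derive0 r0 df; rewrite /f PSeries_0 /a /= /Rdiv Rinv_0 !Rmult_0_r Rmult_0_l.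
rewrite Rminus_0_r Rmult_0_l Rplus_0_r ln_1 => h.
have -> : - ln (1 - 2 * rho * cos phi + rho * (rho * 1)) * / 2 = PSeries a rho - a 0%N.
  by rewrite {2}/a /= /Rdiv Rinv_0 Rmult_0_r; move: h; rewrite /a /Rdiv; lra.
have [l hl] := CV_radius_inside _ _ (logcos_CV (tr rho (conj r0 (Rle_refl _)))).
have -> : PSeries a rho = l.
  apply: is_series_unique; apply: is_series_ext hl => k.
  by rewrite pow_n_pow /scal /= /mult /= Rmult_comm.
have := is_series_incr_1 (fun k => a k * rho ^ k) (l - a 0%N).
have -> : plus (l - a 0%N) (a 0%N * rho ^ 0) = l by change (l - a 0%N + a 0%N * rho ^ 0 = l); ring.
move=> /(_ _)H; have {}H : is_series (fun k => a k.+1 * rho ^ k.+1) (l - a 0%N).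
  apply: H; apply: is_series_ext hl => k.
  by rewrite pow_n_pow /scal /= /mult /= Rmult_comm.
by apply: is_series_ext H => k; change (a k.+1 * rho ^ k.+1 = rho ^ k.+1 * cos (INR k.+1 * phi) / INR k.+1); rewrite /a /Rdiv; ring.
Qed.

End LogCos.

(** * Bounding power sums by averaging over roots of unity *)

Definition theta (M l : nat) : R := 2 * PI * INR l / INR M.

Lemma INR_gt0 n : (0 < n)%N -> 0 < INR n.
Proof. by move=> n0; apply: lt_0_INR; lia. Qed.

Lemma Rsum_mull n (c : R) (F : nat -> R) :
  \big[Rplus/0]_(i < n) (c * F i) = c * \big[Rplus/0]_(i < n) F i.
Proof. by rewrite big_distrr. Qed.

Lemma Rsum_add n (F G : nat -> R) :
  \big[Rplus/0]_(i < n) (F i + G i) = \big[Rplus/0]_(i < n) F i + \big[Rplus/0]_(i < n) G i.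
Proof. by rewrite big_split. Qed.

Lemma cos_sum_telescope a b n :
  2 * sin (a / 2) * \big[Rplus/0]_(l < n) cos (b + INR l * a) =
  sin (b + INR n * a - a / 2) - sin (b - a / 2).
Proof.
elim: n => [|n IHn]; first by rewrite big_ord0 /= Rmult_0_l; ring_simplify; rewrite Rplus_0_r; ring.
rewrite (RsumS n (fun l => cos (b + INR l * a))) Rmult_plus_distr_l IHn S_INR.
have -> : b + (INR n + 1) * a - a / 2 = (b + INR n * a) + a / 2 by field.
by rewrite sin_plus sin_minus; ring.
Qed.

Lemma cos_sum_roots M j psi : (0 < M)%N ->
  \big[Rplus/0]_(l < M) cos (psi + INR j * theta M l) = if (M %| j)%N then INR M * cos psi else 0.
Proof.
move=> M0; have M0' := INR_gt0 M0; case: ifP => [/dvdnP[d ->]|Mj].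
  rewrite -Rsum_const; apply: eq_bigr => l _.
  rewrite (_ : psi + _ = psi + 2 * INR (d * l) * PI) ?cos_period //.
  by rewrite /theta !mult_INR; field; lra.
have d0 : (0 < j %% M)%N by rewrite lt0n -/(dvdn M j) Mj.
have dM : (j %% M < M)%N by rewrite ltn_mod.
pose a := 2 * PI * INR (j %% M) / INR M.
have e l : cos (psi + INR j * theta M l) = cos (psi + INR l * a).
  rewrite {1}(divn_eq j M) plus_INR mult_INR.
  rewrite (_ : psi + _ = (psi + INR l * a) + 2 * INR (j %/ M * l) * PI) ?cos_period //.
  by rewrite /theta /a !mult_INR; field; lra.
rewrite (eq_bigr (fun l : 'I_M => cos (psi + INR l * a))); last by move=> l _; exact: e.
have s0 : 0 < sin (a / 2).
  have Pi := PI_RGT_0; have d0' := INR_gt0 d0.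
  have q : 0 < INR (j %% M) / INR M < 1.
    split; first by apply: Rdiv_lt_0_compat.
    by apply/Rlt_div_l => //; rewrite Rmult_1_l; apply: lt_INR; lia.
  by apply: sin_gt_0; rewrite /a /Rdiv; move: q; rewrite /Rdiv; nra.
have := cos_sum_telescope a psi M.
rewrite (_ : psi + INR M * a - a / 2 = (psi - a / 2) + 2 * INR (j %% M) * PI); last first.
  by rewrite /a; field; lra.
rewrite sin_period Rminus_diag => /Rmult_integral[|//]; lra.
Qed.

(** This is ln |1 - rho e^(i phi)|. *)
Definition halfln rho phi : R := ln (1 - 2 * rho * cos phi + rho ^ 2) / 2.

(** Average over the M-th roots of unity against the kernel 1 + eps cos (k t). For |eps| <= 1 the
    kernel is nonnegative, and for 0 < k < M it has mean 1, so upper bounds on [F] survive. *)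
Definition wavg M k eps (F : R -> R) : R :=
  / INR M * \big[Rplus/0]_(l < M) (F (theta M l) * (1 + eps * cos (INR k * theta M l))).

(** Averaging the cosine series termwise keeps the indices j + 1 that are 0, k or - k modulo M.
    Adding M in [j.+1 + M - k] keeps the subtraction from truncating. *)
Lemma halfln_avg rho phi k eps M : 0 <= rho < 1 -> (0 < M)%N -> (k <= M)%N ->
  is_series (fun j => rho ^ j.+1 * cos (INR j.+1 * phi) / INR j.+1 *
     ((if (M %| j.+1)%N then 1 else 0) + eps / 2 *
      ((if (M %| j.+1 + k)%N then 1 else 0) + (if (M %| j.+1 + M - k)%N then 1 else 0))))
   (- wavg M k eps (fun t => halfln rho (phi + t))).
Proof.
move=> rho1 M0 kM; have M0' := INR_gt0 M0.
have H n : is_series (fun j => \big[Rplus/0]_(l < n)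
     ((1 + eps * cos (INR k * theta M l)) * (rho ^ j.+1 * cos (INR j.+1 * (phi + theta M l)) / INR j.+1)))
    (\big[Rplus/0]_(l < n) ((1 + eps * cos (INR k * theta M l)) * (- halfln rho (phi + theta M l)))).
  elim: n => [|n IHn].
    rewrite big_ord0; apply: (is_series_ext (fun _ => 0)) => [j|]; first by rewrite big_ord0.
    by apply: is_lim_seq_ext (is_lim_seq_const 0) => m; rewrite sum_n_big big1.
  rewrite big_ord_recr /=.
  apply: (is_series_ext (fun j => \big[Rplus/0]_(l < n)
     ((1 + eps * cos (INR k * theta M l)) * (rho ^ j.+1 * cos (INR j.+1 * (phi + theta M l)) / INR j.+1))
     + ((1 + eps * cos (INR k * theta M n)) * (rho ^ j.+1 * cos (INR j.+1 * (phi + theta M n)) / INR j.+1)))).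
    by move=> j; rewrite [RHS]big_ord_recr.
  apply: is_series_plus IHn _; apply: is_series_scal.
  by have := @is_series_logcos (phi + theta M n) rho rho1; rewrite /halfln /Rdiv Ropp_mult_distr_l.
have := is_series_scal (/ INR M) _ _ (H M).
rewrite (_ : scal _ _ = - wavg M k eps (fun t => halfln rho (phi + t))); last first.
  rewrite /scal /= /mult /= /wavg Ropp_mult_distr_r -Rsum_opp; congr Rmult.
  by apply: eq_bigr => l _; ring.
apply: is_series_ext => j; rewrite /scal /= /mult /=.
change (/ INR M * \big[Rplus/0]_(l < M) ((1 + eps * cos (INR k * theta M l)) * (rho ^ j.+1 * cos (INR j.+1 * (phi + theta M l)) / INR j.+1)) =
 rho ^ j.+1 * cos (INR j.+1 * phi) / INR j.+1 *
     ((if (M %| j.+1)%N then 1 else 0) + eps / 2 *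
      ((if (M %| j.+1 + k)%N then 1 else 0) + (if (M %| j.+1 + M - k)%N then 1 else 0)))).
have j0 : 0 < INR j.+1 by apply: INR_gt0.
rewrite (eq_bigr (fun l : 'I_M => rho ^ j.+1 / INR j.+1 * (cos (INR j.+1 * phi + INR j.+1 * theta M l) + eps / 2 *
   (cos (INR j.+1 * phi + INR (j.+1 + k) * theta M l) + cos (INR j.+1 * phi + INR (j.+1 + M - k) * theta M l))))); last first.
  move=> l _.
  have -> : INR (j.+1 + M - k) = INR j.+1 - INR k + INR M.
    by rewrite minus_INR ?plus_INR; [ring | lia].
  have -> : INR j.+1 * phi + (INR j.+1 - INR k + INR M) * theta M l =
            (INR j.+1 * phi + INR j.+1 * theta M l - INR k * theta M l) + 2 * INR l * PI.
    by rewrite /theta; field; lra.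
  rewrite cos_period plus_INR.
  have -> : INR j.+1 * phi + (INR j.+1 + INR k) * theta M l = INR j.+1 * phi + INR j.+1 * theta M l + INR k * theta M l by ring.
  rewrite (cos_plus (_ + _)) cos_minus Rmult_plus_distr_l; field; lra.
have E1 := cos_sum_roots j.+1 (INR j.+1 * phi) M0.
have E2 := cos_sum_roots (j.+1 + k) (INR j.+1 * phi) M0.
have E3 := cos_sum_roots (j.+1 + M - k) (INR j.+1 * phi) M0.
move: (INR j.+1) (INR (j.+1 + k)) (INR (j.+1 + M - k)) (rho ^ j.+1) j0 E1 E2 E3 => J J1 J2 rj j0 E1 E2 E3.
rewrite -big_distrr big_split /= E1 -big_distrr big_split /= E2 E3.
by do 3 case: ifP => _; field; lra.
Qed.

(** As M grows, all the retained indices except k itself go to infinity. The mean of ln |1 - rho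
    e^(i t)| contributes nothing because rho < 1. *)
Lemma wavg_halfln_lim rho phi k eps : 0 <= rho < 1 -> (0 < k)%N ->  Rabs eps <= 1 ->
  is_lim_seq (fun M => - wavg (M + k).+1 k eps (fun t => halfln rho (phi + t)))
    (eps / 2 * (rho ^ k * cos (INR k * phi) / INR k)).
Proof.
move=> rho1 k0 e1.
pose c M j := (if (M %| j.+1)%N then 1 else 0) + eps / 2 *
      ((if (M %| j.+1 + k)%N then 1 else 0) + (if (M %| j.+1 + M - k)%N then 1 else 0)).
pose u M j := rho ^ j.+1 * cos (INR j.+1 * phi) / INR j.+1 * c (M + k).+1 j.
pose l j := rho ^ j.+1 * cos (INR j.+1 * phi) / INR j.+1 * (if j == k.-1 then eps / 2 else 0).
have -> : eps / 2 * (rho ^ k * cos (INR k * phi) / INR k) = Series l.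
  symmetry; apply: is_series_unique.
  change (is_lim_seq (sum_n l) (Rbar.Finite (eps / 2 * (rho ^ k * cos (INR k * phi) / INR k)))).
  apply: (is_lim_seq_ext_loc (fun _ => eps / 2 * (rho ^ k * cos (INR k * phi) / INR k))); last exact: is_lim_seq_const.
  exists k => n kn; rewrite sum_n_big.
  have kn' : (k.-1 < n.+1)%N by lia.
  rewrite (bigD1 (Ordinal kn')) //= big1 ?Rplus_0_r => [|i ik].
    by rewrite /l eqxx prednK // Rmult_comm.
  by rewrite /l -(inj_eq val_inj) /= in ik *; rewrite (negbTE ik) Rmult_0_r.
apply: (is_lim_seq_ext (fun M => Series (u M))).
  move=> M; apply: is_series_unique; apply: halfln_avg => //; lia.
apply: (@Tannery u l (fun j => 2 * rho * rho ^ j)).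
- move=> M j; rewrite /u.
  have c2 : Rabs (c (M + k).+1 j) <= 2.
    by rewrite /c; do 3 case: ifP => _; split_Rabs; lra.
  have j0 : 1 <= INR j.+1 by rewrite S_INR; have := pos_INR j; lra.
  have a1 : Rabs (rho ^ j.+1 * cos (INR j.+1 * phi) / INR j.+1) <= rho * rho ^ j.
    rewrite Rabs_div; last lra; rewrite (Rabs_pos_eq (INR _)); last lra.
    apply/Rle_div_l; first lra.
    have p : 0 <= rho ^ j.+1 by apply: pow_le; lra.
    have p' : rho ^ j.+1 = rho * rho ^ j by [].
    rewrite Rabs_mult (Rabs_pos_eq _ p) p'.
    have := COS_bound (INR j.+1 * phi) => cb.
    have : Rabs (cos (INR j.+1 * phi)) <= 1 by split_Rabs; lra.
    rewrite p' in p; nra.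
  rewrite Rabs_mult (_ : 2 * rho * rho ^ j = rho * rho ^ j * 2); last ring.
  by apply: Rmult_le_compat => //; exact: Rabs_pos.
- apply: ex_series_scal_l; apply: ex_series_geom.
  by rewrite Rabs_pos_eq; lra.
move=> j.
apply: (is_lim_seq_ext_loc (fun _ => l j)); last exact: is_lim_seq_const.
exists (j + k).+1 => M jM; rewrite /l /u; congr Rmult; rewrite /c.
have -> : ((M + k).+1 %| j.+1)%N = false by rewrite gtnNdvd //; lia.
have -> : ((M + k).+1 %| j.+1 + k)%N = false by rewrite gtnNdvd //; lia.
case: eqP => [->|jk].
  by rewrite prednK // (_ : (k + (M + k).+1 - k = (M + k).+1)%N) ?dvdnn; [lra|lia].
case: ifP => [|_]; last lra.
case/dvdnP => d; case: d => [|[|d]]; nia.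
Qed.

(** The kernel is nonnegative of mean 1, so its average of the sum of [halfln] is at most A; in the
    limit that average is - eps / (2 k) times the power sum. The signs eps = 1 and eps = -1 give the
    two inequalities. *)
Lemma power_sum_bound (s : seq (R * R)) k A : (0 < k)%N ->
  (forall x, x \in s -> 0 <= x.1 < 1) ->
  (forall t, \big[Rplus/0]_(x <- s) halfln x.1 (x.2 + t) <= A) ->
  Rabs (\big[Rplus/0]_(x <- s) (x.1 ^ k * cos (INR k * x.2))) <= 2 * INR k * A.
Proof.
move=> k0 s1 sA; have k0' := INR_gt0 k0.
have H eps : Rabs eps = 1 ->
    - (eps / 2 * (\big[Rplus/0]_(x <- s) (x.1 ^ k * cos (INR k * x.2)) / INR k)) <= A.
  move=> e1.
  have L : is_lim_seq (fun M => \big[Rplus/0]_(x <- s) - wavg (M + k).+1 k eps (fun t => halfln x.1 (x.2 + t)))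
     (eps / 2 * (\big[Rplus/0]_(x <- s) (x.1 ^ k * cos (INR k * x.2)) / INR k)).
    elim: s s1 {sA} => [|x s IHs] s1.
      rewrite big_nil (_ : _ * _ = 0); last by field; lra.
      by apply: is_lim_seq_ext (is_lim_seq_const 0) => M; rewrite big_nil.
    rewrite big_cons /Rdiv Rmult_plus_distr_r Rmult_plus_distr_l.
    apply: (is_lim_seq_ext (fun M => - wavg (M + k).+1 k eps (fun t => halfln x.1 (x.2 + t)) +
       \big[Rplus/0]_(x <- s) - wavg (M + k).+1 k eps (fun t => halfln x.1 (x.2 + t)))).
      by move=> M; rewrite big_cons.
    apply: is_lim_seq_plus'.
      by apply: wavg_halfln_lim => //; [apply: s1; rewrite mem_head | lra].
    by apply: IHs => y ys; apply: s1; rewrite in_cons ys orbT.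
  suff /(_ _)Hm : forall M, - A <= \big[Rplus/0]_(x <- s) - wavg (M + k).+1 k eps (fun t => halfln x.1 (x.2 + t)).
    have := is_lim_seq_le (fun _ => - A) _ (Rbar.Finite (- A)) _ Hm (is_lim_seq_const _) L.
    by rewrite /Rbar_le; lra.
  move=> M; rewrite Rsum_opp; apply: Ropp_le_contravar.
  have M0 : 0 < INR (M + k).+1 by apply: INR_gt0.
  rewrite /wavg -big_distrr /= exchange_big /=.
  have : \big[Rplus/0]_(l < (M + k).+1) \big[Rplus/0]_(x <- s)
      (halfln x.1 (x.2 + theta (M + k).+1 l) * (1 + eps * cos (INR k * theta (M + k).+1 l)))
    <= \big[Rplus/0]_(l < (M + k).+1) (A + A * eps * cos (0 + INR k * theta (M + k).+1 l)).
    apply: Rsum_le => l _; rewrite -big_distrl /= Rplus_0_l.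
    rewrite (_ : A + _ = A * (1 + eps * cos (INR k * theta (M + k).+1 l))); last ring.
    apply: Rmult_le_compat_r; last exact: sA.
    have := COS_bound (INR k * theta (M + k).+1 l).
    by move: e1; split_Rabs; nra.
  rewrite big_split Rsum_const (Rsum_mull _ (A * eps) (fun l => cos (0 + INR k * theta (M + k).+1 l))).
  rewrite cos_sum_roots // gtnNdvd //; last lia.
  rewrite Rmult_0_r /= Rplus_0_r => h.
  by apply: (Rmult_le_reg_l _ _ _ M0); rewrite -Rmult_assoc Rinv_r ?Rmult_1_l //; lra.
have h1 := H 1 Rabs_R1; have h2 := H (-1); rewrite Rabs_Ropp Rabs_R1 in h2; have {}h2 := h2 erefl.
set S := \big[Rplus/0]_(x <- s) _ in h1 h2 *.
have eS : S = S / INR k * INR k by field; lra.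
have {}h1 : - S <= 2 * INR k * A by rewrite eS; move: (S / INR k) h1 => q; nra.
have {}h2 : S <= 2 * INR k * A by rewrite eS; move: (S / INR k) h2 => q; nra.
by split_Rabs; lra.
Qed.

Lemma polar_real (x y : R) : exists rho phi, 0 <= rho /\ x = rho * cos phi /\ y = rho * sin phi.
Proof.
have N0 : 0 <= x * x + y * y by nra.
pose rho := sqrt (x * x + y * y).
have r2 : rho * rho = x * x + y * y by apply: sqrt_def.
have rho0 : 0 <= rho by apply: sqrt_pos.
suff [phi e] : exists phi, x = rho * cos phi /\ y = rho * sin phi by exists rho, phi.
case: (Rle_lt_or_eq_dec _ _ rho0) => [rp|r0]; last first.
  by exists 0; rewrite -r0 in r2 *; split; nra.
have c1 : -1 <= x / rho <= 1.
  by split; [apply/Rle_div_r|apply/Rle_div_l] => //; nra.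
have s1 : sin (acos (x / rho)) = Rabs y / rho.
  rewrite sin_acos //.
  have -> : 1 - Rsqr (x / rho) = Rsqr (Rabs y / rho).
    rewrite (Rsqr_div' (Rabs y)) -Rsqr_abs.
    apply: (Rmult_eq_reg_r (rho * rho)); last by nra.
    rewrite [LHS](_ : _ = rho * rho - x * x); last by rewrite /Rsqr; field; lra.
    by rewrite [RHS](_ : _ = y * y); [lra | rewrite /Rsqr; field; lra].
  by rewrite sqrt_Rsqr //; apply: Rdiv_le_0_compat => //; exact: Rabs_pos.
case: (Rle_dec 0 y) => y0.
  exists (acos (x / rho)); rewrite s1 cos_acos // Rabs_pos_eq //.
  by split; field; lra.
exists (- acos (x / rho)); rewrite cos_neg sin_neg s1 cos_acos // Rabs_left; last lra.
by split; field; lra.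
Qed.

(** * Coefficients of logarithmic derivatives *)

Module LogDerPoly.
Import mathcomp.order.all_order mathcomp.algebra.all_algebra complex ring.
Import GRing.Theory Num.Theory Order.TTheory ComplexField.Normc.
Local Open Scope ring_scope.

Section Formal.
Variable F : fieldType.

(** The expansion of 1 / (X - z) at 0, in degrees below m. *)
Definition geoser (m : nat) (z : F) : {poly F} := \poly_(k < m) - z^-1 ^+ k.+1.

Lemma geoserP m (z : F) : z != 0 -> 'X^m %| 1 - geoser m z * ('X - z%:P).
Proof.
move=> z0; suff -> : 1 - geoser m z * ('X - z%:P) = (z^-1 ^+ m)%:P * 'X^m by rewrite dvdp_mull.
elim: m => [|m IHm].
  by rewrite /geoser poly_def big_ord0 mul0r subr0 !expr0 mulr1.
have -> : geoser m.+1 z = geoser m z - (z^-1 ^+ m.+1)%:P * 'X^m.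
  by rewrite /geoser !poly_def big_ord_recr /= scaleNr -mul_polyC.
rewrite mulrBl opprB addrCA IHm.
have -> : (z^-1 ^+ m)%:P = (z^-1 ^+ m.+1)%:P * z%:P :> {poly F}.
  by rewrite -polyCM exprSr -mulrA mulVf // mulr1.
by rewrite [in RHS](exprS 'X); move: (_%:P) ('X^m) => c Y; ring.
Qed.

(** Divisibility of P' - H P by X^m says that H is P' / P up to order m. In this form the Leibniz
    rule makes logarithmic derivatives add without any power series. *)
Lemma LD_mul m (P Q H J : {poly F}) :
  'X^m %| P^`() - H * P -> 'X^m %| Q^`() - J * Q ->
  'X^m %| (P * Q)^`() - (H + J) * (P * Q).
Proof.
move=> dP dQ; rewrite derivM.
have -> : P^`() * Q + P * Q^`() - (H + J) * (P * Q) =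
  (P^`() - H * P) * Q + P * (Q^`() - J * Q).
  by rewrite mulrDl mulrBl mulrBr opprD addrACA !mulrA (mulrC J).
by apply: dvdp_add; [exact: dvdp_mulr | exact: dvdp_mull].
Qed.

Lemma LD_prod m (c : F) (s : seq F) : all (fun z => z != 0) s ->
  'X^m %| (c *: \prod_(z <- s) ('X - z%:P))^`() -
     (\sum_(z <- s) geoser m z) * (c *: \prod_(z <- s) ('X - z%:P)).
Proof.
elim: s => [|z s IHs] /=.
  by rewrite !big_nil mul0r subr0 derivZ derivC scaler0 dvdp0.
case/andP=> z0 /IHs dP; rewrite !big_cons.
rewrite scalerAr; apply: LD_mul => //.
by rewrite derivXsubC geoserP.
Qed.

Lemma conv_uniq (b h t : nat -> F) K : b 0%N != 0 ->
  (forall k, (k <= K)%N -> \sum_(i < k.+1) h i * b (k - i)%N = \sum_(i < k.+1) t i * b (k - i)%N) ->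
  h K = t K.
Proof.
move=> b0; elim: K {-2}K (leqnn K) => [|n IHn] K.
  rewrite leqn0 => /eqP -> /(_ 0%N (leqnn _)).
  by rewrite !big_ord_recl !big_ord0 !addr0 /= => /(mulIf b0).
move=> Kn H; have := H K (leqnn K); rewrite !big_ord_recr /= subnn.
have -> : \sum_(i < K) h i * b (K - i)%N = \sum_(i < K) t i * b (K - i)%N.
  apply: eq_bigr => i _; congr (_ * _); apply: IHn => [|k ki].
    by have := ltn_ord i; lia.
  by apply: H; have := ltn_ord i; lia.
by move/addrI/(mulIf b0).
Qed.

(** A form of Newton's identities: the recursion determines h because b 0 is nonzero, and P' / P,
    the sum of 1 / (X - z) over the roots with multiplicity, solves it. *)
Lemma LD_coef (c : F) (s : seq F) (b h : nat -> F) n K : (K < n)%N ->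
  b 0%N != 0 -> all (fun z => z != 0) s ->
  \poly_(k < n.+1) b k = c *: \prod_(z <- s) ('X - z%:P) ->
  (forall k, (k <= K)%N -> k.+1%:R * b k.+1 = \sum_(i < k.+1) h i * b (k - i)%N) ->
  h K = - \sum_(z <- s) z^-1 ^+ K.+1.
Proof.
move=> Kn b0 s0 E Hh.
pose t k : F := - \sum_(z <- s) z^-1 ^+ k.+1.
apply: (@conv_uniq b h t K b0) => k kK; rewrite -Hh //.
have := LD_prod K.+1 c s0; rewrite -E => /dvdpP[q /(congr1 (fun p : {poly F} => p`_k))].
rewrite coefMXn ltnS kK coefB => /eqP; rewrite subr_eq0 => /eqP.
rewrite coef_deriv coef_poly ltnS (leq_trans _ Kn) // mulr_natl => ->.
rewrite coefM; apply: eq_bigr => i _; congr (_ * _).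
  rewrite coef_sum (eq_bigr (fun z => - (z^-1 ^+ i.+1))) ?sumrN // => z _.
  by rewrite coef_poly ltnS (leq_trans _ kK) // -ltnS ltn_ord.
by rewrite coef_poly; case: ifP => //; have := ltn_ord i; lia.
Qed.

End Formal.

Section Nsq.
Variable K : rcfType.
Local Notation C := K[i].

Definition nsq (z : C) : K := complex.Re z ^+ 2 + complex.Im z ^+ 2.

Lemma nsqM (z w : C) : nsq (z * w) = nsq z * nsq w.
Proof. by case: z w => a b [c d]; rewrite /nsq /=; ring. Qed.

Lemma nsq_prod (s : seq C) (f : C -> C) : nsq (\prod_(z <- s) f z) = \prod_(z <- s) nsq (f z).
Proof.
elim: s => [|z s IHs]; first by rewrite !big_nil /nsq /=; ring.
by rewrite !big_cons nsqM IHs.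
Qed.

Lemma nsq_normc (z : C) : nsq z = normc z ^+ 2.
Proof. by case: z => a b; rewrite /nsq /= sqr_sqrtr // addr_ge0 ?sqr_ge0. Qed.

Lemma nsqV (z : C) : nsq z^-1 = (nsq z)^-1.
Proof. by rewrite !nsq_normc normcV exprVn. Qed.

Lemma nsq_real (x : K) : nsq (real_complex K x) = x ^+ 2.
Proof. by rewrite /nsq /=; ring. Qed.

Lemma nsq_eq0 (z : C) : (nsq z == 0) = (z == 0).
Proof.
case: z => a b; rewrite /nsq /= paddr_eq0 ?sqr_ge0 // !sqrf_eq0.
by rewrite eq_complex.
Qed.

Lemma normc_sum n (f : 'I_n -> C) : normc (\sum_(i < n) f i) <= \sum_(i < n) normc (f i).
Proof.
elim: n f => [|n IHn] f; first by rewrite !big_ord0 normc0.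
rewrite !big_ord_recr /=; apply: le_trans (le_normcD _ _) _.
by rewrite lerD2r.
Qed.

Lemma normcX (z : C) k : normc (z ^+ k) = normc z ^+ k.
Proof.
elim: k => [|k IHk]; first by rewrite normc1.
by rewrite !exprS normcM IHk.
Qed.

Lemma normc_realc (x : K) : normc (real_complex K x) = `|x|.
Proof. by rewrite /= expr0n addr0 sqrtr_sqr. Qed.

Lemma nsq_horner_le (b : nat -> K) n (w : C) :
  nsq (\poly_(k < n) real_complex K (b k)).[w] <= (\sum_(k < n) `|b k| * normc w ^+ k) ^+ 2.
Proof.
have n0 z : 0 <= normc z by case: z => x y /=; rewrite sqrtr_ge0.
rewrite horner_poly nsq_normc lerXn2r ?nnegrE //.
  by apply: sumr_ge0 => i _; rewrite mulr_ge0 ?exprn_ge0.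
apply: le_trans (normc_sum _) _; apply: ler_sum => i _.
by rewrite normcM normcX normc_realc.
Qed.

Lemma factor_normalize (c : C) (s : seq C) (b : nat -> K) n :
  b 0%N != 0 -> \poly_(k < n.+1) real_complex K (b k) = c *: \prod_(z <- s) ('X - z%:P) ->
  all (fun z => z != 0) s /\
  forall w, (\poly_(k < n.+1) real_complex K (b k)).[w] = real_complex K (b 0%N) * \prod_(z <- s) (1 - w / z).
Proof.
move=> b0 E.
have P0 : (\poly_(k < n.+1) real_complex K (b k)).[0] = real_complex K (b 0%N).
  by rewrite horner_coef0 coef_poly.
have s0 : all (fun z => z != 0) s.
  apply/allP => z zs; apply/eqP => z0; move/eqP: P0; rewrite E hornerZ.
  have -> : (\prod_(z0 <- s) ('X - z0%:P)).[0] = 0.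
    by apply/eqP; rewrite -[_ == 0]/(root _ _) root_prod_XsubC -z0.
  by rewrite mulr0 eq_sym -nsq_eq0 nsq_real sqrf_eq0 (negbTE b0).
split=> // w; rewrite -P0 !E !hornerZ -mulrA; congr (_ * _).
rewrite !horner_prod -big_split /=; apply: eq_big_seq => z zs.
rewrite !hornerXsubC sub0r mulrBr mulr1 mulNr opprK mulrCA divff ?mulr1 1?addrC //.
exact: (allP s0).
Qed.

End Nsq.

Local Notation C := (R[i]).

Definition cis (t : R) : C := Complex (cos t) (sin t).

Lemma cisD s t : cis (Rplus s t) = cis s * cis t.
Proof.
rewrite /cis cos_plus sin_plus.
by rewrite -[RHS]/(Complex (Rplus (Rmult (cos s) (cos t)) (Ropp (Rmult (sin s) (sin t)))) (Rplus (Rmult (cos s) (sin t)) (Rmult (sin s) (cos t)))); congr Complex; rewrite Rplus_comm.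
Qed.

Lemma cisX t k : cis t ^+ k = cis (Rmult (INR k) t).
Proof.
elim: k => [|k IHk]; first by rewrite /= Rmult_0_l /cis cos_0 sin_0.
by rewrite exprS IHk -cisD S_INR; congr cis; rewrite Rplus_comm Rmult_plus_distr_r Rmult_1_l.
Qed.

Lemma polar (z : C) : exists rho phi, Rle 0 rho /\ z = real_complex R rho * cis phi.
Proof.
case: z => x y; have [rho [phi [r0 [-> ->]]]] := polar_real x y.
exists rho, phi; split=> //.
rewrite -[RHS]/(Complex (Rplus (Rmult rho (cos phi)) (Ropp (Rmult (IZR 0) (sin phi)))) (Rplus (Rmult rho (sin phi)) (Rmult (IZR 0) (cos phi)))).
by congr Complex; rewrite Rmult_0_l ?Ropp_0 Rplus_0_r.
Qed.

End LogDerPoly.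

Module LogDerBound.
Import mathcomp.order.all_order mathcomp.algebra.all_algebra complex.
Import GRing.Theory Num.Theory Order.TTheory ComplexField.Normc LogDerPoly.
Delimit Scope R_scope with Re.
Local Open Scope R_scope.

Notation RC := (real_complex R).
Local Notation CC := (complex.complex R).

(** Passage between two models of the complex numbers: polynomials are factored in [R[i]], which is
    algebraically closed, while the analysis takes place in Coquelicot's pairs. *)
Lemma RC_horner (b : nat -> R) n (x y : R) :
  (\poly_(k < n) RC (b k)).[Complex x y]%R =
  Complex (\big[Rplus/0]_(k < n) (b k * Coquelicot.Complex.Re (Cpow (x, y) k))) (\big[Rplus/0]_(k < n) (b k * Coquelicot.Complex.Im (Cpow (x, y) k))).
Proof.
have pw k : (Complex x y ^+ k)%R = Complex (Coquelicot.Complex.Re (Cpow (x, y) k)) (Coquelicot.Complex.Im (Cpow (x, y) k)) :> CC.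
  by elim: k => [|k IHk] //; rewrite exprS IHk Cpow_S.
rewrite horner_poly; elim: n => [|n IHn]; first by rewrite !big_ord0.
rewrite !big_ord_recr IHn pw /=.
rewrite -[LHS]/(Complex (\big[Rplus/0]_(i < n) (b i * Coquelicot.Complex.Re (Cpow (x, y) i)) + (b n * Coquelicot.Complex.Re (Cpow (x, y) n) + - (0 * Coquelicot.Complex.Im (Cpow (x, y) n))))
  (\big[Rplus/0]_(i < n) (b i * Coquelicot.Complex.Im (Cpow (x, y) i)) + (b n * Coquelicot.Complex.Im (Cpow (x, y) n) + 0 * Coquelicot.Complex.Re (Cpow (x, y) n)))).
by congr Complex; congr Rplus; lra.
Qed.

Lemma nsq_cis rho a : nsq (1 - RC rho * cis a)%R = 1 - 2 * rho * cos a + rho ^ 2.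
Proof.
change (@eq R ((1 + - (rho * cos a + - (0 * sin a))) * (1 + - (rho * cos a + - (0 * sin a))) +
  (0 + - (rho * sin a + 0 * cos a)) * (0 + - (rho * sin a + 0 * cos a))) (1 - 2 * rho * cos a + rho ^ 2)).
have e := sin2_cos2 a; rewrite /Rsqr in e.
have -> : rho ^ 2 = rho * rho * (sin a * sin a + cos a * cos a) by rewrite e; ring.
by ring.
Qed.

Lemma sum_ln (I : eqType) (s : seq I) (f : I -> R) : (forall x, x \in s -> 0 < f x) ->
  0 < \big[Rmult/1]_(x <- s) f x /\
  \big[Rplus/0]_(x <- s) ln (f x) = ln (\big[Rmult/1]_(x <- s) f x).
Proof.
elim: s => [|x s IHs] fp; first by rewrite !big_nil ln_1; split=> //; lra.
have [|p0 IH] := IHs; first by move=> y ys; apply: fp; rewrite in_cons ys orbT.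
have fx : 0 < f x by apply: fp; rewrite mem_head.
by rewrite !big_cons IH ln_mult //; split=> //; apply: Rmult_lt_0_compat.
Qed.

(* With [h_K] a power sum of the inverse zeros of the polynomial, all of modulus less than [1 / r], the factor
   [1 +- cos] makes the average of [ln |P|] on the circle of radius [r] single out the [K.+1]-st power sum. *)
Lemma logder_bound (b h : nat -> R) (r B : R) n K :
  0 < r -> 0 < b 0%N -> (K < n)%N ->
  (forall k, (k <= K)%N -> INR k.+1 * b k.+1 = \big[Rplus/0]_(i < k.+1) (h i * b (k - i)%N)) ->
  (forall z : C, Cmod z <= r ->
     ~ (\big[Rplus/0]_(k < n.+1) (b k * Coquelicot.Complex.Re (Cpow z k)) = 0 /\
        \big[Rplus/0]_(k < n.+1) (b k * Coquelicot.Complex.Im (Cpow z k)) = 0)) ->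
  \big[Rplus/0]_(k < n.+1) (Rabs (b k) * r ^ k) <= B ->
  Rabs (h K * r ^ K.+1) <= 2 * INR K.+1 * (ln B - ln (b 0%N)).
Proof.
move=> r0 b0 Kn Hh nv BB.
set P : {poly CC} := (\poly_(k < n.+1) RC (b k))%R.
have [s E] := closed_field_poly_normal P.
set c := lead_coef P in E.
have bn0 : (b 0%N != 0%R)%R by apply/eqP => e; move: b0; rewrite e => /Rlt_irrefl.
have [s0 PE] := factor_normalize bn0 E.
have rts z : z \in s -> (P.[z] = 0)%R.
  move=> zs; have /rootP rz : root (\prod_(z0 <- s) ('X - z0%:P))%R z by rewrite root_prod_XsubC.
  by rewrite E hornerZ rz mulr0.
have rbig z : z \in s -> r * r < nsq z.
  case: z => x y /rts; rewrite /P RC_horner => -[e1 e2].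
  apply: Rnot_le_lt => h1; apply: (nv (x, y)); last by split.
  rewrite /Cmod /=; apply: Rle_trans (_ : sqrt (r * r) <= r); last by rewrite sqrt_square; lra.
  apply: sqrt_le_1_alt.
  by rewrite -[nsq _]/(x * x + y * y) in h1; lra.
have [f Hf] := choice (fun z : CC => polar (RC r / z)%R).
have {}Hf z : exists phi, Rle 0 (f z) /\ (RC r / z)%R = (RC (f z) * cis phi)%R := Hf z.
have [g Hg] := choice Hf.
have fz z : (RC r / z)%R = (RC (f z) * cis (g z))%R by case: (Hg z).
have ncis t : nsq (cis t) = 1.
  by rewrite -[LHS]/(cos t * cos t + sin t * sin t); have := sin2_cos2 t; rewrite /Rsqr; lra.
have fz1 z : z \in s -> 0 <= f z < 1.
  move=> zs; split; first by case: (Hg z).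
  have := rbig z zs; have := congr1 (@nsq _) (fz z).
  rewrite !nsqM nsqV ncis !nsq_real => e h1.
  have {}e : r * r * / (nsq z) = f z * f z.
    have q : (nsq z != 0%R)%R.
      apply/eqP => q; move: h1; rewrite q => h1.
      exact: Rlt_irrefl (Rlt_trans _ _ _ (Rmult_lt_0_compat _ _ r0 r0) h1).
    by move: e; rewrite mulr1 !expr2 -RinvE.
  have [z0 _] := Hg z; apply: Rnot_le_lt => f1.
  have : r * r * / nsq z < 1 by apply/Rlt_div_l; nra.
  by nra.
pose ss := [seq (f z, g z) | z <- s].
have H1 x : x \in ss -> 0 <= x.1 < 1 by case/mapP => z zs -> /=; exact: fz1.
(* For w = r e^(i t), [halfln (f z) (g z + t)] is ln |1 - w / z|, so the sum is ln |P(w) / P(0)|.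
   Squared moduli spare the square roots. *)
have H2 t : \big[Rplus/0]_(x <- ss) halfln x.1 (x.2 + t) <= ln B - ln (b 0%N).
  rewrite big_map /=.
  pose w : CC := (RC r * cis t)%R.
  have F z : z \in s -> halfln (f z) (g z + t) = ln (nsq (1 - w / z)%R) * / 2.
    move=> zs; rewrite /halfln -nsq_cis cisD; congr (ln (nsq _) / 2).
    by rewrite /w mulrAC fz mulrA.
  have pos z : z \in s -> 0 < nsq (1 - w / z)%R.
    move=> zs; rewrite /w mulrAC fz -mulrA -cisD nsq_cis.
    by apply: quad_pos; have := fz1 z zs; split_Rabs; lra.
  rewrite (eq_big_seq _ F) -big_distrl /=.
  have [pp ->] := sum_ln pos.
  have Pw : nsq (P.[w])%R = (b 0%N * b 0%N) * \big[Rmult/1]_(z <- s) nsq (1 - w / z)%R.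
    by rewrite PE nsqM nsq_real nsq_prod.
  have nw : normc w = r.
    have : (normc w ^+ 2 = r ^+ 2)%R by rewrite -nsq_normc nsqM ncis nsq_real mulr1.
    have n0 : 0 <= normc w by case: (w) => x y /=; apply/RleP; rewrite sqrtr_ge0.
    by move=> e; have {}e : normc w * normc w = r * r := e; nra.
  have B0 : b 0%N <= B.
    apply: Rle_trans BB; rewrite big_ord_recl.
    apply: Rle_trans (_ : Rabs (b 0%N) * r ^ 0 + 0 <= _).
      by have := Rle_abs (b 0%N); rewrite /= Rmult_1_r; lra.
    apply: Rplus_le_compat_l; apply: Rsum_ge0 => i _.
    by apply: Rmult_le_pos; [exact: Rabs_pos | apply: pow_le; lra].
  have PB : nsq (P.[w])%R <= B * B.
    have /RleP h1 := nsq_horner_le b n.+1 w.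
    apply: Rle_trans h1 _; rewrite expr2 nw.
    set S := (\sum_(k < _) _)%R.
    have S0 : 0 <= S.
      by apply/RleP; apply: sumr_ge0 => i _; apply: mulr_ge0 => //; apply: exprn_ge0; apply/RleP; exact: Rlt_le.
    have SB : S <= B.
      apply: Rle_trans BB; apply: Req_le; rewrite /S.
      by apply: eq_bigr => i _; rewrite RpowE.
    by apply: Rmult_le_compat.
  rewrite Pw in PB.
  set Q := \big[Rmult/1]_(z <- s) _ in pp PB *.
  have := ln_le _ _ (Rmult_lt_0_compat _ _ (Rmult_lt_0_compat _ _ b0 b0) pp) PB.
  have bb0 : 0 < b 0%N * b 0%N by apply: Rmult_lt_0_compat.
  have Bp : 0 < B by apply: Rlt_le_trans B0.
  rewrite (ln_mult _ _ bb0 pp) (ln_mult _ _ b0 b0) (ln_mult _ _ Bp Bp).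
  by move: (ln (b 0%N)) (ln B) (ln Q) => u v q; lra.
have := power_sum_bound (isT : (0 < K.+1)%N) H1 H2.
suff -> : h K * r ^ K.+1 = - \big[Rplus/0]_(x <- ss) (x.1 ^ K.+1 * cos (INR K.+1 * x.2)) by rewrite Rabs_Ropp.
rewrite big_map.
have hE : RC (h K) = (- \sum_(z <- s) z^-1 ^+ K.+1)%R.
  apply: (LD_coef (h := fun k => RC (h k)) Kn _ s0 E) => [|k kK].
    by rewrite -nsq_eq0 nsq_real sqrf_eq0.
  have e : (k.+1%:R * b k.+1 = \sum_(i < k.+1) h i * b (k - i)%N)%R.
    by rewrite -INRE; exact: Hh.
  by rewrite -(rmorph_nat (real_complex R)) -rmorphM e rmorph_sum; apply: eq_bigr => i _; rewrite rmorphM.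
have := congr1 (fun z : CC => complex.Re (z * RC r ^+ K.+1)%R) hE.
rewrite mulNr mulr_suml -rmorphXn -rmorphM /= => e.
have {}e : h K * r ^ K.+1 = complex.Re (- \sum_(z <- s) (z^-1 ^+ K.+1 * RC (r ^+ K.+1)))%R.
  by rewrite -e RpowE.
rewrite {}e; elim: (s) => [|z s' IHs]; first by rewrite !big_nil /=.
rewrite !big_cons opprD.
have -> : (z^-1 ^+ K.+1 * RC (r ^+ K.+1) = RC (f z ^+ K.+1) * cis (INR K.+1 * g z))%R.
  by rewrite !rmorphXn -exprMn mulrC fz exprMn cisX.
rewrite Ropp_plus_distr -IHs.
set T := (- \sum_(z <- s') _)%R.
have ReB (u v : CC) : complex.Re (- u + v)%R = - complex.Re u + complex.Re v by case: u v => ? ? [? ?].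
rewrite ReB -RpowE; congr Rplus; congr Ropp.
rewrite -[LHS]/(f z ^ K.+1 * cos (INR K.+1 * g z) + - (0 * sin (INR K.+1 * g z))).
by rewrite Rmult_0_l Ropp_0 Rplus_0_r.
Qed.

End LogDerBound.

(** * Taylor coefficients of Dirichlet series *)

Lemma nonincr_of_derive (f df : R -> R) a b : a <= b ->
  (forall x, a <= x <= b -> is_derive f x (df x)) -> (forall x, a <= x <= b -> df x <= 0) ->
  f b <= f a.
Proof.
move=> ab Hd Hn.
have [c [cab e]] : exists c, Rmin a b <= c <= Rmax a b /\ f b - f a = df c * (b - a).
  apply: MVT_gen => x; rewrite Rmin_left ?Rmax_right // => xab; first by apply: Hd; lra.
  by apply/continuity_pt_filterlim/ex_derive_continuous; exists (df x); apply: Hd.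
rewrite Rmin_left ?Rmax_right // in cab.
by have := Hn c cab; nra.
Qed.

Definition expterm (s v : R) k : R := exp (- s * v) * ((s * v) ^ k / INR (fact k)).

(** The probability that a Poisson variable of mean s v is less than k, which is also a normalized
    incomplete gamma function. *)
Definition gamma_tail (s : R) k (v : R) : R := \big[Rplus/0]_(i < k) expterm s v i.

Lemma expterm_ge0 s v k : 0 <= s -> 0 <= v -> 0 <= expterm s v k.
Proof.
move=> s0 v0; apply: Rmult_le_pos; first exact/Rlt_le/exp_pos.
apply: Rdiv_le_0_compat; last exact: INR_fact_pos.
by apply: pow_le; nra.
Qed.

Lemma expterm_sum_le1 s v k : 0 <= s -> 0 <= v -> gamma_tail s k v <= 1.
Proof.
move=> s0 v0; rewrite /gamma_tail -big_distrr /=.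
have sv : 0 <= s * v by nra.
have := @partial_le_Series (fun i => (s * v) ^ i / INR (fact i)) k.
rewrite (is_series_unique _ _ (@is_series_exp (s * v))) => H.
have {}H : \big[Rplus/0]_(i < k) ((s * v) ^ i / INR (fact i)) <= exp (s * v).
  apply: H; last by eexists; exact: is_series_exp.
  by move=> i; apply: Rdiv_le_0_compat; [exact: pow_le | exact: INR_fact_pos].
have e : exp (- s * v) * exp (s * v) = 1 by rewrite -exp_plus -exp_0; congr exp; ring.
by rewrite -e; apply: Rmult_le_compat_l => //; exact/Rlt_le/exp_pos.
Qed.

(** The derivative of a Poisson term is a difference of neighbours, so the sum telescopes to its
    last term. The sign of that term makes the tails decrease. *)
Lemma gamma_tail_derive s k v :
  is_derive (gamma_tail s k.+1) v (- s * expterm s v k).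
Proof.
elim: k => [|k IHk].
  apply: (is_derive_ext (fun v => exp (- s * v))).
    by move=> t; rewrite /gamma_tail big_ord_recl big_ord0 /expterm /=; field.
  by rewrite /expterm; auto_derive => //=; field.
apply: (is_derive_ext (fun v => gamma_tail s k.+1 v + expterm s v k.+1)).
  by move=> t; rewrite /gamma_tail [RHS]big_ord_recr.
have f0 := INR_fact_pos k; have k0 := pos_INR k.
rewrite (_ : - s * expterm s v k.+1 = plus (- s * expterm s v k) (s * expterm s v k - s * expterm s v k.+1)); last first.
  by change (- s * expterm s v k.+1 = - s * expterm s v k + (s * expterm s v k - s * expterm s v k.+1)); ring.
apply: is_derive_plus IHk _.
rewrite /expterm; auto_derive => //.
change (fact k.+1) with (k.+1 * fact k)%coq_nat; rewrite mult_INR.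
change (match k with 0%N => 1 | _.+1 => INR k + 1 end) with (INR k.+1).
by rewrite S_INR /=; field; lra.
Qed.

Lemma gamma_tail_nonincr s k u v : 0 <= s -> 0 <= u <= v -> gamma_tail s k v <= gamma_tail s k u.
Proof.
move=> s0 [u0 uv]; case: k => [|k]; first by rewrite /gamma_tail !big_ord0; lra.
apply: (nonincr_of_derive (df := fun v => - s * expterm s v k)) => // x xuv; first exact: gamma_tail_derive.
by have : 0 <= expterm s x k by [apply: expterm_ge0; lra]; nra.
Qed.

Lemma gamma_tail_ge0 s k v : 0 <= s -> 0 <= v -> 0 <= gamma_tail s k v.
Proof. by move=> s0 v0; apply: Rsum_ge0 => i _; exact: expterm_ge0. Qed.

(* [wt s k n] is [n^(-s) (ln n)^k / k!], the Taylor coefficient of [z |-> n^(z-s)] at [0]. *)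
Definition wt (s : R) k (n : nat) : R := exp (- s * ln (INR n)) * (ln (INR n) ^ k / INR (fact k)).

Lemma ln_INR_ge0 n : 0 <= ln (INR n.+1).
Proof.
rewrite -ln_1; apply: ln_le; first lra.
by rewrite S_INR; have := pos_INR n; lra.
Qed.

Lemma ln_INR_mono m n : (m <= n)%N -> ln (INR m.+1) <= ln (INR n.+1).
Proof.
move=> mn; apply: ln_le; first exact: INR_gt0.
by apply: le_INR; lia.
Qed.

Lemma wt_ge0 s k n : 0 <= wt s k n.+1.
Proof.
apply: Rmult_le_pos; first exact/Rlt_le/exp_pos.
by apply: Rdiv_le_0_compat; [apply: pow_le; exact: ln_INR_ge0 | exact: INR_fact_pos].
Qed.

Lemma wt_expterm s k n : 0 < s -> wt s k n = / s ^ k * expterm s (ln (INR n)) k.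
Proof.
move=> s0; rewrite /wt /expterm Rpow_mult_distr; field.
have := INR_fact_pos k; have := pow_lt s k s0; lra.
Qed.

(* [wt s k] is the difference of two decreasing functions of [n], each with total variation at most [s^-k]. *)
Lemma wt_variation s k n : 0 < s ->
  Rabs (wt s k n.+1 - wt s k n.+2) <=
  / s ^ k * ((gamma_tail s k.+1 (ln (INR n.+1)) + gamma_tail s k (ln (INR n.+1))) -
             (gamma_tail s k.+1 (ln (INR n.+2)) + gamma_tail s k (ln (INR n.+2)))).
Proof.
move=> s0.
have g1 v : gamma_tail s k.+1 v = gamma_tail s k v + expterm s v k by rewrite /gamma_tail big_ord_recr.
have uv : 0 <= ln (INR n.+1) <= ln (INR n.+2) by split; [exact: ln_INR_ge0 | exact: ln_INR_mono].
have h1 := gamma_tail_nonincr k (Rlt_le _ _ s0) uv.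
have h2 := gamma_tail_nonincr k.+1 (Rlt_le _ _ s0) uv.
have e u : expterm s u k = gamma_tail s k.+1 u - gamma_tail s k u by rewrite g1; ring.
rewrite !wt_expterm // -Rmult_minus_distr_l Rabs_mult Rabs_pos_eq; last first.
  by apply/Rlt_le/Rinv_0_lt_compat/pow_lt.
apply: Rmult_le_compat_l; first by apply/Rlt_le/Rinv_0_lt_compat/pow_lt.
by rewrite !e; split_Rabs; lra.
Qed.

Lemma wt_total_variation s k M : 0 < s ->
  \big[Rplus/0]_(j < M) Rabs (wt s k j.+1 - wt s k j.+2) <= 2 / s ^ k.
Proof.
move=> s0; have p := pow_lt s k s0.
have ip : 0 < / s ^ k by exact: Rinv_0_lt_compat.
pose g n := / s ^ k * (gamma_tail s k.+1 (ln (INR n.+1)) + gamma_tail s k (ln (INR n.+1))).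
apply: Rle_trans (_ : g 0%N <= _); first apply: (@telescope_bound (fun j => Rabs (wt s k j.+1 - wt s k j.+2))).
- by move=> i; rewrite /g -Rmult_minus_distr_l; exact: wt_variation.
- move=> i; have l0 := ln_INR_ge0 i; apply: Rmult_le_pos; first lra.
  by apply: Rplus_le_le_0_compat; apply: gamma_tail_ge0; lra.
rewrite /g /Rdiv Rmult_comm; apply: Rmult_le_compat_r; first lra.
have l0 := ln_INR_ge0 0.
have := expterm_sum_le1 k (Rlt_le _ _ s0) l0; have := expterm_sum_le1 k.+1 (Rlt_le _ _ s0) l0.
by lra.
Qed.

Definition psum (f : nat -> R) n : R := \big[Rplus/0]_(i < n) f i.+1.

Lemma summation_by_parts (f u : nat -> R) M :
  \big[Rplus/0]_(j < M) (f j.+1 * u j) =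
  \big[Rplus/0]_(j < M) (psum f j.+1 * (u j - u j.+1)) + psum f M * u M.
Proof.
elim: M => [|M IHM]; first by rewrite /psum !big_ord0; ring.
rewrite (RsumS M (fun j => f j.+1 * u j)) (RsumS M (fun j => psum f j.+1 * (u j - u j.+1))) IHM.
by rewrite /psum (RsumS M (fun j => f j.+1)); ring.
Qed.

(** The coefficient of z^k in L(s - z), summed by parts. Bounded partial sums of f then give
    absolute convergence for every s > 0. *)
Definition coefL (f : nat -> R) s k : R :=
  Series (fun j => psum f j.+1 * (wt s k j.+1 - wt s k j.+2)).

Definition coefL_part (f : nat -> R) s k M : R :=
  \big[Rplus/0]_(j < M) (psum f j.+1 * (wt s k j.+1 - wt s k j.+2)).

Section Coef.
Variables (f : nat -> R) (Q : R).
Hypothesis fQ : forall n, Rabs (psum f n) <= Q.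

Lemma Q_ge0 : 0 <= Q.
Proof. by apply: Rle_trans (fQ 0); exact: Rabs_pos. Qed.

Lemma coefL_ex s k : 0 < s ->
  ex_series (fun j => Rabs (psum f j.+1 * (wt s k j.+1 - wt s k j.+2))).
Proof.
move=> s0.
apply: (@ex_series_bounded _ (Q * (2 / s ^ k))) => [i|M]; first exact: Rabs_pos.
apply: Rle_trans (_ : Q * \big[Rplus/0]_(j < M) Rabs (wt s k j.+1 - wt s k j.+2) <= _).
  rewrite big_distrr /=; apply: Rsum_le => i _; rewrite Rabs_mult.
  by apply: Rmult_le_compat_r; [exact: Rabs_pos | exact: fQ].
by apply: Rmult_le_compat_l; [exact: Q_ge0 | exact: wt_total_variation].
Qed.

Lemma coefL_part_bound s k M : 0 < s -> Rabs (coefL_part f s k M) <= 2 * Q * / s ^ k.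
Proof.
move=> s0; rewrite /coefL_part; apply: Rle_trans; first exact: Rabs_bigsum.
apply: Rle_trans (_ : Q * \big[Rplus/0]_(j < M) Rabs (wt s k j.+1 - wt s k j.+2) <= _).
  rewrite big_distrr /=; apply: Rsum_le => i _; rewrite Rabs_mult.
  by apply: Rmult_le_compat_r; [exact: Rabs_pos | exact: fQ].
have := Rmult_le_compat_l _ _ _ Q_ge0 (wt_total_variation k M s0).
by rewrite /Rdiv; lra.
Qed.

Lemma coefL_lim s k : 0 < s -> is_lim_seq (coefL_part f s k) (coefL f s k).
Proof.
move=> s0; apply/is_lim_seq_incr_1.
apply: (is_lim_seq_ext (sum_n (fun j => psum f j.+1 * (wt s k j.+1 - wt s k j.+2)))).
  by move=> n; rewrite sum_n_big.
exact: Series_correct _ (ex_series_abs (coefL_ex k s0)).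
Qed.

(** The total variation of the weights is at most 2 / s^k, so the Taylor series at s converges on
    the whole disc |z| < s, up to the line of abscissa 0. This is the analytic continuation of L. *)
Lemma coefL_bound s k : 0 < s -> Rabs (coefL f s k) <= 2 * Q * / s ^ k.
Proof.
move=> s0.
have := is_lim_seq_le _ (fun _ => 2 * Q * / s ^ k) _ _ _ (is_lim_seq_abs _ _ (@coefL_lim s k s0)) (is_lim_seq_const _).
by apply=> n; exact: coefL_part_bound.
Qed.

End Coef.

(** From (ln n)^k / k! <= n. The bound is uniform in k. *)
Lemma wt_le s k j : 3 <= s -> wt s k j.+1 <= / INR j.+1 ^ 2.
Proof.
move=> s3; have l0 := ln_INR_ge0 j; have j0 : 0 < INR j.+1 by apply: INR_gt0.
apply: Rle_trans (_ : exp (- s * ln (INR j.+1)) * exp (ln (INR j.+1)) <= _).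
  by apply: Rmult_le_compat_l; [exact/Rlt_le/exp_pos | exact: pow_fact_le_exp].
rewrite -exp_plus.
have -> : / INR j.+1 ^ 2 = exp (- 2 * ln (INR j.+1)).
  rewrite (_ : - 2 * ln (INR j.+1) = - (ln (INR j.+1) + ln (INR j.+1))); last ring.
  by rewrite exp_Ropp exp_plus exp_ln //; congr Rinv; rewrite /=; ring.
have : - s * ln (INR j.+1) + ln (INR j.+1) <= - 2 * ln (INR j.+1) by nra.
by case/Rle_lt_or_eq_dec => [/exp_increasing/Rlt_le|->] //; apply: Rle_refl.
Qed.

Lemma wt_mul_ex f s k : 3 <= s -> (forall n, Rabs (f n) <= 1) ->
  ex_series (fun j => Rabs (f j.+1 * wt s k j.+1)).
Proof.
move=> s3 f1; apply: ex_series_dom ex_series_inv_sq => j.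
rewrite Rabs_Rabsolu Rabs_mult (Rabs_pos_eq _ (wt_ge0 s k j)).
have := f1 j.+1; have := wt_ge0 s k j; have := wt_le k j s3; have := Rabs_pos (f j.+1); nra.
Qed.

Lemma inv_sq_lim : is_lim_seq (fun j => / INR j.+1 ^ 2) 0.
Proof. exact: ex_series_lim_0 ex_series_inv_sq. Qed.

Lemma coefL_series f Q s k : 3 <= s -> (forall n, Rabs (f n) <= 1) ->
  (forall n, Rabs (psum f n) <= Q) ->
  coefL f s k = Series (fun j => f j.+1 * wt s k j.+1).
Proof.
move=> s3 f1 fQ; have s0 : 0 < s by lra.
have l1 := @coefL_lim f Q fQ s k s0.
have l2 : is_lim_seq (fun M => \big[Rplus/0]_(j < M) (f j.+1 * wt s k j.+1)) (Series (fun j => f j.+1 * wt s k j.+1)).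
  apply/is_lim_seq_incr_1; apply: (is_lim_seq_ext (sum_n (fun j => f j.+1 * wt s k j.+1))).
    by move=> n; rewrite sum_n_big.
  exact: Series_correct _ (ex_series_abs (wt_mul_ex k s3 f1)).
have l3 : is_lim_seq (fun M => coefL_part f s k M + psum f M * wt s k M.+1) (coefL f s k + 0).
  apply: is_lim_seq_plus' => //; apply/is_lim_seq_abs_0.
  apply: (is_lim_seq_le_le (fun _ => 0) _ (fun M => Q * / INR M.+1 ^ 2)).
  - move=> M; split; first exact: Rabs_pos.
    rewrite Rabs_mult (Rabs_pos_eq _ (wt_ge0 s k M)).
    apply: Rmult_le_compat => //; [exact: Rabs_pos | exact: wt_ge0 | exact: wt_le].
  - exact: is_lim_seq_const.
  have := is_lim_seq_scal_l _ Q _ inv_sq_lim.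
  by rewrite /Rbar_mult /= Rmult_0_r.
have : is_lim_seq (fun M => \big[Rplus/0]_(j < M) (f j.+1 * wt s k j.+1)) (coefL f s k + 0).
  by apply: is_lim_seq_ext l3 => M; rewrite (summation_by_parts f (fun j => wt s k j.+1)).
by move/is_lim_seq_unique; rewrite (is_lim_seq_unique _ _ l2) Rplus_0_r => -[].
Qed.

(** * Complex power series *)

Definition Cseries (a : nat -> C) : C := (Series (fun k => Re (a k)), Series (fun k => Im (a k))).

Lemma Cmod_le_sum (z : C) : Cmod z <= Rabs (Re z) + Rabs (Im z).
Proof.
have [_ h] := sqrt_plus_sqr z.1 z.2.
rewrite /Cmod /Re /Im; apply: Rsqr_incr_0_var; last by have := Rabs_pos z.1; have := Rabs_pos z.2; lra.
rewrite Rsqr_sqrt; last nra.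
rewrite -(pow2_abs z.1) -(pow2_abs z.2) /Rsqr.
by have := Rabs_pos z.1; have := Rabs_pos z.2; nra.
Qed.

Lemma Cseries_bound (a : nat -> C) (c : nat -> R) :
  (forall k, Cmod (a k) <= c k) -> ex_series c -> Cmod (Cseries a) <= 2 * Series c.
Proof.
move=> ac ec; apply: Rle_trans (Cmod_le_sum _) _; rewrite /Cseries /=.
have h1 : Rabs (Series (fun k => Re (a k))) <= Series c.
  by apply: Series_dom => // k; apply: Rle_trans (re_le_Cmod _) (ac k).
have h2 : Rabs (Series (fun k => Im (a k))) <= Series c.
  by apply: Series_dom => // k; apply: Rle_trans (Rabs_Im_le _) (ac k).
lra.
Qed.

Lemma ex_Cseries_dom (a : nat -> C) (c : nat -> R) :
  (forall k, Cmod (a k) <= c k) -> ex_series c ->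
  ex_series (fun k => Re (a k)) /\ ex_series (fun k => Im (a k)).
Proof.
move=> ac ec; split; apply: ex_series_dom ec => k.
  by apply: Rle_trans (re_le_Cmod _) (ac k).
by apply: Rle_trans (Rabs_Im_le _) (ac k).
Qed.

(** The factor r on the left replaces an exponent k - 1 on the right, which would truncate at k =
    0. *)
Lemma Cpow_diff_bound r (z w : C) k : Cmod z <= r -> Cmod w <= r ->
  r * Cmod (w ^ k - z ^ k)%C <= INR k * r ^ k * Cmod (w - z)%C.
Proof.
move=> zr wr; have r0 : 0 <= r by apply: Rle_trans zr; exact: Cmod_ge_0.
elim: k => [|k IHk].
  by rewrite /= (_ : (1 - 1 = 0)%C) ?Cmod_0; [lra | ring].
have -> : (w ^ k.+1 - z ^ k.+1 = w ^ k * (w - z) + z * (w ^ k - z ^ k))%C by rewrite !Cpow_S; ring.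
have h1 : Cmod (w ^ k * (w - z))%C <= r ^ k * Cmod (w - z)%C.
  rewrite Cmod_mult Cmod_pow; apply: Rmult_le_compat_r; first exact: Cmod_ge_0.
  by apply: pow_incr; split; [exact: Cmod_ge_0|].
have h2 : r * Cmod (z * (w ^ k - z ^ k))%C <= r * (INR k * r ^ k * Cmod (w - z)%C).
  rewrite Cmod_mult (Rmult_comm (Cmod z)) -Rmult_assoc Rmult_comm.
  apply: Rle_trans (_ : r * (r * Cmod (w ^ k - z ^ k)%C) <= _); last by apply: Rmult_le_compat_l.
  apply: Rmult_le_compat_r => //; apply: Rmult_le_pos => //; exact: Cmod_ge_0.
have h3 := Cmod_triangle (w ^ k * (w - z))%C (z * (w ^ k - z ^ k))%C.
have h4 := Rmult_le_compat_l _ _ _ r0 h3; have h5 := Rmult_le_compat_l _ _ _ r0 h1.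
rewrite S_INR -[r ^ k.+1]/(r * r ^ k); lra.
Qed.

Lemma Cpow_taylor_bound r (z w : C) k : Cmod z <= r -> Cmod w <= r ->
  r * Cmod (w ^ k.+1 - z ^ k.+1 - RtoC (INR k.+1) * (z ^ k * (w - z)))%C
    <= INR k.+1 ^ 2 * r ^ k * Cmod (w - z)%C ^ 2.
Proof.
move=> zr wr; have r0 : 0 <= r by apply: Rle_trans zr; exact: Cmod_ge_0.
have d0 := Cmod_ge_0 (w - z)%C.
elim: k => [|k IHk].
  rewrite (_ : (_ - _ = 0)%C) ?Cmod_0; last by rewrite /=; ring.
  by rewrite Rmult_0_r /=; nra.
have -> : (w ^ k.+2 - z ^ k.+2 - RtoC (INR k.+2) * (z ^ k.+1 * (w - z)) =
  z * (w ^ k.+1 - z ^ k.+1 - RtoC (INR k.+1) * (z ^ k * (w - z))) + (w ^ k.+1 - z ^ k.+1) * (w - z))%C.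
  by rewrite !Cpow_S (S_INR k.+1) RtoC_plus; ring.
set E := (w ^ k.+1 - z ^ k.+1 - _)%C in IHk *.
set D := (w ^ k.+1 - z ^ k.+1)%C.
have h3 := Cmod_triangle (z * E)%C (D * (w - z))%C.
have h4 := Rmult_le_compat_l _ _ _ r0 h3.
apply: Rle_trans h4 _; rewrite !Cmod_mult Rmult_plus_distr_l.
have e0 := Cmod_ge_0 E; have z0 := Cmod_ge_0 z.
have h5 : r * (Cmod z * Cmod E) <= r * (INR k.+1 ^ 2 * r ^ k * Cmod (w - z)%C ^ 2).
  apply: Rle_trans (_ : r * (r * Cmod E) <= _); last by apply: Rmult_le_compat_l.
  by apply: Rmult_le_compat_l => //; apply: Rmult_le_compat_r.
have h6 := Cpow_diff_bound k.+1 zr wr; rewrite -/D in h6.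
have h7 : r * (Cmod D * Cmod (w - z)%C) <= INR k.+1 * r ^ k.+1 * Cmod (w - z)%C * Cmod (w - z)%C.
  by rewrite -Rmult_assoc; apply: Rmult_le_compat_r.
have p : 0 <= r ^ k by apply: pow_le.
have i0 := pos_INR k.+1.
rewrite (S_INR k.+1); move: h5 h7; rewrite -[r ^ k.+1]/(r * r ^ k).
set d := Cmod (w - z)%C in d0 *; set i := INR k.+1 in i0 *; set X := r ^ k in p *.
move=> h5 h7.
have -> : (i + 1) ^ 2 * (r * X) * d ^ 2 = r * (i ^ 2 * X * d ^ 2) + i * (r * X) * d * d + (i + 1) * (r * X) * d ^ 2 by ring.
have : 0 <= (i + 1) * (r * X) * d ^ 2 by apply: Rmult_le_pos; [apply: Rmult_le_pos; nra | nra].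
lra.
Qed.

Lemma ex_series_poly_geom t : 0 <= t < 1 -> ex_series (fun k => INR k.+1 ^ 2 * t ^ k).
Proof.
(* Bernoulli's inequality gives k d <= (1 + d)^k, so k^2 t^k is at most d^(-2) ((1 + d)^2 t)^k; for
   t = 1 - 4 d the ratio (1 + d)^2 (1 - 4 d) is below 1. *)
move=> [t0 t1]; pose d := (1 - t) / 4.
have d0 : 0 < d by rewrite /d; lra.
have te : t = 1 - 4 * d by rewrite /d; field.
have bern n : INR n * d <= (1 + d) ^ n.
  elim: n => [|n IHn]; first by rewrite /=; lra.
  rewrite S_INR -[(1 + d) ^ n.+1]/((1 + d) * (1 + d) ^ n).
  by have := pow_R1_Rle (1 + d) n; nra.
have q : 0 <= (1 + d) ^ 2 * t < 1 by rewrite te; have : 0 <= 1 - 4 * d by [lra]; nra.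
apply: (@ex_series_dom _ (fun k => / d ^ 2 * (1 + d) ^ 2 * ((1 + d) ^ 2 * t) ^ k)); last first.
  by apply: ex_series_scal_l; apply: ex_series_geom; rewrite Rabs_pos_eq; lra.
move=> k; have tk : 0 <= t ^ k by apply: pow_le.
rewrite Rabs_pos_eq; last by apply: Rmult_le_pos => //; exact: pow2_ge_0.
rewrite Rpow_mult_distr -Rmult_assoc; apply: Rmult_le_compat_r => //.
have b := bern k.+1.
have b2 : INR k.+1 ^ 2 * d ^ 2 <= ((1 + d) ^ k.+1) ^ 2.
  rewrite -Rpow_mult_distr; apply: pow_incr; split=> //.
  by apply: Rmult_le_pos; [exact: pos_INR | lra].
have -> : / d ^ 2 * (1 + d) ^ 2 * ((1 + d) ^ 2) ^ k = ((1 + d) ^ k.+1) ^ 2 / d ^ 2.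
  rewrite -!pow_mult (_ : (k.+1 * 2)%coq_nat = (2 + (2 * k)%coq_nat)%coq_nat); last by lia.
  by rewrite pow_add; field; lra.
by apply: (proj1 (Rle_div_r _ _ _ (pow_lt d 2 d0))).
Qed.

Definition ppart (b : nat -> R) n (z : C) : C :=
  (\big[Rplus/0]_(k < n) (b k * Re (z ^ k)%C), \big[Rplus/0]_(k < n) (b k * Im (z ^ k)%C)).

Section PowerSeries.
Variables (b : nat -> R) (C0 rho : R).
Hypothesis rho0 : 0 < rho.
Hypothesis bb : forall k, Rabs (b k) <= C0 * / rho ^ k.

Definition psC (z : C) : C := Cseries (fun k => RtoC (b k) * z ^ k)%C.
Definition psD (z : C) : C := Cseries (fun k => RtoC (INR k.+1 * b k.+1) * z ^ k)%C.

Lemma psC_dom r z k : Cmod z <= r -> Cmod (RtoC (b k) * z ^ k)%C <= C0 * (r / rho) ^ k.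
Proof.
move=> zr; rewrite Cmod_mult Cmod_R Cmod_pow /Rdiv Rpow_mult_distr pow_inv.
rewrite (Rmult_comm (r ^ k)) -Rmult_assoc; apply: Rmult_le_compat => //.
- exact: Rabs_pos.
- by apply: pow_le; exact: Cmod_ge_0.
by apply: pow_incr; split=> //; exact: Cmod_ge_0.
Qed.

Lemma ratio_lt1 r : 0 <= r < rho -> 0 <= r / rho < 1.
Proof.
move=> [r0 r1]; split; first by apply: Rdiv_le_0_compat.
by apply/Rlt_div_l; lra.
Qed.

Lemma geom_ex r : 0 <= r < rho -> ex_series (fun k => C0 * (r / rho) ^ k).
Proof.
move=> /ratio_lt1 h; apply: ex_series_scal_l; apply: ex_series_geom.
by rewrite Rabs_pos_eq; lra.
Qed.

Lemma psC_ex z : Cmod z < rho ->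
  ex_series (fun k => Re (RtoC (b k) * z ^ k)%C) /\ ex_series (fun k => Im (RtoC (b k) * z ^ k)%C).
Proof.
move=> zr; apply: (ex_Cseries_dom (c := fun k => C0 * (Cmod z / rho) ^ k)).
  by move=> k; apply: psC_dom; lra.
by apply: geom_ex; split=> //; exact: Cmod_ge_0.
Qed.

Lemma psC_tail r z n : 0 <= r < rho -> Cmod z <= r ->
  Cmod (psC z - ppart b n z)%C
   <= 2 * Series (fun k => C0 * (r / rho) ^ (n + k)).
Proof.
move=> rr zr.
have e : forall k, Re (RtoC (b k) * z ^ k)%C = b k * Re (z ^ k)%C /\ Im (RtoC (b k) * z ^ k)%C = b k * Im (z ^ k)%C.
  by move=> k; rewrite Re_mult Im_mult /=; split; ring.
have [e1 e2] := psC_ex (Rle_lt_trans _ _ _ zr (proj2 rr)).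
have -> : (psC z - ppart b n z)%C =
  Cseries (fun k => RtoC (b (n + k)%N) * z ^ (n + k)%N)%C.
  have t1 : \big[Rplus/0]_(k < n) Re (RtoC (b k) * z ^ k)%C = \big[Rplus/0]_(k < n) (b k * Re (z ^ k)%C).
    by apply: eq_bigr => k _; case: (e k).
  have t2 : \big[Rplus/0]_(k < n) Im (RtoC (b k) * z ^ k)%C = \big[Rplus/0]_(k < n) (b k * Im (z ^ k)%C).
    by apply: eq_bigr => k _; case: (e k).
  rewrite /psC /Cseries (Series_tail_split n e1) (Series_tail_split n e2) t1 t2 /ppart.
  by rewrite /Cminus /Cplus /Copp; f_equal; rewrite [fst]lock [snd]lock /= -!lock; cbn [fst snd]; ring.
apply: Cseries_bound; first by move=> k; exact: psC_dom.
by apply: (ex_series_shift (a := fun k => C0 * (r / rho) ^ k)); exact: geom_ex.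
Qed.

Definition lipC r : R := Series (fun k => C0 / rho * (INR k.+1 ^ 2 * (r / rho) ^ k)).

Lemma lip_ex r : 0 <= r < rho -> ex_series (fun k => C0 / rho * (INR k.+1 ^ 2 * (r / rho) ^ k)).
Proof. by move=> rr; apply: ex_series_scal_l; apply: ex_series_poly_geom; exact: ratio_lt1. Qed.

Lemma psC_incr z : Cmod z < rho -> psC z = (RtoC (b 0%N) + Cseries (fun k => RtoC (b k.+1) * z ^ k.+1))%C.
Proof.
move=> zr; have [e1 e2] := psC_ex zr.
rewrite /psC /Cseries /Cplus /= (Series_incr_1 _ e1) (Series_incr_1 _ e2) /=.
by f_equal; f_equal; ring.
Qed.

Lemma Cseries_minus a a' :
  ex_series (fun k => Re (a k)) /\ ex_series (fun k => Im (a k)) ->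
  ex_series (fun k => Re (a' k)) /\ ex_series (fun k => Im (a' k)) ->
  (Cseries a - Cseries a')%C = Cseries (fun k => a k - a' k)%C.
Proof.
move=> [e1 e2] [e3 e4]; rewrite /Cseries /Cminus /Cplus /Copp /=; f_equal.
  by rewrite -/(Rminus _ _) -Series_minus.
by rewrite -/(Rminus _ _) -Series_minus.
Qed.

Lemma psC_shift_ex z : Cmod z < rho ->
  ex_series (fun k => Re (RtoC (b k.+1) * z ^ k.+1)%C) /\ ex_series (fun k => Im (RtoC (b k.+1) * z ^ k.+1)%C).
Proof.
move=> /psC_ex[e1 e2]; split.
  exact: (ex_series_incr_1 (fun k => Re (RtoC (b k) * z ^ k)%C)).1.
exact: (ex_series_incr_1 (fun k => Im (RtoC (b k) * z ^ k)%C)).1.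
Qed.

Lemma shifted_coef_bound r k : 0 < r -> Rabs (b k.+1) * (INR k.+1 ^ 2 * r ^ k) <= C0 / rho * (INR k.+1 ^ 2 * (r / rho) ^ k).
Proof.
move=> r0; have p := pow_lt _ k rho0; have rk : 0 < r ^ k by exact: pow_lt.
have -> : C0 / rho * (INR k.+1 ^ 2 * (r / rho) ^ k) = C0 * / rho ^ k.+1 * (INR k.+1 ^ 2 * r ^ k).
  by rewrite /Rdiv Rpow_mult_distr pow_inv -[rho ^ k.+1]/(rho * rho ^ k); field; lra.
apply: Rmult_le_compat_r => //.
by apply: Rmult_le_pos; [exact: pow2_ge_0 | lra].
Qed.

Lemma psC_lipschitz r z w : 0 < r < rho -> Cmod z <= r -> Cmod w <= r ->
  Cmod (psC w - psC z)%C <= 2 * lipC r * Cmod (w - z)%C.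
Proof.
move=> rr zr wr; have rr' : 0 <= r < rho by lra.
rewrite !psC_incr; [|lra|lra].
set s1 := Cseries _; set s2 := Cseries _.
have -> : (RtoC (b 0%N) + s1 - (RtoC (b 0%N) + s2) = s1 - s2)%C by ring.
rewrite /s1 /s2 Cseries_minus; [|apply: psC_shift_ex; lra|apply: psC_shift_ex; lra].
rewrite /lipC Rmult_assoc -Series_scal_r; apply: Cseries_bound; last first.
  by apply: ex_series_scal_r; exact: lip_ex.
move=> k.
have -> : (RtoC (b k.+1) * w ^ k.+1 - RtoC (b k.+1) * z ^ k.+1 = RtoC (b k.+1) * (w ^ k.+1 - z ^ k.+1))%C by ring.
rewrite Cmod_mult Cmod_R.
have d0 := Cmod_ge_0 (w - z)%C.
apply: Rle_trans (Rmult_le_compat_r _ _ _ d0 (shifted_coef_bound k (proj1 rr))).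
rewrite Rmult_assoc; apply: Rmult_le_compat_l; first exact: Rabs_pos.
have h := Cpow_diff_bound k.+1 zr wr.
apply: (Rmult_le_reg_l r); first lra.
apply: Rle_trans h _; rewrite -[r ^ k.+1]/(r * r ^ k).
have i1 : 1 <= INR k.+1 by rewrite S_INR; have := pos_INR k; lra.
have X0 : 0 < r ^ k by apply: pow_lt; lra.
have : 0 <= r * r ^ k * Cmod (w - z)%C by apply: Rmult_le_pos => //; nra.
set X := r * r ^ k * _ => XX.
have -> : INR k.+1 * (r * r ^ k) * Cmod (w - z)%C = INR k.+1 * X by rewrite /X; ring.
have -> : r * (INR k.+1 ^ 2 * r ^ k * Cmod (w - z)%C) = INR k.+1 ^ 2 * X by rewrite /X; ring.
by apply: Rmult_le_compat_r => //; nra.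
Qed.

Lemma psD_ex r z : 0 < r < rho -> Cmod z <= r ->
  ex_series (fun k => Re (RtoC (INR k.+1 * b k.+1) * z ^ k)%C) /\ ex_series (fun k => Im (RtoC (INR k.+1 * b k.+1) * z ^ k)%C).
Proof.
move=> rr zr; apply: (ex_Cseries_dom (c := fun k => C0 / rho * (INR k.+1 ^ 2 * (r / rho) ^ k))); last first.
  by apply: lip_ex; lra.
move=> k; apply: Rle_trans (shifted_coef_bound k (proj1 rr)).
have i1 : 1 <= INR k.+1 by rewrite S_INR; have := pos_INR k; lra.
rewrite Cmod_mult Cmod_R Cmod_pow Rabs_mult (Rabs_pos_eq (INR _)); last lra.
rewrite (Rmult_comm (INR _)) Rmult_assoc; apply: Rmult_le_compat_l; first exact: Rabs_pos.
apply: Rmult_le_compat; [lra | apply: pow_le; exact: Cmod_ge_0 | nra |].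
by apply: pow_incr; split=> //; exact: Cmod_ge_0.
Qed.

Lemma psC_quadratic r z w : 0 < r < rho -> Cmod z <= r -> Cmod w <= r ->
  Cmod (psC w - psC z - psD z * (w - z))%C <= 2 * (lipC r / r) * Cmod (w - z)%C ^ 2.
Proof.
move=> rr zr wr; have rr' : 0 <= r < rho by lra.
rewrite !psC_incr; [|lra|lra].
have [d1 d2] := psD_ex rr zr.
have eD : (psD z * (w - z))%C = Cseries (fun k => RtoC (INR k.+1 * b k.+1) * z ^ k * (w - z))%C /\
  (ex_series (fun k => Re (RtoC (INR k.+1 * b k.+1) * z ^ k * (w - z))%C) /\
   ex_series (fun k => Im (RtoC (INR k.+1 * b k.+1) * z ^ k * (w - z))%C)).
  set h := (w - z)%C.
  have m1 := ex_series_scal_r (Re h) _ d1; have m2 := ex_series_scal_r (Im h) _ d2.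
  have m3 := ex_series_scal_r (Im h) _ d1; have m4 := ex_series_scal_r (Re h) _ d2.
  split; last split.
  - rewrite /psD /Cseries {1}/Cmult; f_equal.
      by rewrite -!Series_scal_r -Series_minus.
    by rewrite -!Series_scal_r -Series_plus.
  - exact: ex_series_minus m1 m2.
  - exact: ex_series_plus m3 m4.
case: eD => -> eD.
set s1 := Cseries _; set s2 := Cseries _; set s3 := Cseries _.
have -> : (RtoC (b 0%N) + s1 - (RtoC (b 0%N) + s2) - s3 = s1 - s2 - s3)%C by ring.
have w1 : Cmod w < rho by lra.
have z1 : Cmod z < rho by lra.
have ew := psC_shift_ex w1; have ez := psC_shift_ex z1.
rewrite /s1 /s2 Cseries_minus // /s3 Cseries_minus //; last first.
  by split; [exact: ex_series_minus (proj1 ew) (proj1 ez) | exact: ex_series_minus (proj2 ew) (proj2 ez)].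
rewrite /lipC /Rdiv Rmult_assoc Rmult_assoc -Series_scal_r; apply: Cseries_bound; last first.
  by apply: ex_series_scal_r; exact: lip_ex.
move=> k; rewrite RtoC_mult.
have -> : (RtoC (b k.+1) * w ^ k.+1 - RtoC (b k.+1) * z ^ k.+1 - RtoC (INR k.+1) * RtoC (b k.+1) * z ^ k * (w - z) = RtoC (b k.+1) * (w ^ k.+1 - z ^ k.+1 - RtoC (INR k.+1) * (z ^ k * (w - z))))%C by ring.
rewrite Cmod_mult Cmod_R.
have d0 := Cmod_ge_0 (w - z)%C.
have c0 : 0 <= / r * Cmod (w - z)%C ^ 2.
  by apply: Rmult_le_pos; [apply/Rlt_le/Rinv_0_lt_compat; lra | exact: pow2_ge_0].
apply: Rle_trans (Rmult_le_compat_r _ _ _ c0 (shifted_coef_bound k (proj1 rr))).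
rewrite Rmult_assoc; apply: Rmult_le_compat_l; first exact: Rabs_pos.
have h := Cpow_taylor_bound k zr wr.
apply: (Rmult_le_reg_l r); first lra.
by apply: Rle_trans h _; apply: Req_le; field; lra.
Qed.

End PowerSeries.

(** * Dirichlet series with bounded coefficient sums, on Re s > 0 *)

Lemma nat_Cpow_opp_shift (s : R) (z : C) n :
  nat_Cpow_opp n (RtoC s - z)%C = (RtoC (exp (- s * ln (INR n))) * Cexp (z * RtoC (ln (INR n))))%C.
Proof.
rewrite /nat_Cpow_opp (_ : (- ((RtoC s - z) * RtoC (ln (INR n))))%C = (RtoC (- s * ln (INR n)) + z * RtoC (ln (INR n)))%C).
  by rewrite Cexp_plus; congr Cmult; rewrite /Cexp /= cos_0 sin_0 /RtoC; f_equal; ring.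
by rewrite RtoC_mult RtoC_opp; ring.
Qed.

Lemma npow_is_series s z n :
  is_series (fun k => wt s k n * Re (z ^ k)%C) (Re (nat_Cpow_opp n (RtoC s - z)%C)) /\
  is_series (fun k => wt s k n * Im (z ^ k)%C) (Im (nat_Cpow_opp n (RtoC s - z)%C)).
Proof.
rewrite nat_Cpow_opp_shift; set l := ln (INR n); set e := exp _.
have [h1 h2] := is_series_Cexp (z * RtoC l)%C.
have E : forall k, Re ((z * RtoC l) ^ k)%C = l ^ k * Re (z ^ k)%C /\ Im ((z * RtoC l) ^ k)%C = l ^ k * Im (z ^ k)%C.
  by move=> k; rewrite Cpow_mult_l -RtoC_pow Re_mult Im_mult /=; split; ring.
split.
- rewrite Re_mult (_ : _ - _ = scal e (Re (Cexp (z * RtoC l)))); last first.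
    by change (e * Re (Cexp (z * RtoC l)) - 0 * Im (Cexp (z * RtoC l)) = e * Re (Cexp (z * RtoC l))); ring.
  apply: is_series_ext (is_series_scal_l e _ _ h1) => k; case: (E k) => -> _.
  change (e * (l ^ k * Re (z ^ k)%C / INR (fact k)) = e * (l ^ k / INR (fact k)) * Re (z ^ k)%C).
  by rewrite /Rdiv; ring.
rewrite Im_mult (_ : _ + _ = scal e (Im (Cexp (z * RtoC l)))); last first.
  by change (e * Im (Cexp (z * RtoC l)) + 0 * Re (Cexp (z * RtoC l)) = e * Im (Cexp (z * RtoC l))); ring.
apply: is_series_ext (is_series_scal_l e _ _ h2) => k; case: (E k) => _ ->.
change (e * (l ^ k * Im (z ^ k)%C / INR (fact k)) = e * (l ^ k / INR (fact k)) * Im (z ^ k)%C).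
by rewrite /Rdiv; ring.
Qed.

Lemma Cmod_npow n s : Cmod (nat_Cpow_opp n s) = exp (- Re s * ln (INR n)).
Proof. by rewrite /nat_Cpow_opp Cmod_Cexp; congr exp; case: s => a b /=; ring. Qed.

Lemma npow_mult m n s : (0 < m)%N -> (0 < n)%N ->
  nat_Cpow_opp (m * n) s = (nat_Cpow_opp m s * nat_Cpow_opp n s)%C.
Proof.
move=> m0 n0; rewrite /nat_Cpow_opp mult_INR ln_mult; [|exact: INR_gt0|exact: INR_gt0].
by rewrite RtoC_plus -Cexp_plus; congr Cexp; ring.
Qed.

Lemma Cmod_npow_lim s : 0 < Re s -> is_lim_seq (fun n => Cmod (nat_Cpow_opp n.+1 s)) 0.
Proof.
move=> s0; apply: (is_lim_seq_ext (fun n => exp (- Re s * ln (INR n.+1)))).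
  by move=> n; rewrite Cmod_npow.
apply/is_lim_seq_epsP => eps e0.
have [N HN] := INR_unbounded (exp (- ln eps / Re s)).
exists N => n Nn; rewrite Rminus_0_r Rabs_pos_eq; last exact/Rlt_le/exp_pos.
rewrite -[X in _ < X](exp_ln eps) //; apply: exp_increasing.
have h : - ln eps / Re s < ln (INR n.+1).
  rewrite -(ln_exp (- ln eps / Re s)); apply: ln_increasing; first exact: exp_pos.
  apply: Rlt_le_trans HN _; apply: le_INR; lia.
have := Rmult_lt_compat_l _ _ _ s0 h.
rewrite (_ : Re s * (- ln eps / Re s) = - ln eps); last by field; lra.
lra.
Qed.

Definition Lterm (f : nat -> R) (s : C) j : C :=
  (RtoC (psum f j.+1) * (nat_Cpow_opp j.+1 s - nat_Cpow_opp j.+2 s))%C.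

Definition Lfun (f : nat -> R) (s : C) : C := Cseries (Lterm f s).

Lemma Re_RtoC_mult a (z : C) : Re (RtoC a * z)%C = a * Re z.
Proof. by rewrite Re_mult /=; ring. Qed.

Lemma Im_RtoC_mult a (z : C) : Im (RtoC a * z)%C = a * Im z.
Proof. by rewrite Im_mult /=; ring. Qed.

Lemma is_series_big M (u : nat -> nat -> R) (l : nat -> R) :
  (forall j, is_series (u j) (l j)) ->
  is_series (fun k => \big[Rplus/0]_(j < M) u j k) (\big[Rplus/0]_(j < M) l j).
Proof.
move=> ul; elim: M => [|M IHM].
  rewrite big_ord0; apply: (is_series_ext (fun _ => 0)) => [j|]; first by rewrite big_ord0.
  by apply: is_lim_seq_ext (is_lim_seq_const 0) => m; rewrite sum_n_big big1.
rewrite RsumS; apply: (is_series_ext (fun k => \big[Rplus/0]_(j < M) u j k + u M k)).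
  by move=> k; rewrite (RsumS M (fun j => u j k)).
exact: is_series_plus.
Qed.

Section L.
Variables (f : nat -> R) (Q : R).
Hypothesis fQ : forall n, Rabs (psum f n) <= Q.

(** The sums over j and k are exchanged: a partial sum over j is a power series with coefficients
    [coefL_part], dominated by 2 Q (|z| / s)^k whatever its length. [p] stands for Re or Im. *)
Lemma Lterm_real_series (p : C -> R) (s : R) (z : C) : 0 < s -> Cmod z < s ->
  (forall k, Rabs (p (z ^ k)%C) <= Cmod z ^ k) ->
  (forall n, is_series (fun k => wt s k n * p (z ^ k)%C) (p (nat_Cpow_opp n (RtoC s - z)%C))) ->
  is_series (fun j => psum f j.+1 * (p (nat_Cpow_opp j.+1 (RtoC s - z)%C) - p (nat_Cpow_opp j.+2 (RtoC s - z)%C)))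
    (Series (fun k => coefL f s k * p (z ^ k)%C)).
Proof.
move=> s0 zs pb pser.
have T : is_lim_seq (fun M => Series (fun k => coefL_part f s k M * p (z ^ k)%C)) (Series (fun k => coefL f s k * p (z ^ k)%C)).
  apply: (@Tannery _ _ (fun k => 2 * Q * (Cmod z / s) ^ k)).
  - move=> M k; rewrite Rabs_mult /Rdiv Rpow_mult_distr pow_inv (Rmult_comm (Cmod z ^ k)) -Rmult_assoc.
    by apply: Rmult_le_compat; [exact: Rabs_pos | exact: Rabs_pos | exact: coefL_part_bound | exact: pb].
  - apply: ex_series_scal_l; apply: ex_series_geom.
    have z0 := Cmod_ge_0 z; rewrite Rabs_pos_eq; first by apply/Rlt_div_l; lra.
    by apply: Rdiv_le_0_compat.
  move=> k; apply: (is_lim_seq_ext (fun M => p (z ^ k)%C * coefL_part f s k M)).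
    by move=> M; rewrite Rmult_comm.
  by rewrite Rmult_comm; exact: (is_lim_seq_scal_l _ _ (Rbar.Finite _) (@coefL_lim f Q fQ s k s0)).
have {}T := (is_lim_seq_incr_1 _ _).1 T.
apply: (is_lim_seq_ext _ _ _ _ T) => n; rewrite sum_n_big.
apply: is_series_unique.
apply: (is_series_ext (fun k => \big[Rplus/0]_(j < n.+1) (psum f j.+1 * (wt s k j.+1 * p (z ^ k)%C - wt s k j.+2 * p (z ^ k)%C)))).
  move=> k; rewrite /coefL_part big_distrl; apply: eq_bigr => j _ /=; ring.
apply: (@is_series_big n.+1 (fun j k => psum f j.+1 * (wt s k j.+1 * p (z ^ k)%C - wt s k j.+2 * p (z ^ k)%C))
  (fun j => psum f j.+1 * (p (nat_Cpow_opp j.+1 (RtoC s - z)%C) - p (nat_Cpow_opp j.+2 (RtoC s - z)%C)))).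
move=> j; apply: is_series_scal_l.
exact: is_series_minus (pser _) (pser _).
Qed.

Lemma Lterm_series s z : 0 < s -> Cmod z < s ->
  is_series (fun j => Re (Lterm f (RtoC s - z)%C j)) (Re (psC (coefL f s) z)) /\
  is_series (fun j => Im (Lterm f (RtoC s - z)%C j)) (Im (psC (coefL f s) z)).
Proof.
move=> s0 zs.
have -> : Re (psC (coefL f s) z) = Series (fun k => coefL f s k * Re (z ^ k)%C).
  by apply: Series_ext => k; exact: Re_RtoC_mult.
have -> : Im (psC (coefL f s) z) = Series (fun k => coefL f s k * Im (z ^ k)%C).
  by apply: Series_ext => k; exact: Im_RtoC_mult.
split.
  apply: is_series_ext (Lterm_real_series s0 zs (Rabs_Re_pow z) (fun n => (npow_is_series s z n).1)) => j.
  by rewrite /Lterm Re_RtoC_mult.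
apply: is_series_ext (Lterm_real_series s0 zs (Rabs_Im_pow z) (fun n => (npow_is_series s z n).2)) => j.
by rewrite /Lterm Im_RtoC_mult.
Qed.

Lemma Lfun_ps s z : 0 < s -> Cmod z < s -> Lfun f (RtoC s - z)%C = psC (coefL f s) z.
Proof.
move=> s0 zs; have [h1 h2] := Lterm_series s0 zs.
rewrite /Lfun /Cseries (is_series_unique _ _ h1) (is_series_unique _ _ h2).
by case: (psC _ _).
Qed.

(** The discs |s - N| < N exhaust the half-plane, as the condition reads |s|^2 < 2 N Re s. Taylor
    series at real centres therefore cover every s. *)
Lemma in_disc (s : C) : 0 < Re s -> exists N : R, 3 <= N /\ Cmod (RtoC N - s)%C < N.
Proof.
case: s => x y /= x0; pose N := 3 + (x ^ 2 + y ^ 2) / x.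
have q : 0 <= (x ^ 2 + y ^ 2) / x by apply: Rdiv_le_0_compat => //; nra.
exists N; split; first by rewrite /N; lra.
rewrite /Cmod /=; apply: Rlt_le_trans (_ : sqrt (N * N) <= N); last by rewrite sqrt_square; rewrite /N; lra.
apply: sqrt_lt_1_alt; split.
  by have := Rle_0_sqr (N + - x); have := Rle_0_sqr y; rewrite /Rsqr; lra.
have e : (x ^ 2 + y ^ 2) / x * x = x ^ 2 + y ^ 2 by field; lra.
move: e q; rewrite /N; move: ((x ^ 2 + y ^ 2) / x) => t e q.
by nra.
Qed.

Lemma Lterm_ex s : 0 < Re s ->
  is_series (fun j => Re (Lterm f s j)) (Re (Lfun f s)) /\
  is_series (fun j => Im (Lterm f s j)) (Im (Lfun f s)).
Proof.
move=> /in_disc[N [N3 sN]]; have N0 : 0 < N by lra.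
have := Lterm_series N0 sN; rewrite -(Lfun_ps N0 sN).
by rewrite (_ : (RtoC N - (RtoC N - s) = s)%C) //; ring.
Qed.

Lemma Dirichlet_partial (p : C -> R) (s : C) (l : R) : 0 < Re s ->
  (forall z, Rabs (p z) <= Cmod z) ->
  is_series (fun j => psum f j.+1 * (p (nat_Cpow_opp j.+1 s) - p (nat_Cpow_opp j.+2 s))) l ->
  is_series (fun j => f j.+1 * p (nat_Cpow_opp j.+1 s)) l.
Proof.
move=> s0 pb h; change (is_lim_seq (sum_n (fun j => f j.+1 * p (nat_Cpow_opp j.+1 s))) (Rbar.Finite l)).
apply: (is_lim_seq_ext (fun n => sum_n (fun j => psum f j.+1 * (p (nat_Cpow_opp j.+1 s) - p (nat_Cpow_opp j.+2 s))) n + psum f n.+1 * p (nat_Cpow_opp n.+2 s))).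
  by move=> n; rewrite !sum_n_big (summation_by_parts f (fun j => p (nat_Cpow_opp j.+1 s))).
rewrite -(Rplus_0_r l); apply: is_lim_seq_plus' => //; apply/is_lim_seq_abs_0.
apply: (is_lim_seq_le_le (fun _ => 0) _ (fun M => Q * Cmod (nat_Cpow_opp M.+2 s))).
- move=> M; split; first exact: Rabs_pos.
  rewrite Rabs_mult; apply: Rmult_le_compat => //; exact: Rabs_pos.
- exact: is_lim_seq_const.
have := is_lim_seq_scal_l _ Q _ ((is_lim_seq_incr_1 _ _).1 (Cmod_npow_lim s0)).
by rewrite /Rbar_mult /= Rmult_0_r.
Qed.

Lemma is_series_C (a : nat -> C) (l : C) :
  is_series (fun n => Re (a n)) (Re l) -> is_series (fun n => Im (a n)) (Im l) ->
  @is_series C_AbsRing C_NormedModule a l.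
Proof.
move=> h1 h2.
have e n : sum_n (G := C_NormedModule) a n = (sum_n (fun n => Re (a n)) n, sum_n (fun n => Im (a n)) n).
  elim: n => [|n IHn]; first by rewrite !sum_O; case: (a 0%N).
  by rewrite !sum_Sn IHn /plus /=; case: (a n.+1).
apply/filterlim_locally => eps.
have /filterlim_locally/(_ eps) H1 := h1; have /filterlim_locally/(_ eps) H2 := h2.
apply: filter_imp (filter_and _ _ H1 H2) => n [B1 B2].
by rewrite e; split.
Qed.

Lemma Dirichlet_series_Re (s : C) : 0 < Re s ->
  is_series (fun j => f j.+1 * Re (nat_Cpow_opp j.+1 s)) (Re (Lfun f s)) /\
  is_series (fun j => f j.+1 * Im (nat_Cpow_opp j.+1 s)) (Im (Lfun f s)).
Proof.
move=> s0; have [h1 h2] := Lterm_ex s0; split; apply: Dirichlet_partial => //.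
- exact: re_le_Cmod.
- by apply: is_series_ext h1 => j; rewrite /Lterm Re_RtoC_mult.
- exact: Rabs_Im_le.
by apply: is_series_ext h2 => j; rewrite /Lterm Im_RtoC_mult.
Qed.

Lemma Lfun_Dirichlet (s : C) : 0 < Re s ->
  @is_series C_AbsRing C_NormedModule
    (fun k => Cmult (RtoC (f k.+1)) (nat_Cpow_opp k.+1 s)) (Lfun f s).
Proof.
move=> s0; have [h1 h2] := Dirichlet_series_Re s0; apply: is_series_C.
  by apply: is_series_ext h1 => k; rewrite Re_RtoC_mult.
by apply: is_series_ext h2 => k; rewrite Im_RtoC_mult.
Qed.

Lemma is_derive_quadratic (F : C -> C) (s l : C) (M d : R) : 0 < d -> 0 <= M ->
  (forall w, Cmod (w - s)%C < d -> Cmod (F w - F s - l * (w - s))%C <= M * Cmod (w - s)%C ^ 2) ->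
  @is_derive C_AbsRing C_NormedModule F s l.
Proof.
move=> d0 M0 H; split; first exact: is_linear_scal_l.
move=> x Hx; have <- : s = x := @is_filter_lim_locally_unique C_AbsRing (AbsRing_NormedModule C_AbsRing) s x Hx.
move=> eps; apply: (@locally_le_locally_norm C_AbsRing (AbsRing_NormedModule C_AbsRing)).
have e' : 0 < Rmin d (eps / (M + 1)).
  by apply: Rmin_glb_lt => //; apply: Rdiv_lt_0_compat; [exact: cond_pos | lra].
exists (mkposreal _ e') => w Hw.
have {}Hw : Cmod (w - s)%C < Rmin d (eps / (M + 1)) by exact: Hw.
have h1 := Rlt_le_trans _ _ _ Hw (Rmin_l _ _); have h2 := Rlt_le_trans _ _ _ Hw (Rmin_r _ _).
change (Cmod (F w - F s - (w - s) * l)%C <= eps * Cmod (w - s)%C).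
rewrite (Cmult_comm _ l); apply: Rle_trans (H w h1) _.
have c0 := Cmod_ge_0 (w - s)%C.
rewrite -[_ ^ 2]/(Cmod (w - s)%C * (Cmod (w - s)%C * 1)) Rmult_1_r -Rmult_assoc.
apply: Rmult_le_compat_r => //.
have M1 : 0 < M + 1 by lra.
have h3 := (Rlt_div_r _ _ _ M1).2 h2.
by nra.
Qed.

(** The quadratic remainder serves twice: it yields the complex differentiability that
    [is_dirichlet_L] requires, and at a zero of L it gives the linear decay used in the 3-4-1
    argument. *)
Lemma Lfun_derive_quad (s : C) : 0 < Re s -> exists l M d, [/\ 0 < d, 0 <= M &
  forall w, Cmod (w - s)%C < d -> Cmod (Lfun f w - Lfun f s - l * (w - s))%C <= M * Cmod (w - s)%C ^ 2].
Proof.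
move=> /in_disc[N [N3 sN]]; have N0 : 0 < N by lra.
set z := (RtoC N - s)%C in sN.
have z0 := Cmod_ge_0 z.
pose r := (Cmod z + N) / 2; have rr : 0 < r < N by rewrite /r; lra.
pose b := coefL f N.
have bb k : Rabs (b k) <= 2 * Q * / N ^ k by apply: coefL_bound.
exists (- psD b z)%C, (2 * (lipC (2 * Q) N r / r)), ((N - Cmod z) / 2).
have d0 : 0 < (N - Cmod z) / 2 by lra.
split=> //.
  apply: Rmult_le_pos; first lra; apply: Rdiv_le_0_compat; last lra.
  apply: Series_ge0; last by apply: lip_ex => //; lra.
  move=> i; apply: Rmult_le_pos.
    by apply: Rdiv_le_0_compat => //; have := Q_ge0 fQ; lra.
  by apply: Rmult_le_pos; [exact: pow2_ge_0 | apply: pow_le; apply: Rdiv_le_0_compat; lra].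
move=> w wd; set z' := (RtoC N - w)%C.
have ez : (z' - z = - (w - s))%C by rewrite /z /z'; ring.
have zr : Cmod z <= r by rewrite /r; lra.
have z'r : Cmod z' <= r.
  have -> : z' = (z + (z' - z))%C by ring.
  apply: Rle_trans (Cmod_triangle _ _) _; rewrite ez Cmod_opp /r; lra.
have := psC_quadratic N0 bb rr zr z'r; rewrite ez Cmod_opp.
have -> : Lfun f w = psC b z'.
  by rewrite -Lfun_ps; [congr Lfun; rewrite /z'; ring | | lra].
have -> : Lfun f s = psC b z.
  by rewrite -Lfun_ps; [congr Lfun; rewrite /z; ring | | lra].
by rewrite (_ : (psD b z * - (w - s) = - psD b z * (w - s))%C) //; ring.
Qed.

Lemma Lfun_ex_derive (s : C) : 0 < Re s -> @ex_derive C_AbsRing C_NormedModule (Lfun f) s.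
Proof.
move=> s0; have [l [M [d [d0 M0 H]]]] := Lfun_derive_quad s0.
by exists l; apply: is_derive_quadratic H.
Qed.

Lemma Lfun_local_lipschitz (s : C) : 0 < Re s -> Lfun f s = RtoC 0 -> exists M d, [/\ 0 < d, 0 <= M &
  forall w, Cmod (w - s)%C < d -> Cmod (Lfun f w) <= M * Cmod (w - s)%C].
Proof.
move=> s0 Ls; have [l [M [d [d0 M0 H]]]] := Lfun_derive_quad s0.
exists (M * d + Cmod l), d; split=> //.
  by have := Cmod_ge_0 l; nra.
move=> w wd; have := H w wd; rewrite Ls.
rewrite (_ : Lfun f w = (Lfun f w - 0 - l * (w - s)) + l * (w - s))%C; last by ring.
set E := (Lfun f w - 0 - _)%C; rewrite (_ : (E + _ - 0 - _ = E)%C); last by ring.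
have h := Cmod_triangle E (l * (w - s))%C; rewrite Cmod_mult in h.
have c0 := Cmod_ge_0 (w - s)%C.
move=> h2; apply: Rle_trans h _; rewrite Rmult_plus_distr_r; apply: Rplus_le_compat_r.
apply: Rle_trans h2 _; rewrite Rmult_assoc /=; apply: Rmult_le_compat_l => //; nra.
Qed.

End L.

(** * Euler products and the zeta function *)

Definition coprime_upto P n := all (fun q => prime q ==> ~~ (q %| n)%N) (iota 0 P.+1).

Definition sieved (f : nat -> R) P n : R := if coprime_upto P n then f n else 0.

Lemma coprime_upto0 n : coprime_upto 0 n.
Proof. by []. Qed.

Lemma coprime_uptoS P n : coprime_upto P.+1 n = coprime_upto P n && (prime P.+1 ==> ~~ (P.+1 %| n)%N).
Proof. by rewrite /coprime_upto -{1}addn1 iotaD all_cat /= andbT. Qed.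

Lemma coprime_upto1 P : coprime_upto P 1.
Proof.
by apply/allP => q _; apply/implyP => pq; rewrite dvdn1; apply: contraTneq pq => ->.
Qed.

Lemma coprime_upto_small P n : (1 < n)%N -> (n <= P)%N -> coprime_upto P n = false.
Proof.
move=> n1 nP; apply/negbTE/allPn; exists (pdiv n).
  by rewrite mem_iota /= add0n ltnS (leq_trans (pdiv_leq (ltnW n1))).
by rewrite pdiv_prime //= pdiv_dvd.
Qed.

Lemma coprime_upto_mul P p n : prime p -> (P < p)%N -> coprime_upto P (p * n) = coprime_upto P n.
Proof.
move=> pp Pp; apply: eq_in_all => q; rewrite mem_iota add0n => /andP[_ qP].
case pq: (prime q) => //=; rewrite Euclid_dvdM // dvdn_prime2 //.
by case: eqP => // qp; lia.
Qed.

Section Sieve.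
Variable f : nat -> R.
Hypothesis f1 : f 1%N = 1.
Hypothesis fM : forall m n, f (m * n)%N = f m * f n.
Hypothesis fb : forall n, Rabs (f n) <= 1.

Lemma sieved0 n : sieved f 0 n = f n.
Proof. by rewrite /sieved coprime_upto0. Qed.

Lemma sieved_bound P n : Rabs (sieved f P n) <= 1.
Proof. by rewrite /sieved; case: ifP => _ //; rewrite Rabs_R0; lra. Qed.

Lemma sieved_mul P p n : prime p -> (P < p)%N -> sieved f P (p * n) = f p * sieved f P n.
Proof.
by move=> pp Pp; rewrite /sieved coprime_upto_mul //; case: ifP => _; rewrite ?fM ?Rmult_0_r.
Qed.

Section G.
Variables (g : nat -> R) (c : nat -> R).
Hypothesis gc : forall j, Rabs (g j.+1) <= c j.
Hypothesis ec : ex_series c.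

Lemma sieved_ex P : ex_series (fun j => Rabs (sieved f P j.+1 * g j.+1)).
Proof.
apply: ex_series_dom ec => j; rewrite Rabs_Rabsolu Rabs_mult.
by have := sieved_bound P j.+1; have := gc j; have := Rabs_pos (g j.+1); have := Rabs_pos (sieved f P j.+1); nra.
Qed.

(** Only n = 1 survives as P grows. The function [g] is general because the sieve is applied both to
    the parts of n^(-s) and to the weights [wt s k]. *)
Lemma sieve_lim : is_lim_seq (fun P => Series (fun j => sieved f P j.+1 * g j.+1)) (g 1%N).
Proof.
have -> : g 1%N = Series (fun j => if j == 0%N then g 1%N else 0).
  symmetry; apply: is_series_unique.
  change (is_lim_seq (sum_n (fun j => if j == 0%N then g 1%N else 0)) (Rbar.Finite (g 1%N))).
  apply: (is_lim_seq_ext (fun _ => g 1%N)); last exact: is_lim_seq_const.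
  by move=> n; rewrite sum_n_big big_ord_recl /= big1 ?Rplus_0_r.
apply: (@Tannery _ _ c) => //.
  move=> P j; rewrite Rabs_mult.
  by have := sieved_bound P j.+1; have := gc j; have := Rabs_pos (g j.+1); have := Rabs_pos (sieved f P j.+1); nra.
move=> j; apply: (is_lim_seq_ext_loc (fun _ => if j == 0%N then g 1%N else 0)); last exact: is_lim_seq_const.
exists j.+1 => P jP; rewrite /sieved; case: j jP => [|j] jP /=.
  by rewrite coprime_upto1 f1 Rmult_1_l.
by rewrite coprime_upto_small ?Rmult_0_l //; lia.
Qed.

Lemma sieve_step P : prime P.+1 ->
  ex_series (fun j => Rabs (sieved f P j.+1 * g (P.+1 * j.+1)%N)) /\
  Series (fun j => sieved f P.+1 j.+1 * g j.+1) =
  Series (fun j => sieved f P j.+1 * g j.+1) - f P.+1 * Series (fun j => sieved f P j.+1 * g (P.+1 * j.+1)%N).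
Proof.
move=> pp.
have e0 := sieved_ex P.
have eg : ex_series (fun j => Rabs (g j.+1)) by apply: ex_series_dom ec => j; rewrite Rabs_Rabsolu.
have [e1 H] := @series_multiples P.+1 (fun n => sieved f P n * g n) isT e0.
have [e3 _] := @series_multiples P.+1 g isT eg.
have e2 : ex_series (fun j => if (P.+1 %| j.+1)%N then sieved f P j.+1 * g j.+1 else 0).
  by apply: ex_series_dom e0 => k; case: ifP => _; [lra | rewrite Rabs_R0; exact: Rabs_pos].
split.
  apply: ex_series_dom e3 => k; rewrite Rabs_Rabsolu Rabs_mult.
  have := sieved_bound P k.+1; have := Rabs_pos (g (P.+1 * k.+1)); have := Rabs_pos (sieved f P k.+1); nra.
have -> : f P.+1 * Series (fun j => sieved f P j.+1 * g (P.+1 * j.+1)%N) =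
  Series (fun m => sieved f P (P.+1 * m.+1)%N * g (P.+1 * m.+1)%N).
  by rewrite -Series_scal_l; apply: Series_ext => j; rewrite sieved_mul // Rmult_assoc.
rewrite -H -Series_minus //; last exact: ex_series_abs.
apply: Series_ext => j; rewrite /sieved coprime_uptoS pp /=.
by case: (coprime_upto P j.+1); case: (P.+1 %| j.+1)%N => /=; ring.
Qed.

Lemma sieve_skip P : ~~ prime P.+1 ->
  Series (fun j => sieved f P.+1 j.+1 * g j.+1) = Series (fun j => sieved f P j.+1 * g j.+1).
Proof.
by move=> pp; apply: Series_ext => j; rewrite /sieved coprime_uptoS (negbTE pp) andbT.
Qed.

End G.
End Sieve.

Definition npw (sigma : R) (n : nat) : R := exp (- sigma * ln (INR n)).

Lemma npw_gt0 s n : 0 < npw s n.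
Proof. exact: exp_pos. Qed.

Lemma npw1 s : npw s 1 = 1.
Proof. by rewrite /npw ln_1 Rmult_0_r exp_0. Qed.

(** The right side is the integral of t^(-s) over [j + 1, j + 2]. The proof uses e^u >= 1 + u in
    place of integration. *)
Lemma npw_telescope s j : 1 < s -> npw s j.+2 <= npw (s - 1) j.+1 / (s - 1) - npw (s - 1) j.+2 / (s - 1).
Proof.
move=> s1; set a := ln (INR j.+1); set b := ln (INR j.+2).
have i1 : 0 < INR j.+1 by exact: INR_gt0.
have i2 : 0 < INR j.+2 by exact: INR_gt0.
have hb : exp (- b) <= b - a.
  have e : b - a = - ln (INR j.+1 / INR j.+2) by rewrite ln_div // /a /b; ring.
  have q : 0 < INR j.+1 / INR j.+2 by apply: Rdiv_lt_0_compat.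
  have h := exp_ineq1_le (ln (INR j.+1 / INR j.+2)); rewrite exp_ln // in h.
  have -> : exp (- b) = 1 - INR j.+1 / INR j.+2.
    by rewrite exp_Ropp exp_ln // (S_INR j.+1); field; rewrite -S_INR; lra.
  by rewrite e; lra.
have -> : npw s j.+2 = exp (- (s - 1) * b) * exp (- b) by rewrite /npw -exp_plus; congr exp; rewrite -/b; ring.
have -> : npw (s - 1) j.+1 = exp (- (s - 1) * b) * exp ((s - 1) * (b - a)).
  by rewrite /npw -exp_plus; congr exp; rewrite -/a; ring.
rewrite /npw -/b.
have h := exp_ineq1_le ((s - 1) * (b - a)).
have E := exp_pos (- (s - 1) * b).
move: (exp (- (s - 1) * b)) E => E E0.
move: (exp (- b)) (exp ((s - 1) * (b - a))) hb h => x y hb h.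
have -> : E * y / (s - 1) - E / (s - 1) = E * ((y - 1) / (s - 1)) by field; lra.
apply: Rmult_le_compat_l; first lra.
by apply: (proj1 (Rle_div_r _ _ _ _)); [lra | nra].
Qed.

Lemma zeta_bound s : 1 < s ->
  ex_series (fun j => npw s j.+1) /\ Series (fun j => npw s j.+1) <= 1 + / (s - 1).
Proof.
move=> s1; have i0 : 0 < / (s - 1) by apply: Rinv_0_lt_compat; lra.
have [e1 h1] := @telescope_series (fun j => npw s j.+2) (fun j => npw (s - 1) j.+1 / (s - 1))
  (fun i => conj (Rlt_le _ _ (npw_gt0 s i.+2)) (npw_telescope i s1))
  (fun i => Rlt_le _ _ (Rmult_lt_0_compat _ _ (npw_gt0 (s - 1) i.+1) i0)).
have e : ex_series (fun j => npw s j.+1) by apply/ex_series_incr_1.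
split=> //; rewrite Series_incr_1 // npw1.
by move: h1; rewrite npw1 /Rdiv Rmult_1_l; lra.
Qed.

Section Euler.
Variable f : nat -> R.
Hypothesis f1 : f 1%N = 1.
Hypothesis fM : forall m n, f (m * n)%N = f m * f n.
Hypothesis fb : forall n, Rabs (f n) <= 1.
Variable s : C.
Hypothesis s1 : 1 < Re s.

Definition Dsieved P : C := Cseries (fun j => RtoC (sieved f P j.+1) * nat_Cpow_opp j.+1 s)%C.

Lemma npow_Re_bound j : Rabs (Re (nat_Cpow_opp j.+1 s)) <= npw (Re s) j.+1.
Proof. by apply: Rle_trans (re_le_Cmod _) _; rewrite Cmod_npow; apply: Rle_refl. Qed.

Lemma npow_Im_bound j : Rabs (Im (nat_Cpow_opp j.+1 s)) <= npw (Re s) j.+1.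
Proof. by apply: Rle_trans (Rabs_Im_le _) _; rewrite Cmod_npow; apply: Rle_refl. Qed.

Lemma Dsieved_Re P : Re (Dsieved P) = Series (fun j => sieved f P j.+1 * Re (nat_Cpow_opp j.+1 s)).
Proof. by apply: Series_ext => j; exact: Re_RtoC_mult. Qed.

Lemma Dsieved_Im P : Im (Dsieved P) = Series (fun j => sieved f P j.+1 * Im (nat_Cpow_opp j.+1 s)).
Proof. by apply: Series_ext => j; exact: Im_RtoC_mult. Qed.

Lemma C_eq (z w : C) : Re z = Re w -> Im z = Im w -> z = w.
Proof. by case: z w => a b [c d] /= -> ->. Qed.

Lemma npow1 : nat_Cpow_opp 1 s = 1%C.
Proof. by rewrite /nat_Cpow_opp ln_1 Cmult_0_r /Cexp /= Ropp_0 exp_0 cos_0 sin_0 Rmult_1_r Rmult_0_r. Qed.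

Lemma Dsieved_lim : is_lim_seq (fun P => Re (Dsieved P)) 1 /\ is_lim_seq (fun P => Im (Dsieved P)) 0.
Proof.
have [ez _] := zeta_bound s1.
have l1 := @sieve_lim f f1 fb (fun n => Re (nat_Cpow_opp n s)) _ npow_Re_bound ez.
have l2 := @sieve_lim f f1 fb (fun n => Im (nat_Cpow_opp n s)) _ npow_Im_bound ez.
rewrite npow1 /= in l1 l2.
by split; [apply: is_lim_seq_ext l1 => P; rewrite Dsieved_Re | apply: is_lim_seq_ext l2 => P; rewrite Dsieved_Im].
Qed.

Lemma Dsieved_Cmod_lim : is_lim_seq (fun P => Cmod (Dsieved P)) 1.
Proof.
have [l1 l2] := Dsieved_lim.
have l3 := is_lim_seq_plus' _ _ _ _ (is_lim_seq_mult' _ _ _ _ l1 l1) (is_lim_seq_mult' _ _ _ _ l2 l2).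
have c1 : continuity_pt sqrt (1 * 1 + 0 * 0) by apply: continuity_pt_sqrt; lra.
have := is_lim_seq_continuous _ _ _ c1 l3.
rewrite (_ : sqrt (1 * 1 + 0 * 0) = 1); last by rewrite (_ : 1 * 1 + 0 * 0 = 1); [exact: sqrt_1 | ring].
by apply: is_lim_seq_ext => P; rewrite /Cmod /= !Rmult_1_r.
Qed.

Lemma Dsieved_step P : prime P.+1 ->
  Dsieved P.+1 = ((1 - RtoC (f P.+1) * nat_Cpow_opp P.+1 s) * Dsieved P)%C.
Proof.
move=> pp; have [ez _] := zeta_bound s1.
have [_ h1] := @sieve_step f fM fb (fun n => Re (nat_Cpow_opp n s)) _ npow_Re_bound ez P pp.
have [_ h2] := @sieve_step f fM fb (fun n => Im (nat_Cpow_opp n s)) _ npow_Im_bound ez P pp.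
have e1 := ex_series_abs (@sieved_ex f fb (fun n => Re (nat_Cpow_opp n s)) _ npow_Re_bound ez P).
have e2 := ex_series_abs (@sieved_ex f fb (fun n => Im (nat_Cpow_opp n s)) _ npow_Im_bound ez P).
set w := nat_Cpow_opp P.+1 s.
have gm j : nat_Cpow_opp (P.+1 * j.+1) s = (w * nat_Cpow_opp j.+1 s)%C by rewrite npow_mult.
have k1 : Series (fun j => sieved f P j.+1 * Re (nat_Cpow_opp (P.+1 * j.+1) s)) = Re w * Re (Dsieved P) - Im w * Im (Dsieved P).
  rewrite Dsieved_Re Dsieved_Im -!Series_scal_l -Series_minus; [|exact: ex_series_scal_l|exact: ex_series_scal_l].
  by apply: Series_ext => j; rewrite gm Re_mult; ring.
have k2 : Series (fun j => sieved f P j.+1 * Im (nat_Cpow_opp (P.+1 * j.+1) s)) = Re w * Im (Dsieved P) + Im w * Re (Dsieved P).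
  rewrite Dsieved_Re Dsieved_Im -!Series_scal_l -Series_plus; [|exact: ex_series_scal_l|exact: ex_series_scal_l].
  by apply: Series_ext => j; rewrite gm Im_mult; ring.
rewrite -Dsieved_Re -Dsieved_Re k1 in h1; rewrite -Dsieved_Im -Dsieved_Im k2 in h2.
apply: C_eq; [rewrite h1 | rewrite h2]; move: (w) (Dsieved P) => [a b] [c d] /=; ring.
Qed.

Lemma Dsieved_skip P : ~~ prime P.+1 -> Dsieved P.+1 = Dsieved P.
Proof.
move=> pp; apply: C_eq.
  by rewrite !Dsieved_Re; exact: (@sieve_skip f (fun n => Re (nat_Cpow_opp n s)) P pp).
by rewrite !Dsieved_Im; exact: (@sieve_skip f (fun n => Im (nat_Cpow_opp n s)) P pp).
Qed.

(** Removing the multiples of a prime multiplies the series by 1 - f(p) p^(-s), so a zero would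
    persist at every stage, whereas the sieved series tend to 1. *)
Lemma Dsieved0_neq0 : Dsieved 0 <> 0%C.
Proof.
move=> D0; have D P : Dsieved P = 0%C.
  elim: P => // P IH; case: (boolP (prime P.+1)) => pp.
    by rewrite Dsieved_step // IH Cmult_0_r.
  by rewrite Dsieved_skip.
have [l1 _] := Dsieved_lim.
have l0 : is_lim_seq (fun P => Re (Dsieved P)) 0.
  by apply: is_lim_seq_ext (is_lim_seq_const 0) => P; rewrite D.
by have := is_lim_seq_unique _ _ l1; rewrite (is_lim_seq_unique _ _ l0) => -[]; lra.
Qed.

Lemma Lfun_Dsieved Q : (forall n, Rabs (psum f n) <= Q) -> Lfun f s = Dsieved 0.
Proof.
move=> fQ; have s0 : 0 < Re s by lra.
have [h1 h2] := Dirichlet_series_Re fQ s0; apply: C_eq.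
  by rewrite Dsieved_Re -(is_series_unique _ _ h1); apply: Series_ext => j; rewrite sieved0.
by rewrite Dsieved_Im -(is_series_unique _ _ h2); apply: Series_ext => j; rewrite sieved0.
Qed.

End Euler.

(** * The zeta function near the line Re s = 1, away from its pole *)

Lemma Cexp_RtoC x : Cexp (RtoC x) = RtoC (exp x).
Proof. by rewrite /Cexp /= cos_0 sin_0 /RtoC; f_equal; ring. Qed.

Lemma Cexp_second_order (z : C) : Cmod (Cexp z - 1 - z)%C <= 2 * (Cmod z ^ 2 * exp (Cmod z)).
Proof.
set r := Cmod z; have r0 : 0 <= r := Cmod_ge_0 z.
have [h1 h2] := is_series_Cexp z.
have G (p : C -> R) E0 : (forall k, Rabs (p (z ^ k)%C) <= r ^ k) ->
    is_series (fun k => p (z ^ k)%C / INR (fact k)) E0 ->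
    Rabs (E0 - (p (z ^ 0)%C + p (z ^ 1)%C)) <= r ^ 2 * exp r.
  move=> pb h.
  have eh : ex_series (fun k => p (z ^ k)%C / INR (fact k)) by exists E0.
  rewrite -(is_series_unique _ _ h) (Series_tail_split 2 eh).
  rewrite (RsumS 1 (fun k => p (z ^ k)%C / INR (fact k))) (RsumS 0 (fun k => p (z ^ k)%C / INR (fact k))) big_ord0.
  change (INR (fact 0)) with 1; change (INR (fact 1)) with 1.
  rewrite (_ : _ - _ = Series (fun k => p (z ^ (2 + k)%N)%C / INR (fact (2 + k)))); last by field.
  rewrite -(is_series_unique _ _ (@is_series_exp r)) -Series_scal_l.
  apply: Series_dom; last by apply: ex_series_scal_l; eexists; exact: is_series_exp.
  move=> k; have f0 := INR_fact_pos k; have f2 := INR_fact_pos (2 + k).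
  have ff : INR (fact k) <= INR (fact (2 + k)) by apply: le_INR; apply: fact_le; lia.
  rewrite Rabs_div ?(Rabs_pos_eq (INR _)); [|lra|lra].
  rewrite -Rmult_assoc -pow_add /Rdiv; apply: Rmult_le_compat => //.
  - exact: Rabs_pos.
  - by apply/Rlt_le/Rinv_0_lt_compat.
  by apply: Rinv_le_contravar.
have g1 := G _ _ (Rabs_Re_pow z) h1; have g2 := G _ _ (Rabs_Im_pow z) h2.
apply: Rle_trans (Cmod_le_sum _) _.
have e1 : Re (Cexp z - 1 - z)%C = Re (Cexp z) - (Re (z ^ 0)%C + Re (z ^ 1)%C).
  by rewrite Cpow_1_r; change (Re (Cexp z) + - (1) + - Re z = Re (Cexp z) - (1 + Re z)); ring.
have e2 : Im (Cexp z - 1 - z)%C = Im (Cexp z) - (Im (z ^ 0)%C + Im (z ^ 1)%C).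
  by rewrite Cpow_1_r; change (Im (Cexp z) + - 0 + - Im z = Im (Cexp z) - (0 + Im z)); ring.
rewrite e1 e2; lra.
Qed.

Section ZetaBound.
Variables (sigma tau : R).
Hypothesis s12 : 1 < sigma <= 2.
Let s : C := (sigma, tau).
Let w : C := (sigma - 1, tau).
Let W := 1 + Rabs tau.
Let u n : C := nat_Cpow_opp n.+1 w.

Lemma zeta_w_bound : Cmod w <= W.
Proof.
by apply: Rle_trans (Cmod_le_sum _) _; rewrite /w /W /=; apply: Rplus_le_compat_r; split_Rabs; lra.
Qed.

(** With w = s - 1, the function t^(-w) has derivative - w t^(-s), so w n^(-s) is n^(-w) - (n +
    1)^(-w) up to O(n^(-2)), uniformly in 1 < sigma <= 2. Summation bounds (s - 1) zeta(s) as sigma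
    tends to 1, with no continuation of zeta. *)
Lemma zeta_diff n :
  Cmod (w * nat_Cpow_opp n.+1 s - (u n - u n.+1))%C <= (W + 2 * (W ^ 2 * exp W)) * / INR n.+1 ^ 2.
Proof.
set a := ln (INR n.+1); set b := ln (INR n.+2); pose h := b - a.
have i1 : 1 <= INR n.+1 by rewrite S_INR; have := pos_INR n; lra.
have i2 : INR n.+2 = INR n.+1 + 1 by rewrite S_INR.
have ea : exp a = INR n.+1 by apply: exp_ln; lra.
have eb : exp b = INR n.+2 by apply: exp_ln; lra.
have hu : h <= / INR n.+1.
  have := exp_ineq1_le h; rewrite /h exp_plus exp_Ropp ea eb i2.
  by rewrite Rmult_plus_distr_r Rinv_r; lra.
have hl : / INR n.+1 - / INR n.+1 ^ 2 <= h.
  have := exp_ineq1_le (- h); rewrite /h Ropp_minus_distr exp_plus exp_Ropp ea eb i2 => H.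
  apply: Rle_trans (_ : 1 - INR n.+1 * / (INR n.+1 + 1) <= _); last lra.
  rewrite (_ : 1 - _ = / (INR n.+1 + 1)); last by field; lra.
  rewrite (_ : / _ - _ = / (INR n.+1 + 1) - / (INR n.+1 ^ 2 * (INR n.+1 + 1))); last by field; lra.
  have : 0 < / (INR n.+1 ^ 2 * (INR n.+1 + 1)) by apply: Rinv_0_lt_compat; nra.
  lra.
have h0 : 0 <= h by rewrite /h; have := ln_INR_mono (leqnSn n); rewrite -/a -/b; lra.
have un1 : u n.+1 = (u n * Cexp (- (w * RtoC h)))%C.
  rewrite /u /nat_Cpow_opp -Cexp_plus -/a -/b; congr Cexp.
  by rewrite /h RtoC_minus; ring.
have sn : nat_Cpow_opp n.+1 s = (u n * RtoC (/ INR n.+1))%C.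
  have -> : RtoC (/ INR n.+1) = Cexp (RtoC (- a)).
    by rewrite Cexp_RtoC exp_Ropp ea.
  rewrite /u /nat_Cpow_opp -Cexp_plus -/a; congr Cexp.
  rewrite /s /w; apply: C_eq => /=; ring.
set E := (Cexp (- (w * RtoC h)) - 1 - (- (w * RtoC h)))%C.
have -> : (w * nat_Cpow_opp n.+1 s - (u n - u n.+1))%C = (u n * (w * RtoC (/ INR n.+1 - h) + E))%C.
  by rewrite sn un1 /E RtoC_minus; ring.
have u1 : Cmod (u n) <= 1.
  rewrite Cmod_npow -[X in _ <= X]exp_0; have := ln_INR_ge0 n; rewrite -/a => a0.
  have : - Re w * a <= 0 by rewrite /=; nra.
  by case/Rle_lt_or_eq_dec => [/exp_increasing/Rlt_le|->] //; apply: Rle_refl.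
have wW := zeta_w_bound; have w0 := Cmod_ge_0 w.
have W1 : 1 <= W by rewrite /W; have := Rabs_pos tau; lra.
have n2 : 0 < / INR n.+1 ^ 2 by apply: Rinv_0_lt_compat; nra.
have n1 : 0 < / INR n.+1 <= 1.
  by split; [apply: Rinv_0_lt_compat; lra | rewrite -Rinv_1; apply: Rinv_le_contravar; lra].
have EB : Cmod E <= 2 * (W ^ 2 * exp W) * / INR n.+1 ^ 2.
  apply: Rle_trans (Cexp_second_order _) _; rewrite Rmult_assoc; apply: Rmult_le_compat_l; first lra.
  have c : Cmod (- (w * RtoC h))%C = Cmod w * h by rewrite Cmod_opp Cmod_mult Cmod_R Rabs_pos_eq.
  rewrite c (_ : W ^ 2 * exp W * / INR n.+1 ^ 2 = (W * / INR n.+1) ^ 2 * exp W); last by field; lra.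
  apply: Rmult_le_compat; [exact: pow2_ge_0 | exact/Rlt_le/exp_pos | |].
    by apply: pow_incr; split; [apply: Rmult_le_pos | apply: Rmult_le_compat].
  have : Cmod w * h <= W by rewrite -(Rmult_1_r W); apply: Rmult_le_compat => //; lra.
  by case/Rle_lt_or_eq_dec => [/exp_increasing/Rlt_le|->] //; apply: Rle_refl.
rewrite Cmod_mult -(Rmult_1_l ((_ + _) * _)).
apply: Rmult_le_compat => //; [exact: Cmod_ge_0 | exact: Cmod_ge_0 |].
apply: Rle_trans (Cmod_triangle _ _) _; rewrite Rmult_plus_distr_r; apply: Rplus_le_compat => //.
rewrite Cmod_mult Cmod_R Rabs_pos_eq; last lra.
by apply: Rmult_le_compat => //; lra.
Qed.

Definition zeta_const : R := 2 + (W + 2 * (W ^ 2 * exp W)) * Series (fun k => / INR k.+1 ^ 2).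

Definition zeta_part M : C :=
  (\big[Rplus/0]_(n < M) Re (nat_Cpow_opp n.+1 s), \big[Rplus/0]_(n < M) Im (nat_Cpow_opp n.+1 s)).

Lemma zeta_part_bound M : Cmod (w * zeta_part M)%C <= zeta_const.
Proof.
have W1 : 1 <= W by rewrite /W; have := Rabs_pos tau; lra.
have u1 n : Cmod (u n) <= 1.
  rewrite Cmod_npow -[X in _ <= X]exp_0; have a0 := ln_INR_ge0 n.
  have : - Re w * ln (INR n.+1) <= 0 by change (Re w) with (sigma - 1); nra.
  by case/Rle_lt_or_eq_dec => [/exp_increasing/Rlt_le|->] //; apply: Rle_refl.
have K0 : 0 <= W + 2 * (W ^ 2 * exp W) by have := exp_pos W; nra.
have H : Cmod (w * zeta_part M - (u 0%N - u M))%C <=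
   (W + 2 * (W ^ 2 * exp W)) * \big[Rplus/0]_(n < M) / INR n.+1 ^ 2.
  elim: M => [|M IHM].
    rewrite /zeta_part !big_ord0 Rmult_0_r (_ : (_ - _)%C = 0%C) ?Cmod_0; first exact: Rle_refl.
    by rewrite -[(0, 0)]/(RtoC 0); ring.
  rewrite (RsumS M (fun n => / INR n.+1 ^ 2)) Rmult_plus_distr_l.
  have -> : (w * zeta_part M.+1 - (u 0%N - u M.+1))%C =
     ((w * zeta_part M - (u 0%N - u M)) + (w * nat_Cpow_opp M.+1 s - (u M - u M.+1)))%C.
    have -> : zeta_part M.+1 = (zeta_part M + nat_Cpow_opp M.+1 s)%C.
      by rewrite /zeta_part (RsumS M (fun n => Re (nat_Cpow_opp n.+1 s))) (RsumS M (fun n => Im (nat_Cpow_opp n.+1 s))).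
    by ring.
  by apply: Rle_trans (Cmod_triangle _ _) _; apply: Rplus_le_compat => //; exact: zeta_diff.
have -> : (w * zeta_part M)%C = ((w * zeta_part M - (u 0%N - u M)) + (u 0%N - u M))%C by ring.
apply: Rle_trans (Cmod_triangle _ _) _; rewrite /zeta_const Rplus_comm; apply: Rplus_le_compat.
  apply: Rle_trans (Cmod_triangle _ _) _; rewrite Cmod_opp.
  by have := u1 0%N; have := u1 M; lra.
apply: Rle_trans H _; apply: Rmult_le_compat_l => //.
apply: partial_le_Series; last exact: ex_series_inv_sq.
by move=> i; apply/Rlt_le/Rinv_0_lt_compat/pow_lt/INR_gt0.
Qed.

Lemma zeta_bound_line : tau <> 0 -> Cmod (Dsieved (fun _ => 1) s 0) <= 2 * (zeta_const / Rabs tau).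
Proof.
move=> t0; have t0' : 0 < Rabs tau by apply: Rabs_pos_lt.
have s1 : 1 < Re s by rewrite /=; lra.
have [ez _] := zeta_bound s1.
have fb : forall n : nat, Rabs 1 <= 1 by move=> _; rewrite Rabs_R1; lra.
have P M : Cmod (zeta_part M) <= zeta_const / Rabs tau.
  have := zeta_part_bound M; rewrite Cmod_mult => h.
  have wt : Rabs tau <= Cmod w by exact: (Rabs_Im_le w).
  apply: (proj1 (Rle_div_r _ _ _ t0')); apply: Rle_trans h.
  by rewrite Rmult_comm; apply: Rmult_le_compat_r => //; exact: Cmod_ge_0.
have B (p : C -> R) : (forall z, Rabs (p z) <= Cmod z) -> (forall M, \big[Rplus/0]_(n < M) p (nat_Cpow_opp n.+1 s) = p (zeta_part M)) ->
    Rabs (Series (fun j => sieved (fun _ => 1) 0 j.+1 * p (nat_Cpow_opp j.+1 s))) <= zeta_const / Rabs tau.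
  move=> pb pe.
  have e : ex_series (fun j => sieved (fun _ => 1) 0 j.+1 * p (nat_Cpow_opp j.+1 s)).
    apply/ex_series_abs/(@sieved_ex (fun _ => 1) fb (fun n => p (nat_Cpow_opp n s)) _ _ ez) => j.
    by apply: Rle_trans (pb _) _; rewrite Cmod_npow; apply: Rle_refl.
  have l := is_lim_seq_abs _ (Rbar.Finite _) (Series_correct _ e).
  apply: (is_lim_seq_le _ (fun _ => zeta_const / Rabs tau) _ _ _ l (is_lim_seq_const _)) => n.
  rewrite sum_n_big (eq_bigr (fun j : 'I_n.+1 => p (nat_Cpow_opp j.+1 s))).
    by rewrite pe; apply: Rle_trans (P n.+1).
  by move=> j _; rewrite sieved0 Rmult_1_l.
apply: Rle_trans (Cmod_le_sum _) _; rewrite Dsieved_Re Dsieved_Im.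
have := B Re re_le_Cmod (fun M => erefl); have := B Im Rabs_Im_le (fun M => erefl); lra.
Qed.

End ZetaBound.

(** * Nonvanishing on the line Re s = 1 off the real axis *)

Definition polarC (rho phi : R) : C := (rho * cos phi, rho * sin phi).

Lemma Cmod_one_minus rho phi : 0 <= rho < 1 ->
  Cmod (1 - polarC rho phi)%C = exp (halfln rho phi).
Proof.
move=> r1; have q : 0 < 1 - 2 * rho * cos phi + rho ^ 2 by apply: quad_pos; rewrite Rabs_pos_eq; lra.
have -> : exp (halfln rho phi) = sqrt (1 - 2 * rho * cos phi + rho ^ 2).
  by rewrite -Rpower_sqrt // /Rpower /halfln; congr exp; field.
rewrite /Cmod; congr sqrt => /=.
have e := sin2_cos2 phi; rewrite /Rsqr in e.
have -> : rho * (rho * 1) = rho * rho * (sin phi * sin phi + cos phi * cos phi) by rewrite e; ring.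
by ring.
Qed.

Lemma npow_polar (sigma tau : R) n :
  nat_Cpow_opp n (sigma, tau) = polarC (npw sigma n) (- tau * ln (INR n)).
Proof.
rewrite /nat_Cpow_opp /Cexp /npw /polarC /=.
have -> : - (sigma * ln (INR n) - tau * 0) = - sigma * ln (INR n) by ring.
by have -> : - (sigma * 0 + tau * ln (INR n)) = - tau * ln (INR n) by ring.
Qed.

(** From 3 + 4 cos t + cos 2t = 2 (1 + cos t)^2 >= 0, summed against x^j / j. For eps = -1 the angle
    is shifted by pi; for eps = 0 the middle term drops out and 3 + cos 2t >= 0 remains. The last
    factor carries no character, so the third series will be zeta itself. *)
Lemma mertens_local x theta eps : 0 <= x < 1 -> (eps = 1 \/ eps = 0 \/ eps = -1) ->
  Cmod (1 - polarC x 0)%C ^ 3 * Cmod (1 - RtoC eps * polarC x theta)%C ^ 4 *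
  Cmod (1 - polarC x (2 * theta))%C <= 1.
Proof.
move=> x1 he.
have x0 k : 0 <= x ^ k by apply: pow_le; lra.
have main a : (forall k, 0 <= 3 + 4 * a k + cos (INR k * (2 * theta))) -> forall l,
    is_series (fun j => x ^ j.+1 * a j.+1 / INR j.+1) (- l) ->
    3 * halfln x 0 + 4 * l + halfln x (2 * theta) <= 0.
  move=> ha l hl.
  have s1 := @is_series_logcos 0 x x1; have s2 := @is_series_logcos (2 * theta) x x1.
  have S := is_series_plus _ _ _ _ (is_series_plus _ _ _ _ (is_series_scal_l 3 _ _ s1) (is_series_scal_l 4 _ _ hl)) s2.
  have : 0 <= 3 * (- ln (1 - 2 * x * cos 0 + x ^ 2) / 2) + 4 * - l + - ln (1 - 2 * x * cos (2 * theta) + x ^ 2) / 2.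
    have e : ex_series (fun j => 3 * (x ^ j.+1 * cos (INR j.+1 * 0) / INR j.+1) + 4 * (x ^ j.+1 * a j.+1 / INR j.+1) + x ^ j.+1 * cos (INR j.+1 * (2 * theta)) / INR j.+1).
      by eexists; exact: S.
    have := is_series_unique _ _ S.
    change (Series (fun j => 3 * (x ^ j.+1 * cos (INR j.+1 * 0) / INR j.+1) + 4 * (x ^ j.+1 * a j.+1 / INR j.+1) + x ^ j.+1 * cos (INR j.+1 * (2 * theta)) / INR j.+1) = 3 * (- ln (1 - 2 * x * cos 0 + x ^ 2) / 2) + 4 * - l + - ln (1 - 2 * x * cos (2 * theta) + x ^ 2) / 2 -> 0 <= 3 * (- ln (1 - 2 * x * cos 0 + x ^ 2) / 2) + 4 * - l + - ln (1 - 2 * x * cos (2 * theta) + x ^ 2) / 2).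
    move=> <-; apply: Series_ge0 => // j.
    rewrite Rmult_0_r cos_0.
    have -> : 3 * (x ^ j.+1 * 1 / INR j.+1) + 4 * (x ^ j.+1 * a j.+1 / INR j.+1) + x ^ j.+1 * cos (INR j.+1 * (2 * theta)) / INR j.+1 = x ^ j.+1 * (3 + 4 * a j.+1 + cos (INR j.+1 * (2 * theta))) / INR j.+1 by field; apply: Rgt_not_eq; exact: INR_gt0.
    by apply: Rdiv_le_0_compat; [apply: Rmult_le_pos | exact: INR_gt0].
  by rewrite /halfln; lra.
have cos2 t : cos (2 * t) = 2 * cos t * cos t - 1 by exact: cos_2a_cos.
have ang k p : cos (INR k * (2 * (theta + p))) = cos (INR k * (2 * theta)) -> 0 <= 3 + 4 * cos (INR k * (theta + p)) + cos (INR k * (2 * theta)).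
  move=> <-; rewrite (_ : INR k * (2 * (theta + p)) = 2 * (INR k * (theta + p))); last ring.
  rewrite cos2; move: (cos _) => c; have := Rle_0_sqr (c + 1); rewrite /Rsqr; lra.
have hl p : is_series (fun j => x ^ j.+1 * cos (INR j.+1 * (theta + p)) / INR j.+1) (- halfln x (theta + p)).
  have := @is_series_logcos (theta + p) x x1; rewrite (_ : - ln _ / 2 = - halfln x (theta + p)) // /halfln; field.
have [l hC hle] : exists2 l, Cmod (1 - RtoC eps * polarC x theta)%C = exp l & 3 * halfln x 0 + 4 * l + halfln x (2 * theta) <= 0.
  case: he => [->|[->|->]].
  - exists (halfln x (theta + 0)).
      by rewrite -Cmod_one_minus // Rplus_0_r Cmult_1_l.
    apply: (main (fun k => cos (INR k * (theta + 0)))) => // k.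
    by apply: ang; rewrite Rplus_0_r.
  - exists 0.
      have e : (1 - 0)%C = 1%C by ring.
      by rewrite Cmult_0_l exp_0 e Cmod_1.
    apply: (main (fun _ => 0)) => [k|]; first by have := COS_bound (INR k * (2 * theta)); lra.
    rewrite Ropp_0; apply: (is_series_ext (fun _ => 0)) => [j|]; first by rewrite Rmult_0_r /Rdiv Rmult_0_l.
    by apply: is_lim_seq_ext (is_lim_seq_const 0) => m; rewrite sum_n_big big1.
  exists (halfln x (theta + PI)).
    rewrite -Cmod_one_minus // /polarC neg_cos neg_sin; congr Cmod.
    by apply: C_eq => /=; ring.
  apply: (main (fun k => cos (INR k * (theta + PI)))) => // k.
  apply: ang; rewrite (_ : INR k * (2 * (theta + PI)) = INR k * (2 * theta) + 2 * INR k * PI); last ring.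
  exact: cos_period.
rewrite hC !Cmod_one_minus // -[X in _ <= X]exp_0.
have pw a n : exp a ^ n = exp (INR n * a).
  elim: n => [|n IHn]; first by rewrite /= Rmult_0_l exp_0.
  by rewrite -[exp a ^ n.+1]/(exp a * exp a ^ n) IHn -exp_plus S_INR; congr exp; ring.
rewrite !pw -!exp_plus /=.
rewrite (_ : _ + _ = 3 * halfln x 0 + 4 * l + halfln x (2 * theta)); last ring.
by case/Rle_lt_or_eq_dec: hle => [/exp_increasing/Rlt_le|->] //; apply: Rle_refl.
Qed.

Section NonvanishingLine.
Variable f : nat -> R.
Hypothesis f1 : f 1%N = 1.
Hypothesis fM : forall m n, f (m * n)%N = f m * f n.
Hypothesis f3 : forall n, f n = 1 \/ f n = 0 \/ f n = -1.

Lemma f3_bound n : Rabs (f n) <= 1.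
Proof. by case: (f3 n) => [|[]] ->; split_Rabs; lra. Qed.

(** By [mertens_local] a sieving step can only decrease the product, and the sieved products tend to
    1. *)
Lemma mertens_341 sigma tau : 1 < sigma ->
  1 <= Cmod (Dsieved (fun _ => 1) (sigma, 0) 0) ^ 3 * Cmod (Dsieved f (sigma, tau) 0) ^ 4 *
       Cmod (Dsieved (fun _ => 1) (sigma, 2 * tau) 0).
Proof.
move=> s1.
have o1 : (fun _ : nat => 1) 1%N = 1 by [].
have oM : forall m n : nat, (fun _ : nat => 1) (m * n)%N = (fun _ : nat => 1) m * (fun _ : nat => 1) n by move=> *; ring.
have ob : forall n : nat, Rabs ((fun _ : nat => 1) n) <= 1 by move=> _; rewrite Rabs_R1; lra.
pose q P := Cmod (Dsieved (fun _ => 1) (sigma, 0) P) ^ 3 * Cmod (Dsieved f (sigma, tau) P) ^ 4 *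
       Cmod (Dsieved (fun _ => 1) (sigma, 2 * tau) P).
have dec P : q P.+1 <= q P.
  rewrite /q; case: (boolP (prime P.+1)) => pp; last first.
    by rewrite !Dsieved_skip //; apply: Rle_refl.
  rewrite (@Dsieved_step _ oM ob (sigma, 0)) // (@Dsieved_step f fM f3_bound (sigma, tau)) // (@Dsieved_step _ oM ob (sigma, 2 * tau)) //.
  rewrite !Cmult_1_l !Cmod_mult !npow_polar.
  set x := npw sigma P.+1.
  have x1 : 0 <= x < 1.
    split; first exact/Rlt_le/npw_gt0.
    rewrite /x /npw -exp_0; apply: exp_increasing.
    have : 0 < ln (INR P.+1).
      rewrite -ln_1; apply: ln_increasing; first lra.
      by apply: (lt_INR 1); have := prime_gt1 pp; lia.
    by nra.
  have -> : - 0 * ln (INR P.+1) = 0 by ring.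
  have -> : - (2 * tau) * ln (INR P.+1) = 2 * (- tau * ln (INR P.+1)) by ring.
  have := mertens_local (- tau * ln (INR P.+1)) x1 (f3 P.+1).
  set a := Cmod _; set b := Cmod _; set c := Cmod _ => h.
  have := q; rewrite !Rpow_mult_distr => _.
  set A := Cmod _ ^ 3; set B := Cmod _ ^ 4; set D := Cmod _.
  have A0 : 0 <= A by apply: pow_le; exact: Cmod_ge_0.
  have B0 : 0 <= B by apply: pow_le; exact: Cmod_ge_0.
  have D0 : 0 <= D by exact: Cmod_ge_0.
  have -> : a ^ 3 * A * (b ^ 4 * B) * (c * D) = (a ^ 3 * b ^ 4 * c) * (A * B * D) by ring.
  rewrite -[X in _ <= X]Rmult_1_l; apply: Rmult_le_compat_r => //.
  by apply: Rmult_le_pos => //; apply: Rmult_le_pos.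
have lim : is_lim_seq q (1 ^ 3 * 1 ^ 4 * 1).
  have pw u k : is_lim_seq u 1 -> is_lim_seq (fun n => u n ^ k) (1 ^ k).
    move=> hu; elim: k => [|k IHk]; first exact: is_lim_seq_const.
    exact: is_lim_seq_mult'.
  apply: is_lim_seq_mult'; first apply: is_lim_seq_mult'; try apply: pw.
  - exact: (@Dsieved_Cmod_lim _ o1 ob (sigma, 0)).
  - exact: (@Dsieved_Cmod_lim f f1 f3_bound (sigma, tau)).
  - exact: (@Dsieved_Cmod_lim _ o1 ob (sigma, 2 * tau)).
have dec' P : q P <= q 0%N by elim: P => [|P IH]; [exact: Rle_refl | exact: Rle_trans (dec P) IH].
have h : 1 ^ 3 * 1 ^ 4 * 1 <= q 0%N := is_lim_seq_le q (fun _ => q 0%N) (Rbar.Finite _) (Rbar.Finite _) dec' lim (is_lim_seq_const _).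
by apply: Rle_trans h; lra.
Qed.

Lemma zeta_real_bound sigma : 1 < sigma -> Cmod (Dsieved (fun _ => 1) (sigma, 0) 0) <= 2 * (1 + / (sigma - 1)).
Proof.
move=> s1; have [ez hz] := zeta_bound s1.
apply: Rle_trans (_ : 2 * Series (fun j => npw sigma j.+1) <= _); last lra.
apply: Cseries_bound => // j.
by rewrite sieved0 Cmult_1_l Cmod_npow; apply: Rle_refl.
Qed.

(** If L vanished at 1 + i tau, then at abscissa 1 + u the 3-4-1 product would be O(u^(-3) u^4), the
    last factor staying bounded because tau is nonzero; for small u this is below 1. *)
Lemma Lfun_line_neq0 Q tau : (forall n, Rabs (psum f n) <= Q) -> tau <> 0 -> Lfun f (1, tau) <> 0%C.
Proof.
move=> fQ t0 L0.
have s0 : 0 < Re (1, tau) by rewrite /=; lra.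
have [M [d [d0 M0 H]]] := Lfun_local_lipschitz fQ s0 L0.
pose B := 2 * (zeta_const (2 * tau) / Rabs (2 * tau)).
have B0 : 0 <= B.
  apply: Rle_trans (@zeta_bound_line 2 (2 * tau) _ _); [exact: Cmod_ge_0 | lra | lra].
pose K := 2 ^ 3 * 2 ^ 3 * M ^ 4 * B.
have K0 : 0 <= K by apply: Rmult_le_pos => //; apply: Rmult_le_pos; [lra | exact: pow_le].
pose u := Rmin (1 / 2) (Rmin (d / 2) (/ (K + 1) / 2)).
have iK : 0 < / (K + 1) by apply: Rinv_0_lt_compat; lra.
have u0 : 0 < u by rewrite /u; apply: Rmin_glb_lt; [lra | apply: Rmin_glb_lt; lra].
have u1 : u <= 1 / 2 by exact: Rmin_l.
have u2 : u <= d / 2 by apply: Rle_trans (Rmin_r _ _) (Rmin_l _ _).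
have u3 : u <= / (K + 1) / 2 by apply: Rle_trans (Rmin_r _ _) (Rmin_r _ _).
have s1 : 1 < 1 + u by lra.
have h1 := mertens_341 tau s1.
have h2 := zeta_real_bound s1; rewrite (_ : 1 + u - 1 = u) in h2; last ring.
have h3 : Cmod (Dsieved f (1 + u, tau) 0) <= M * u.
  rewrite -(@Lfun_Dsieved f (1 + u, tau) s1 Q fQ).
  have cu : Cmod (Cminus (1 + u, tau) (1, tau)) = u.
    by rewrite -[X in _ = X](Rabs_pos_eq u) -?Cmod_R; [congr Cmod; apply: C_eq => /=; ring | lra].
  by have := H (1 + u, tau); rewrite cu; apply; lra.
have h4 : Cmod (Dsieved (fun _ => 1) (1 + u, 2 * tau) 0) <= B by apply: zeta_bound_line; lra.
have h2' : u * Cmod (Dsieved (fun _ => 1) (1 + u, 0) 0) <= 2 * 2.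
  apply: Rle_trans (Rmult_le_compat_l _ _ _ (Rlt_le _ _ u0) h2) _.
  by rewrite (_ : u * _ = 2 * (u + 1)); [lra | field; lra].
have g1 := Cmod_ge_0 (Dsieved (fun _ => 1) (1 + u, 0) 0).
have g2 := Cmod_ge_0 (Dsieved f (1 + u, tau) 0).
have g3 := Cmod_ge_0 (Dsieved (fun _ => 1) (1 + u, 2 * tau) 0).
move: h1 h2' h3 h4 g1 g2 g3; set a := Cmod _; set b := Cmod _; set c := Cmod _ => h1 h2' h3 h4 g1 g2 g3.
have k1 : (u * a) ^ 3 <= (2 * 2) ^ 3 by apply: pow_incr; split=> //; nra.
have k2 : b ^ 4 <= (M * u) ^ 4 by apply: pow_incr.
have : u ^ 3 <= (u * a) ^ 3 * b ^ 4 * c.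
  rewrite Rpow_mult_distr -[X in X <= _]Rmult_1_r.
  have -> : u ^ 3 * a ^ 3 * b ^ 4 * c = u ^ 3 * (a ^ 3 * b ^ 4 * c) by ring.
  by apply: Rmult_le_compat_l => //; apply: pow_le; lra.
have k3 : (u * a) ^ 3 * b ^ 4 * c <= (2 * 2) ^ 3 * (M * u) ^ 4 * B.
  apply: Rmult_le_compat => //.
    by apply: Rmult_le_pos; apply: pow_le => //; nra.
  by apply: Rmult_le_compat => //; apply: pow_le => //; nra.
rewrite (_ : (2 * 2) ^ 3 * (M * u) ^ 4 * B = K * u * u ^ 3) in k3; last by rewrite /K; ring.
have u3p : 0 < u ^ 3 by apply: pow_lt.
have Ku : K * u < 1.
  have : (K + 1) * u <= (K + 1) * (/ (K + 1) / 2) by apply: Rmult_le_compat_l; lra.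
  by rewrite (_ : (K + 1) * (/ (K + 1) / 2) = 1 / 2); [nra | field; lra].
move=> k4; have : K * u * u ^ 3 < 1 * u ^ 3 by apply: Rmult_lt_compat_r.
lra.
Qed.

End NonvanishingLine.

(** * Nonvanishing at s = 1 *)

Section Divisors.
Variable f : nat -> R.
Hypothesis f1 : f 1%N = 1.
Hypothesis fM : forall m n, f (m * n)%N = f m * f n.
Hypothesis f3 : forall n, f n = 1 \/ f n = 0 \/ f n = -1.

Definition divsum n : R := \big[Rplus/0]_(d <- divisors n) f d.

Lemma divisors_pfactor p a m : prime p -> (0 < m)%N -> ~~ (p %| m)%N ->
  perm_eq (divisors (p ^ a.+1 * m)) (divisors m ++ [seq (p * d)%N | d <- divisors (p ^ a * m)]).
Proof.
move=> pp m0 pm; have p0 := prime_gt0 pp.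
have n0 b : (0 < p ^ b * m)%N by rewrite muln_gt0 expn_gt0 p0.
apply: uniq_perm; first exact: divisors_uniq.
  rewrite cat_uniq divisors_uniq /= map_inj_uniq ?divisors_uniq ?andbT; last first.
    by move=> x y /eqP; rewrite eqn_pmul2l // => /eqP.
  apply/hasPn => _ /mapP[d _ ->]; rewrite -dvdn_divisors //.
  by apply: contra pm => /(dvdn_trans _); apply; exact: dvdn_mulr.
move=> d; rewrite mem_cat -!dvdn_divisors //.
apply/idP/orP => [dn|[dm|/mapP[e]]].
- case: (boolP (p %| d)%N) => [/dvdnP[e de]|pd].
    right; apply/mapP; exists e; last by rewrite mulnC.
    by move: dn; rewrite de -dvdn_divisors // expnS -mulnA mulnC dvdn_pmul2l.
  left; move: dn; rewrite Gauss_dvdr //.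
  by rewrite coprime_sym coprimeXl // prime_coprime.
- exact: dvdn_mull.
rewrite -dvdn_divisors // => en ->.
by rewrite expnS -mulnA dvdn_pmul2l.
Qed.

(** 1 + x + ... + x^a in Horner form, following the recursion of [divisors_pfactor]. *)
Fixpoint pgeo (x : R) a : R := if a is b.+1 then 1 + x * pgeo x b else 1.

Lemma divsum_pfactor p a m : prime p -> (0 < m)%N -> ~~ (p %| m)%N ->
  divsum (p ^ a * m) = pgeo (f p) a * divsum m.
Proof.
move=> pp m0 pm; elim: a => [|a IHa]; first by rewrite expn0 mul1n Rmult_1_l.
rewrite /divsum (perm_big _ (divisors_pfactor a pp m0 pm)) big_cat big_map /=.
rewrite [X in _ + X](eq_bigr (fun d => f p * f d)); last by move=> d _; exact: fM.
rewrite -big_distrr /= -/(divsum m) -/(divsum (p ^ a * m)) IHa; ring.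
Qed.

Lemma pgeo_ge0 p a : 0 <= pgeo (f p) a /\ (~~ odd a -> 1 <= pgeo (f p) a).
Proof.
have e1 : f p = 1 -> 1 <= pgeo (f p) a by move=> ->; elim: (a) => [|b IH] /=; lra.
have e2 : f p = 0 -> pgeo (f p) a = 1 by move=> ->; case: (a) => [|b] //=; lra.
have e3 : f p = -1 -> pgeo (f p) a = if odd a then 0 else 1.
  by move=> ->; elim: (a) => [|b IH] //=; rewrite IH; case: (odd b) => /=; lra.
case: (f3 p) => [/e1|[/e2|/e3]]; [split; lra | split; lra |].
by case: (odd a) => /= ->; split => //; lra.
Qed.

Lemma pfactor_split n : (1 < n)%N -> exists p a m,
  [/\ prime p, (0 < m < n)%N, ~~ (p %| m)%N & n = (p ^ a * m)%N].
Proof.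
move=> n1; have n0 := ltnW n1; have pp := pdiv_prime n1.
have [m pm nE] := pfactor_coprime pp n0.
exists (pdiv n), (logn (pdiv n) n), m; split => //.
- have m0 : (0 < m)%N by move: n0; rewrite nE; case: (m).
  rewrite m0 /= [X in (_ < X)%N]nE -{1}(muln1 m) ltn_pmul2l // -{1}(expn0 (pdiv n)).
  by rewrite ltn_exp2l ?prime_gt1 // logn_gt0 mem_primes pp n0 pdiv_dvd.
- by rewrite -prime_coprime.
by rewrite mulnC.
Qed.

Lemma divsum1 : divsum 1 = 1.
Proof. by rewrite /divsum (_ : divisors 1 = [:: 1%N]) // big_seq1. Qed.

Lemma divsum_ge0 n : (0 < n)%N -> 0 <= divsum n.
Proof.
elim: n {-2}n (leqnn n) => [|k IH] n nk n0; first by lia.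
case: (ltngtP 1 n) => [n1|n1|<-]; [|lia|rewrite divsum1; lra].
have [p [a [m [pp /andP[m0 mn] pm ->]]]] := pfactor_split n1.
rewrite divsum_pfactor //; apply: Rmult_le_pos; first by case: (pgeo_ge0 p a).
by apply: IH => //; lia.
Qed.

Lemma divsum_sqr n : (0 < n)%N -> 1 <= divsum (n ^ 2).
Proof.
elim: n {-2}n (leqnn n) => [|k IH] n nk n0; first by lia.
case: (ltngtP 1 n) => [n1|n1|<-]; [|lia|rewrite exp1n divsum1; lra].
have [p [a [m [pp /andP[m0 mn] pm ->]]]] := pfactor_split n1.
rewrite expnMn -expnM divsum_pfactor //; last by rewrite Euclid_dvdX // andbT.
  have [_ h1] := pgeo_ge0 p (a * 2); have {}h1 : 1 <= pgeo (f p) (a * 2) by apply: h1; rewrite oddM andbF.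
  have h2 : 1 <= divsum (m ^ 2) by apply: IH => //; lia.
  nra.
by rewrite expn_gt0 m0.
Qed.

(** All terms are nonnegative, and each of the K squares up to K^2 contributes at least 1. *)
Lemma divsum_total K : INR K <= \big[Rplus/0]_(k < K ^ 2) divsum k.+1.
Proof.
have mono a b : (a <= b)%N -> \big[Rplus/0]_(k < a) divsum k.+1 <= \big[Rplus/0]_(k < b) divsum k.+1.
  move/subnKC <-; elim: (b - a)%N => [|c IH]; first by rewrite addn0; apply: Rle_refl.
  rewrite addnS (RsumS _ (fun k => divsum k.+1)); have := @divsum_ge0 (a + c).+1 isT; lra.
elim: K => [|K IH]; first by rewrite big_ord0; apply: Rle_refl.
have e : (K.+1 ^ 2 = (K.+1 ^ 2).-1.+1)%N by rewrite prednK // expn_gt0.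
rewrite e (RsumS _ (fun k => divsum k.+1)) -e S_INR; apply: Rplus_le_compat.
  by apply: Rle_trans IH _; apply: mono; rewrite -ltnS -e ltn_exp2r.
exact: divsum_sqr.
Qed.

End Divisors.

(** * Monsky's Lambert series *)

Definition geo (x : R) n : R := \big[Rplus/0]_(i < n) x ^ i.

Lemma geoE x n : (1 - x) * geo x n = 1 - x ^ n.
Proof.
elim: n => [|n IHn]; first by rewrite /geo big_ord0 /=; ring.
by rewrite /geo (RsumS n (fun i => x ^ i)) Rmult_plus_distr_l IHn /=; ring.
Qed.

(** The inequality of arithmetic and geometric means for 1, x, ..., x^n with x = y^2. The induction
    in steps of two splits off the outer pair and uses 1 + t^2 >= 2 t. *)
Lemma geo_amgm y n : 0 < y < 1 -> INR n.+1 * y ^ n <= geo (y ^ 2) n.+1.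
Proof.
move=> y1; have y2 : 0 < y ^ 2 < 1 by rewrite /=; nra.
have rec m : geo (y ^ 2) m.+2 = 1 + y ^ 2 * geo (y ^ 2) m + (y ^ m.+1) ^ 2.
  apply: (Rmult_eq_reg_l (1 - y ^ 2)); last lra.
  rewrite geoE !Rmult_plus_distr_l (_ : _ * (_ * geo _ m) = y ^ 2 * ((1 - y ^ 2) * geo (y ^ 2) m)); last ring.
  have sq k : (y ^ 2) ^ k = (y ^ k) ^ 2 by rewrite -!pow_mult Nat.mul_comm.
  by rewrite geoE !sq -[y ^ m.+2]/(y * (y * y ^ m)) -[y ^ m.+1]/(y * y ^ m); ring.
have : INR n * y ^ n.-1 <= geo (y ^ 2) n /\ INR n.+1 * y ^ n <= geo (y ^ 2) n.+1.
  elim: n => [|n [IH1 IH2]].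
    by rewrite /geo (RsumS 0 (fun i => (y ^ 2) ^ i)) !big_ord0 /=; lra.
  split=> //; rewrite rec.
  have e : y ^ n.+1 = y ^ 2 * y ^ n.-1 \/ n = 0%N.
    by case: (n) => [|m]; [right | left; rewrite /=; ring].
  have h : INR n * y ^ n.+1 <= y ^ 2 * geo (y ^ 2) n.
    case: e => [->|->]; last by rewrite /geo big_ord0 /=; lra.
    by rewrite (_ : INR n * _ = y ^ 2 * (INR n * y ^ n.-1)); [apply: Rmult_le_compat_l; lra | ring].
  rewrite !S_INR.
  by have := Rle_0_sqr (1 - y ^ n.+1); rewrite /Rsqr; move: (y ^ n.+1) h => t h; nra.
by case.
Qed.

Section Monsky.
Variable y : R.
Hypothesis y1 : 0 < y < 1.
Let x := y ^ 2.

Lemma x_bounds : 0 < x < 1.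
Proof. by rewrite /x /=; nra. Qed.

Lemma geo_pos n : 0 < geo x n.+1.
Proof.
have := geo_amgm n y1; have : 0 < INR n.+1 * y ^ n by apply: Rmult_lt_0_compat; [exact: INR_gt0 | apply: pow_lt; lra].
by rewrite -/x; lra.
Qed.

(** If the sum of f(n) / n is 0, then the sum of f(n) [lambert n] is minus the Lambert series of f,
    that is, minus the sum of [divsum f k] x^k. As [lambert] is nonnegative and decreases from the
    value 1, partial summation bounds this by Q, independently of x. *)
Definition lambert n : R := / INR n / (1 - x) - x ^ n / (1 - x ^ n).

Lemma lambertE n : lambert n.+1 = (/ INR n.+1 - x ^ n.+1 / geo x n.+1) / (1 - x).
Proof.
have xb := x_bounds; have g := geo_pos n; have i := INR_gt0 (isT : (0 < n.+1)%N).
by rewrite /lambert -(geoE x n.+1); field; lra.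
Qed.

Lemma lambert_ge0 n : 0 <= lambert n.+1.
Proof.
have xb := x_bounds; have g := geo_pos n; have i := INR_gt0 (isT : (0 < n.+1)%N).
rewrite lambertE; apply: Rdiv_le_0_compat; last lra.
have h := geo_amgm n y1; rewrite -/x in h.
have p : x ^ n.+1 <= y ^ n.
  rewrite /x -pow_mult (_ : (2 * n.+1)%coq_nat = (n + n.+2)%coq_nat) ?pow_add; last by lia.
  have := pow_lt y n (proj1 y1); have : y ^ n.+2 <= 1 by rewrite -(pow1 n.+2); apply: pow_incr; lra.
  by nra.
suff : x ^ n.+1 / geo x n.+1 <= / INR n.+1 by lra.
apply: (proj2 (Rle_div_l _ _ _ g)); rewrite Rmult_comm.
apply: (proj1 (Rle_div_r _ _ _ i)); rewrite Rmult_comm.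
by apply: Rle_trans h; apply: Rmult_le_compat_l; lra.
Qed.

(** Subtracting neighbours turns the claim, at index n, into x^n / (g g') <= 1 / (n (n + 1)) for the
    geometric sums g and g' of lengths n and n + 1. This is a product of two instances of
    [geo_amgm]. *)
Lemma lambert_decr n : lambert n.+2 <= lambert n.+1.
Proof.
have xb := x_bounds; have g := geo_pos n; have g' := geo_pos n.+1.
have i := INR_gt0 (isT : (0 < n.+1)%N); have i' := INR_gt0 (isT : (0 < n.+2)%N).
rewrite !lambertE; apply: Rmult_le_compat_r; first by apply/Rlt_le/Rinv_0_lt_compat; lra.
have e : x ^ n.+1 / geo x n.+1 - x ^ n.+2 / geo x n.+2 = x ^ n.+1 / (geo x n.+1 * geo x n.+2).
  have gg : geo x n.+2 = 1 + x * geo x n.+1.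
    apply: (Rmult_eq_reg_l (1 - x)); last lra.
    rewrite geoE Rmult_plus_distr_l (_ : _ * (x * _) = x * ((1 - x) * geo x n.+1)); last ring.
    by rewrite geoE /=; ring.
  rewrite gg in g' *; rewrite -[x ^ n.+2]/(x * x ^ n.+1); field; lra.
have e2 : / INR n.+1 - / INR n.+2 = / (INR n.+1 * INR n.+2) by rewrite (S_INR n.+1) in i' *; field; lra.
suff : x ^ n.+1 / (geo x n.+1 * geo x n.+2) <= / (INR n.+1 * INR n.+2) by lra.
have gp : 0 < geo x n.+1 * geo x n.+2 by nra.
have ip : 0 < INR n.+1 * INR n.+2 by nra.
apply: (proj2 (Rle_div_l _ _ _ gp)); rewrite Rmult_comm.
apply: (proj1 (Rle_div_r _ _ _ ip)).
have h := geo_amgm n y1; have h' := geo_amgm n.+1 y1; rewrite -/x in h h'.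
have yn := pow_lt y n (proj1 y1).
have p : x ^ n.+1 <= y ^ n * y ^ n.+1.
  rewrite /x -pow_mult (_ : (2 * n.+1)%coq_nat = (n + n.+1 + 1)%coq_nat) ?pow_add; last by lia.
  have yn1 := pow_lt y n.+1 (proj1 y1).
  have P0 : 0 < y ^ n * y ^ n.+1 by apply: Rmult_lt_0_compat.
  by rewrite pow_1; move: (y ^ n * y ^ n.+1) P0 => P P0; nra.
apply: Rle_trans (_ : (INR n.+1 * y ^ n) * (INR n.+2 * y ^ n.+1) <= _).
  rewrite (_ : _ * (INR n.+2 * _) = (y ^ n * y ^ n.+1) * (INR n.+1 * INR n.+2)); last ring.
  by apply: Rmult_le_compat_r; lra.
apply: Rmult_le_compat => //; apply: Rmult_le_pos; try lra.
by apply: pow_le; lra.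
Qed.

Lemma lambert1 : lambert 1 = 1.
Proof. by have xb := x_bounds; rewrite /lambert /=; field; lra. Qed.

Section F.
Variables (f : nat -> R) (Q : R).
Hypothesis fQ : forall n, Rabs (psum f n) <= Q.

Lemma lambert_sum_bound M : Rabs (\big[Rplus/0]_(j < M) (f j.+1 * lambert j.+1)) <= Q.
Proof.
rewrite (summation_by_parts f (fun j => lambert j.+1)).
have Q0 := Q_ge0 fQ.
have tel : \big[Rplus/0]_(j < M) (lambert j.+1 - lambert j.+2) = 1 - lambert M.+1.
  elim: M => [|M IH]; first by rewrite big_ord0 lambert1; ring.
  by rewrite (RsumS M (fun j => lambert j.+1 - lambert j.+2)) IH; ring.
apply: Rle_trans (Rabs_triang _ _) _.
have h1 : Rabs (\big[Rplus/0]_(j < M) (psum f j.+1 * (lambert j.+1 - lambert j.+2))) <= Q * (1 - lambert M.+1).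
  apply: Rle_trans; first exact: Rabs_bigsum.
  rewrite -tel big_distrr /=; apply: Rsum_le => j _; rewrite Rabs_mult.
  rewrite (Rabs_pos_eq (_ - _)); last by have := lambert_decr j; lra.
  by apply: Rmult_le_compat_r => //; have := lambert_decr j; lra.
have h2 : Rabs (psum f M * lambert M.+1) <= Q * lambert M.+1.
  rewrite Rabs_mult (Rabs_pos_eq (lambert _)); last exact: lambert_ge0.
  by apply: Rmult_le_compat_r => //; exact: lambert_ge0.
lra.
Qed.

Hypothesis f1 : f 1%N = 1.
Hypothesis fM : forall m n, f (m * n)%N = f m * f n.
Hypothesis f3 : forall n, f n = 1 \/ f n = 0 \/ f n = -1.
Hypothesis L1 : is_lim_seq (fun M => \big[Rplus/0]_(j < M) (f j.+1 * / INR j.+1)) 0.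

(** Truncating the divisors at M leaves a finite sum over d to exchange with the series in k; M
    tends to infinity afterwards. *)
Definition divsum_trunc M n : R := \big[Rplus/0]_(d < M) (if (d.+1 %| n)%N then f d.+1 else 0).

Lemma divsum_trunc_eq M n : (0 < n <= M)%N -> divsum_trunc M n = divsum f n.
Proof.
move=> /andP[n0 nM]; rewrite /divsum_trunc /divsum -big_mkcond /=.
have pe : perm_eq (divisors n) [seq d <- iota 1 M | (d %| n)%N].
  apply: uniq_perm; [exact: divisors_uniq | by rewrite filter_uniq // iota_uniq |].
  move=> d; rewrite mem_filter mem_iota -dvdn_divisors //.
  case: (boolP (d %| n)%N) => //= dn; have := dvdn_leq n0 dn; have := dvdn_gt0 n0 dn; lia.
rewrite (perm_big _ pe) big_filter -(big_mkord (fun d => (d.+1 %| n)%N) (fun d => f d.+1)).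
by rewrite (iotaDl 1 0 M) big_map /index_iota subn0.
Qed.

Lemma divsum_trunc_bound M n : (0 < n)%N -> Rabs (divsum_trunc M n) <= INR (minn M n).
Proof.
move=> n0; elim: M => [|M IH]; first by rewrite /divsum_trunc big_ord0 Rabs_R0 min0n; apply: Rle_refl.
rewrite /divsum_trunc (RsumS M (fun d => if (d.+1 %| n)%N then f d.+1 else 0)) -/(divsum_trunc M n).
case: ifP => [/(dvdn_leq n0) Mn|_].
  rewrite (minn_idPl Mn); rewrite (minn_idPl (ltnW Mn)) in IH.
  apply: Rle_trans (Rabs_triang _ _) _; rewrite S_INR.
  by have := f3_bound f3 M.+1; lra.
rewrite Rplus_0_r; apply: Rle_trans IH _; apply: le_INR; lia.
Qed.

Lemma x_geom n : is_series (fun k => if (n.+1 %| k.+1)%N then x ^ k.+1 else 0) (x ^ n.+1 / (1 - x ^ n.+1)).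
Proof.
have xb := x_bounds; have ax : Rabs x < 1 by rewrite Rabs_pos_eq; lra.
have xn : 0 <= x ^ n.+1 < 1 by apply: pow_lt_1_compat; [lra | lia].
have axn : Rabs (x ^ n.+1) < 1 by rewrite Rabs_pos_eq; lra.
have eG : ex_series (fun k => Rabs (x ^ k.+1)).
  apply: (ex_series_ext (fun k => x * x ^ k)); last by apply: ex_series_scal_l; exact: ex_series_geom.
  by move=> k; rewrite Rabs_pos_eq //; apply: pow_le; lra.
have [e1 e2] := @series_multiples n.+1 (fun k => x ^ k) isT eG.
have e3 : ex_series (fun k => if (n.+1 %| k.+1)%N then x ^ k.+1 else 0).
  by apply: ex_series_dom eG => k; case: ifP => _; [exact: Rle_refl | rewrite Rabs_R0; exact: Rabs_pos].
have := Series_correct _ e3; rewrite e2.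
rewrite (Series_ext _ (fun m => x ^ n.+1 * (x ^ n.+1) ^ m)).
  by rewrite Series_scal_l Series_geom.
by move=> m; rewrite -[RHS]/((x ^ n.+1) ^ m.+1) -pow_mult; congr pow; lia.
Qed.

Lemma lambert_series M :
  Series (fun k => divsum_trunc M k.+1 * x ^ k.+1) = \big[Rplus/0]_(d < M) (f d.+1 * (x ^ d.+1 / (1 - x ^ d.+1))).
Proof.
apply: is_series_unique.
apply: (is_series_ext (fun k => \big[Rplus/0]_(d < M) (f d.+1 * (if (d.+1 %| k.+1)%N then x ^ k.+1 else 0)))).
  move=> k; rewrite /divsum_trunc big_distrl; apply: eq_bigr => d _ /=.
  by case: ifP => _; rewrite ?Rmult_0_r ?Rmult_0_l.
apply: (@is_series_big M (fun d k => f d.+1 * (if (d.+1 %| k.+1)%N then x ^ k.+1 else 0)) (fun d => f d.+1 * (x ^ d.+1 / (1 - x ^ d.+1)))).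
by move=> d; apply: is_series_scal_l; exact: x_geom.
Qed.

Lemma divsum_dom_ex : ex_series (fun k => INR k.+1 * x ^ k.+1).
Proof.
have xb := x_bounds.
apply: (@ex_series_dom _ (fun k => x * (INR k.+1 ^ 2 * x ^ k))); last first.
  by apply: ex_series_scal_l; apply: ex_series_poly_geom; lra.
move=> k; have i1 : 1 <= INR k.+1 by rewrite S_INR; have := pos_INR k; lra.
have p : 0 <= x ^ k by apply: pow_le; lra.
rewrite -[x ^ k.+1]/(x * x ^ k) Rabs_pos_eq; last by apply: Rmult_le_pos; nra.
rewrite (_ : INR k.+1 * _ = x * (INR k.+1 * x ^ k)); last ring.
by apply: Rmult_le_compat_l; [lra | apply: Rmult_le_compat_r => //; nra].
Qed.

Lemma divsum_lim : is_lim_seq (fun M => Series (fun k => divsum_trunc M k.+1 * x ^ k.+1))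
  (Series (fun k => divsum f k.+1 * x ^ k.+1)).
Proof.
have xb := x_bounds.
apply: (@Tannery _ _ (fun k => INR k.+1 * x ^ k.+1)) divsum_dom_ex _.
  move=> M k; have p : 0 <= x ^ k.+1 by apply: pow_le; lra.
  rewrite Rabs_mult (Rabs_pos_eq (x ^ _)) //; apply: Rmult_le_compat_r => //.
  by apply: Rle_trans (divsum_trunc_bound M (isT : (0 < k.+1)%N)) _; apply: le_INR; lia.
move=> k; apply: (is_lim_seq_ext_loc (fun _ => divsum f k.+1 * x ^ k.+1)); last exact: is_lim_seq_const.
by exists k.+1 => M kM; rewrite divsum_trunc_eq //; lia.
Qed.

Lemma divsum_series_le : Series (fun k => divsum f k.+1 * x ^ k.+1) <= Q.
Proof.
have xb := x_bounds.
have l2 : is_lim_seq (fun M => / (1 - x) * Rabs (\big[Rplus/0]_(j < M) (f j.+1 * / INR j.+1)) + Q) (/ (1 - x) * 0 + Q).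
  apply: is_lim_seq_plus'; last exact: is_lim_seq_const.
  by apply: is_lim_seq_mult'; [exact: is_lim_seq_const | exact: (proj1 (is_lim_seq_abs_0 _) L1)].
have : Series (fun k => divsum f k.+1 * x ^ k.+1) <= / (1 - x) * 0 + Q.
  apply: (is_lim_seq_le _ _ (Rbar.Finite _) (Rbar.Finite _) _ divsum_lim l2) => M.
  rewrite lambert_series.
  have -> : \big[Rplus/0]_(d < M) (f d.+1 * (x ^ d.+1 / (1 - x ^ d.+1))) =
    / (1 - x) * \big[Rplus/0]_(j < M) (f j.+1 * / INR j.+1) - \big[Rplus/0]_(j < M) (f j.+1 * lambert j.+1).
    rewrite -(Rsum_mull M (/ (1 - x)) (fun j => f j.+1 * / INR j.+1)) /Rminus -Rsum_opp -big_split.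
    apply: eq_bigr => j _.
    rewrite /lambert /Rdiv /Rminus; move: (INR j.+1) => i /=; ring.
  have h := lambert_sum_bound M; have i : 0 < / (1 - x) by apply: Rinv_0_lt_compat; lra.
  move: (\big[Rplus/0]_(j < M) (f j.+1 * lambert j.+1)) h => a h.
  move: (\big[Rplus/0]_(j < M) (f j.+1 * / INR j.+1)) => b.
  have : / (1 - x) * b <= / (1 - x) * Rabs b by apply: Rmult_le_compat_l; [lra | exact: Rle_abs].
  by have := Rle_abs (- a); rewrite Rabs_Ropp; lra.
by rewrite Rmult_0_r Rplus_0_l.
Qed.

Lemma divsum_partial_le J : \big[Rplus/0]_(k < J) (divsum f k.+1 * x ^ k.+1) <= Q.
Proof.
have xb := x_bounds.
have p k : 0 <= divsum f k.+1 * x ^ k.+1.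
  by apply: Rmult_le_pos; [exact: (divsum_ge0 f1 fM f3) | apply: pow_le; lra].
apply: Rle_trans divsum_series_le; apply: partial_le_Series => //.
apply: ex_series_dom divsum_dom_ex => k.
rewrite Rabs_pos_eq //; apply: Rmult_le_compat_r; first by apply: pow_le; lra.
apply: Rle_trans (Rle_abs _) _; rewrite -(@divsum_trunc_eq k.+1) ?leqnn //.
by have := divsum_trunc_bound k.+1 (isT : (0 < k.+1)%N); rewrite minnn.
Qed.

End F.
End Monsky.

Section NonvanishingOne.
Variables (f : nat -> R) (Q : R).
Hypothesis fQ : forall n, Rabs (psum f n) <= Q.
Hypothesis f1 : f 1%N = 1.
Hypothesis fM : forall m n, f (m * n)%N = f m * f n.
Hypothesis f3 : forall n, f n = 1 \/ f n = 0 \/ f n = -1.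

(* Monsky's argument: if [L 1 = 0] then [sum_k (sum_{d | k} f d) x^k] stays bounded as [x -> 1]. *)
Lemma Lfun_one_neq0 : Lfun f 1%C <> 0%C.
Proof.
move=> L0.
have s0 : 0 < Re 1%C by rewrite /=; lra.
have [h _] := Dirichlet_series_Re fQ s0; rewrite L0 in h.
have L1 : is_lim_seq (fun M => \big[Rplus/0]_(j < M) (f j.+1 * / INR j.+1)) 0.
  apply/is_lim_seq_incr_1; apply: is_lim_seq_ext (h : is_lim_seq _ (Rbar.Finite _)) => n.
  rewrite sum_n_big; apply: eq_bigr => j _; congr Rmult.
  rewrite /nat_Cpow_opp Cmult_1_l -RtoC_opp Cexp_RtoC /= exp_Ropp exp_ln //.
  exact: (INR_gt0 (isT : (0 < j.+1)%N)).
have [K HK] := INR_unbounded (2 * Q).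
(* With x = e^(- 2 t), x^k >= 1/2 for all k <= J, so the sum bounded by Q is at least K / 2 > Q. The
   + 2 keeps the denominator positive. *)
pose J := (K ^ 2)%N; pose t := ln 2 / (2 * INR J + 2).
have l2 : 0 < ln 2 by rewrite -ln_1; apply: ln_increasing; lra.
have J0 := pos_INR J.
have t0 : 0 < t by apply: Rdiv_lt_0_compat; lra.
have y1 : 0 < exp (- t) < 1 by split; [exact: exp_pos | rewrite -exp_0; apply: exp_increasing; lra].
have H := @divsum_partial_le (exp (- t)) y1 f Q fQ f1 fM f3 L1 J.
have : / 2 * \big[Rplus/0]_(k < J) divsum f k.+1 <= Q.
  apply: Rle_trans H; rewrite big_distrr /=; apply: Rsum_le => k _.
  rewrite Rmult_comm; apply: Rmult_le_compat_l; first exact: (divsum_ge0 f1 fM f3).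
  have pw n : (exp (- t) ^ 2) ^ n = exp (- (2 * t * INR n)).
    elim: n => [|n IHn]; first by rewrite /= Rmult_0_r Ropp_0 exp_0.
    rewrite -[_ ^ n.+1]/(exp (- t) ^ 2 * (exp (- t) ^ 2) ^ n) IHn S_INR /= Rmult_1_r -!exp_plus.
    by congr exp; ring.
  have -> : / 2 = exp (- ln 2) by rewrite exp_Ropp exp_ln //; lra.
  change (exp (- ln 2) <= (exp (- t) ^ 2) ^ k.+1); rewrite pw.
  have kJ : INR k.+1 <= INR J by apply: le_INR; have := ltn_ord k; lia.
  have te : t * (2 * INR J + 2) = ln 2 by rewrite /t; field; lra.
  have : - ln 2 <= - (2 * t * INR k.+1) by nra.
  by case/Rle_lt_or_eq_dec => [/exp_increasing/Rlt_le|->] //; apply: Rle_refl.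
have := divsum_total f1 fM f3 K; rewrite -/J; lra.
Qed.

End NonvanishingOne.

(** * Prime sums under the Riemann hypothesis *)

Section Compact.
Variables (b : nat -> R) (C0 rho r : R).
Hypothesis rho0 : 0 < rho.
Hypothesis bb : forall k, Rabs (b k) <= C0 * / rho ^ k.
Hypothesis rr : 0 < r < rho.
Hypothesis nz : forall z, Cmod z <= r -> psC b z <> 0%C.

Lemma psC_min : exists d, 0 < d /\ forall z, Cmod z <= r -> d <= Cmod (psC b z).
Proof.
pose La := Rmax 0 (2 * lipC C0 rho r).
have La0 : 0 <= La by exact: Rmax_l.
(* For w in the disc, [d] is so small that the Lipschitz constant [La] keeps |psC b| above [d] on
   the square of half-side [d] about w. For w outside, that square misses the disc. *)
have D (w : C) : exists d : posreal, (Cmod w <= r -> (4 * La + 4) * d <= Cmod (psC b w)) /\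
    (r < Cmod w -> 2 * d < Cmod w - r).
  case: (Rle_dec (Cmod w) r) => wr.
    have p : 0 < Cmod (psC b w) / (4 * La + 4).
      by apply: Rdiv_lt_0_compat; [apply: (proj1 (Cmod_gt_0 _)); exact: nz | lra].
    exists (mkposreal _ p); split; last lra.
    by move=> _ /=; apply: Req_le; field; lra.
  have p : 0 < (Cmod w - r) / 4 by lra.
  by exists (mkposreal _ p); split=> /=; lra.
have [delta Hd] := choice D.
have [d Hc] := compactness_value_2d (- r) r (- r) r (fun u v => delta (u, v)).
exists d; split; first exact: cond_pos.
move=> [x y] zr.
have xr : - r <= x <= r by have /= := Rle_trans _ _ _ (re_le_Cmod (x, y)) zr; split_Rabs; lra.
have yr : - r <= y <= r by have /= := Rle_trans _ _ _ (Rabs_Im_le (x, y)) zr; split_Rabs; lra.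
apply: Rnot_lt_le => hlt; apply: (Hc x y xr yr) => -[u [v [ur [vr [hu [hv dd]]]]]].
set w : C := (u, v) in hu hv dd; have [H1 H2] := Hd w.
set e := delta w in hu hv dd H1 H2; have e0 := cond_pos e.
have dist : Cmod (Cminus (x, y) w) <= Rabs (x - u) + Rabs (y - v) by exact: Cmod_le_sum.
case: (Rle_dec (Cmod w) r) => wr; last first.
  have h := H2 (Rnot_le_lt _ _ wr).
  have := Cmod_triangle (x, y) (- Cminus (x, y) w)%C; rewrite Cmod_opp.
  rewrite (_ : (_ + _)%C = w); last by ring.
  lra.
have h := H1 wr; have L := psC_lipschitz rho0 bb rr zr wr.
have L2 : Cmod (psC b w - psC b (x, y))%C <= La * Cmod (w - (x, y))%C.
  by apply: Rle_trans L _; apply: Rmult_le_compat_r; [exact: Cmod_ge_0 | exact: Rmax_r].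
have e1 : Cmod (w - (x, y))%C = Cmod (Cminus (x, y) w) by rewrite -Cmod_opp; congr Cmod; ring.
rewrite e1 in L2.
have T := Cmod_triangle (psC b (x, y)) (psC b w - psC b (x, y))%C.
rewrite (_ : (_ + _)%C = psC b w) in T; last by ring.
have : La * Cmod (Cminus (x, y) w) <= La * (2 * e) by apply: Rmult_le_compat_l; lra.
by nra.
Qed.

(** The tails are uniformly small on the disc, hence eventually below the minimum of |psC b|. This
    replaces the power series by a polynomial, to which the factorization argument applies. *)
Lemma ppart_nonvanishing K : exists n, (K < n)%N /\ forall z, Cmod z <= r ->
  ~ (\big[Rplus/0]_(k < n.+1) (b k * Re (z ^ k)%C) = 0 /\ \big[Rplus/0]_(k < n.+1) (b k * Im (z ^ k)%C) = 0).
Proof.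
have [d [d0 Hd]] := psC_min.
have rr' : 0 <= r < rho by lra.
have /is_lim_seq_epsP/(_ (d / 2)) [|n0 Hn] := tail_lim0 (geom_ex C0 rho0 rr'); first lra.
exists (K + n0).+1; split; first by lia.
move=> z zr [e1 e2].
have h := psC_tail rho0 bb (K + n0).+2 rr' zr.
rewrite (_ : ppart b (K + n0).+2 z = 0%C) in h; last by rewrite /ppart e1 e2.
rewrite (_ : (psC b z - 0)%C = psC b z) in h; last by ring.
have := Hd z zr; have := Hn (K + n0).+2; rewrite Rminus_0_r => /(_ _)H.
have {}H := H ltac:(lia).
have := Rle_abs (Series (fun k => C0 * (r / rho) ^ ((K + n0).+2 + k))); lra.
Qed.

Lemma abs_coef_sum n : 0 <= C0 -> \big[Rplus/0]_(k < n) (Rabs (b k) * r ^ k) <= C0 / (1 - r / rho).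
Proof.
move=> C00; have rr' : 0 <= r < rho by lra.
have q := ratio_lt1 rho0 rr'.
have -> : C0 / (1 - r / rho) = Series (fun k => C0 * (r / rho) ^ k).
  by rewrite Series_scal_l Series_geom // Rabs_pos_eq; lra.
apply: Rle_trans (partial_le_Series n _ (geom_ex C0 rho0 rr')); last first.
  by move=> i; apply: Rmult_le_pos => //; apply: pow_le; lra.
apply: Rsum_le => k _; rewrite /Rdiv Rpow_mult_distr pow_inv (Rmult_comm (r ^ k)) -Rmult_assoc.
by apply: Rmult_le_compat_r => //; apply: pow_le; lra.
Qed.

End Compact.

(** * The recursion of the logarithmic derivative *)

Module LDpoly.
Import ssralg poly polydiv.
Import GRing.Theory.
Local Open Scope ring_scope.

Section F.
Variable F : fieldType.

Definition LDF (b h : nat -> F) m := forall k, (k < m)%N ->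
  k.+1%:R * b k.+1 = \sum_(i < k.+1) h i * b (k - i)%N.

Lemma LDF_poly (b h : nat -> F) m :
  LDF b h m <-> 'X^m %| (\poly_(k < m.+1) b k)^`() - (\poly_(k < m.+1) h k) * (\poly_(k < m.+1) b k).
Proof.
have coefE k : (k < m)%N -> ((\poly_(k < m.+1) b k)^`() - (\poly_(k < m.+1) h k) * (\poly_(k < m.+1) b k))`_k =
    k.+1%:R * b k.+1 - \sum_(i < k.+1) h i * b (k - i)%N.
  move=> km; rewrite coefB coef_deriv coef_poly ltnS km mulr_natl; congr (_ - _).
  rewrite coefM; apply: eq_bigr => i _; have im := ltn_ord i.
  by rewrite !coef_poly !ifT //; lia.
split=> [H|/dvdpP[q E] k km].
  set p := _ - _; rewrite -(poly_take_drop m p) dvdp_addl ?dvdp_mull //.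
  suff -> : take_poly m p = 0 by rewrite dvdp0.
  apply/polyP => k; rewrite coef_take_poly coef0; case: ifP => // km.
  by rewrite /p coefE // H // subrr.
by apply/eqP; rewrite -subr_eq0 -coefE // E coefMXn km.
Qed.

Lemma LDF_ext (b h b' h' : nat -> F) m :
  (forall k, (k <= m)%N -> b k = b' k) -> (forall k, (k < m)%N -> h k = h' k) -> LDF b h m -> LDF b' h' m.
Proof.
move=> eb eh H k km; rewrite -eb // H //; apply: eq_bigr => i _; have im := ltn_ord i.
by rewrite eh ?eb //; lia.
Qed.

Lemma LDF_conv (a b h g : nat -> F) m : LDF a h m -> LDF b g m ->
  LDF (fun k => \sum_(i < k.+1) a i * b (k - i)%N) (fun k => h k + g k) m.
Proof.
move=> /LDF_poly Ha /LDF_poly Hb; have := LogDerPoly.LD_mul Ha Hb.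
set A := \poly_(k < m.+1) a k; set B := \poly_(k < m.+1) b k.
move=> H k km.
have cAB j : (j <= m)%N -> (A * B)`_j = \sum_(i < j.+1) a i * b (j - i)%N.
  move=> jm; rewrite coefM; apply: eq_bigr => i _; have im := ltn_ord i.
  by rewrite !coef_poly !ifT //; lia.
case/dvdpP: H => q /(congr1 (fun p : {poly F} => p`_k)).
rewrite coefMXn km coefB coef_deriv cAB // => /eqP; rewrite subr_eq0 => /eqP.
rewrite mulr_natl => ->; rewrite coefM; apply: eq_bigr => i _; have im := ltn_ord i.
rewrite cAB; last by lia.
by rewrite coefD !coef_poly !ifT //; lia.
Qed.

End F.

Lemma natE (k : nat) : (k%:R : R) = INR k.
Proof. by rewrite INRE. Qed.

End LDpoly.

(* [h] is the coefficient sequence of the logarithmic derivative of [sum_k b_k z^k], up to order [m]. *)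
Definition LD (b h : nat -> R) m := forall k, (k < m)%N ->
  INR k.+1 * b k.+1 = \big[Rplus/0]_(i < k.+1) (h i * b (k - i)%N).

Lemma LD_LDF b h m : LD b h m <-> LDpoly.LDF b h m.
Proof.
by split=> H k km; have := H k km; rewrite LDpoly.natE.
Qed.

Lemma LD_conv (a b h g : nat -> R) m : LD a h m -> LD b g m ->
  LD (fun k => \big[Rplus/0]_(i < k.+1) (a i * b (k - i)%N)) (fun k => h k + g k) m.
Proof. by move=> /LD_LDF Ha /LD_LDF Hb; apply/LD_LDF; exact: LDpoly.LDF_conv. Qed.

Lemma LD_ext (b h b' h' : nat -> R) m :
  (forall k, (k <= m)%N -> b k = b' k) -> (forall k, (k < m)%N -> h k = h' k) -> LD b h m -> LD b' h' m.
Proof. by move=> eb eh /LD_LDF H; apply/LD_LDF; apply: LDpoly.LDF_ext H. Qed.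

Lemma LD_exists (b : nat -> R) : b 0%N <> 0 -> exists h, forall m, LD b h m.
Proof.
move=> b0.
pose step k (l : seq R) := (INR k.+1 * b k.+1 - \big[Rplus/0]_(i < k) (nth 0 l i * b (k - i)%N)) / b 0%N.
(* Course-of-values recursion: [hl k] lists the first k values. *)
pose hl := fix hl k := if k is k'.+1 then rcons (hl k') (step k' (hl k')) else [::].
have sz k : size (hl k) = k by elim: k => //= k IH; rewrite size_rcons IH.
have nthE k m : (k < m)%N -> nth 0 (hl m) k = step k (hl k).
  elim: m => // m IH; rewrite ltnS leq_eqVlt /= nth_rcons sz => /orP[/eqP ->|km].
    by rewrite ltnn eqxx.
  by rewrite km IH.
exists (fun k => step k (hl k)) => m k _.
rewrite (RsumS k (fun i => step i (hl i) * b (k - i)%N)) subnn.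
have -> : \big[Rplus/0]_(i < k) (step i (hl i) * b (k - i)%N) = \big[Rplus/0]_(i < k) (nth 0 (hl k) i * b (k - i)%N).
  by apply: eq_bigr => i _; rewrite nthE.
by rewrite /step; field.
Qed.

(* Solving the recursion for [h] is continuous in [b]. *)
Lemma LD_lim0 (b h : nat -> nat -> R) m : (forall P, LD (b P) (h P) m) ->
  is_lim_seq (fun P => b P 0%N) 1 -> (forall k, is_lim_seq (fun P => b P k.+1) 0) ->
  forall k, (k < m)%N -> is_lim_seq (fun P => h P k) 0.
Proof.
move=> H l0 lS k; elim: k {-2}k (leqnn k) => [|n IH] k kn km; last first.
  case: (ltngtP k n.+1) kn => // [kn _|ek _]; first by apply: IH.
  rewrite {}ek in km *.
  have e1 : is_lim_seq (fun P => (INR n.+2 * b P n.+2 - \big[Rplus/0]_(i < n.+1) (h P i * b P (n.+1 - i)%N)) / b P 0%N) ((INR n.+2 * 0 - \big[Rplus/0]_(i < n.+1) (0 * 0)) / 1).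
    apply: is_lim_seq_div'; [|exact: l0|lra].
    apply: is_lim_seq_minus'.
      by apply: is_lim_seq_mult'; [exact: is_lim_seq_const | exact: lS].
    have : is_lim_seq (fun P => \big[Rplus/0]_(i < n.+1) (if (i < n.+1)%N then h P i * b P (n.+1 - i)%N else 0)) (\big[Rplus/0]_(i < n.+1) (0 * 0)).
      apply: (@is_lim_seq_big n.+1 (fun P i => if (i < n.+1)%N then h P i * b P (n.+1 - i)%N else 0) (fun _ => 0 * 0)) => i.
      case im : (i < n.+1)%N; last by rewrite Rmult_0_l; exact: is_lim_seq_const.
      apply: is_lim_seq_mult'; first by apply: IH; lia.
      by rewrite subSn; [exact: lS | lia].
    by apply: is_lim_seq_ext => P; apply: eq_bigr => i _; rewrite ltn_ord.
  have z : (INR n.+2 * 0 - \big[Rplus/0]_(i < n.+1) (0 * 0)) / 1 = 0.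
    by rewrite big1 => [|? _]; [field | ring].
  rewrite z in e1.
  have [N0 HN] := (is_lim_seq_epsP _ _).1 l0 (1 / 2) ltac:(lra).
  apply: is_lim_seq_ext_loc e1; exists N0 => P PN.
  have h1 := HN P ltac:(lia).
  rewrite (H P n.+1 km) (RsumS n.+1 (fun i => h P i * b P (n.+1 - i)%N)) subnn.
  by field; split_Rabs; lra.
move: kn km; rewrite leqn0 => /eqP -> km.
have e1 : is_lim_seq (fun P => b P 1%N / b P 0%N) 0.
  have := is_lim_seq_div' _ _ _ _ (lS 0%N) l0 R1_neq_R0.
  by rewrite /Rdiv Rmult_0_l.
have [N0 HN] := (is_lim_seq_epsP _ _).1 l0 (1 / 2) ltac:(lra).
apply: is_lim_seq_ext_loc e1; exists N0 => P PN.
have h1 := HN P ltac:(lia).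
have := H P 0%N km; rewrite (RsumS 0 (fun i => h P i * b P (0 - i)%N)) big_ord0 subnn (_ : INR 1 = 1) // => e2.
have -> : b P 1%N = h P 0%N * b P 0%N by lra.
by field; split_Rabs; lra.
Qed.

(** Since (m n)^(z - s) is a product, its Taylor coefficients convolve; concretely, this is the
    binomial theorem for (ln m + ln n)^k. *)
Lemma wt_mult s k m n : (0 < m)%N -> (0 < n)%N ->
  wt s k (m * n) = \big[Rplus/0]_(i < k.+1) (wt s i m * wt s (k - i) n).
Proof.
move=> m0 n0; rewrite /wt mult_INR ln_mult; [|exact: INR_gt0|exact: INR_gt0].
set u := ln (INR m); set v := ln (INR n).
rewrite Rmult_plus_distr_l exp_plus Binomial.binomial -sum_n_Reals sum_n_big.
rewrite /Rdiv big_distrl big_distrr /=; apply: eq_bigr => i _.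
rewrite /Binomial.C !minusE.
have f1 := INR_fact_pos k; have f2 := INR_fact_pos i; have f3 := INR_fact_pos (k - i).
by field; lra.
Qed.

(** * Prime sums as logarithmic coefficients *)

Section EulerFactor.
Variables (f : nat -> R) (s : R).
Hypothesis s3 : 3 <= s.
Hypothesis f1 : f 1%N = 1.
Hypothesis fM : forall m n, f (m * n)%N = f m * f n.
Hypothesis fb : forall n, Rabs (f n) <= 1.

(** The Taylor coefficients in z of 1 - f(p) p^(z - s). *)
Definition efac p k : R := (if k is 0%N then 1 else 0) - f p * wt s k p.
(** The Taylor coefficients in z of the sum of f(p)^j ln(p) p^(j (z - s)) over j >= 1, the
    contribution of p to the von Mangoldt sum. *)
Definition elog p k : R := ln (INR p) * Series (fun j => f p ^ j.+1 * wt s k (p ^ j.+1)).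

Lemma wt_expn_le p k j : (1 < p)%N -> wt s k (p ^ j.+1) <= (/ 4) ^ j.+1.
Proof.
move=> p1; have e : (p ^ j.+1 = (p ^ j.+1).-1.+1)%N by rewrite prednK // expn_gt0; lia.
rewrite e; apply: Rle_trans (wt_le k (p ^ j.+1).-1 s3) _; rewrite -e.
have h2 : 2 ^ j.+1 <= INR (p ^ j.+1).
  have : (2 ^ j.+1 <= p ^ j.+1)%N by rewrite leq_exp2r.
  move=> /leP/le_INR; apply: Rle_trans; apply: Req_le.
  elim: (j.+1) => // n IH; rewrite expnS mult_INR -IH /=; lra.
have p2 : 0 < 2 ^ j.+1 by apply: pow_lt; lra.
rewrite pow_inv; apply: Rinv_le_contravar; first by apply: pow_lt; lra.
rewrite (_ : 4 = 2 * 2); last ring.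
by rewrite Rpow_mult_distr; change (2 ^ j.+1 * 2 ^ j.+1 <= INR (p ^ j.+1) * (INR (p ^ j.+1) * 1)); nra.
Qed.

Lemma wt_expn_ge0 p k j : (1 < p)%N -> 0 <= wt s k (p ^ j.+1).
Proof.
by move=> p1; have -> : (p ^ j.+1 = (p ^ j.+1).-1.+1)%N; [rewrite prednK // expn_gt0; lia | exact: wt_ge0].
Qed.

Lemma elog_dom p k j : (1 < p)%N -> Rabs (f p ^ j.+1 * wt s k (p ^ j.+1)) <= (/ 4) ^ j.+1.
Proof.
move=> p1; rewrite Rabs_mult -(Rmult_1_l ((/ 4) ^ _)).
apply: Rmult_le_compat; [exact: Rabs_pos | exact: Rabs_pos | |].
  by rewrite -RPow_abs -(pow1 j.+1); apply: pow_incr; split; [exact: Rabs_pos | exact: fb].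
by rewrite Rabs_pos_eq; [exact: wt_expn_le | exact: wt_expn_ge0].
Qed.

Lemma geom4_ex : ex_series (fun j => (/ 4) ^ j.+1).
Proof.
apply: (ex_series_ext (fun j => / 4 * (/ 4) ^ j)) => //.
by apply: ex_series_scal_l; apply: ex_series_geom; rewrite Rabs_pos_eq; lra.
Qed.

Lemma elog_ex p k : (1 < p)%N -> ex_series (fun j => f p ^ j.+1 * wt s k (p ^ j.+1)).
Proof. by move=> p1; apply: ex_series_dom geom4_ex => j; exact: elog_dom. Qed.

Lemma wt_shift k n : INR k.+1 * wt s k.+1 n = ln (INR n) * wt s k n.
Proof.
rewrite /wt; change (fact k.+1) with (k.+1 * fact k)%coq_nat; rewrite mult_INR.
have f0 := INR_fact_pos k; have k0 := INR_gt0 (isT : (0 < k.+1)%N).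
by rewrite -[ln _ ^ k.+1]/(ln (INR n) * ln (INR n) ^ k); field; lra.
Qed.

(** Multiplying the geometric series by 1 - f(p) p^(z - s) shifts it in j, and everything cancels
    except the first power of p, which [wt_shift] identifies with the derivative of the factor. *)
Lemma efac_LD p m : (1 < p)%N -> LD (efac p) (fun k => - elog p k) m.
Proof.
move=> p1 k _; have p0 : (0 < p)%N by lia.
rewrite {1}/efac Rminus_0_l.
have -> : INR k.+1 * - (f p * wt s k.+1 p) = - (f p * (INR k.+1 * wt s k.+1 p)) by ring.
rewrite wt_shift.
have e1 : \big[Rplus/0]_(i < k.+1) (- elog p i * efac p (k - i)) =
   - elog p k + f p * \big[Rplus/0]_(i < k.+1) (elog p i * wt s (k - i) p).
  rewrite (RsumS k (fun i => - elog p i * efac p (k - i))) (RsumS k (fun i => elog p i * wt s (k - i) p)) subnn {2}/efac.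
  have -> : \big[Rplus/0]_(i < k) (- elog p i * efac p (k - i)) = f p * \big[Rplus/0]_(i < k) (elog p i * wt s (k - i) p).
    rewrite -(Rsum_mull k (f p) (fun i => elog p i * wt s (k - i) p)); apply: eq_bigr => i _.
    rewrite /efac; have := ltn_ord i; case E : (k - i)%N => [|d]; first by lia.
    by move=> _; ring.
  by ring.
rewrite {}e1.
have e2 : f p * \big[Rplus/0]_(i < k.+1) (elog p i * wt s (k - i) p) =
  ln (INR p) * Series (fun j => f p ^ j.+2 * wt s k (p ^ j.+2)).
  rewrite -(Rsum_mull k.+1 (f p) (fun i => elog p i * wt s (k - i) p)).
  rewrite -Series_scal_l; symmetry; apply: is_series_unique.
  apply: (is_series_ext (fun j => \big[Rplus/0]_(i < k.+1) (f p * (ln (INR p) * (f p ^ j.+1 * wt s i (p ^ j.+1)) * wt s (k - i) p)))).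
    move=> j; rewrite [(p ^ j.+2)%N]expnSr wt_mult ?expn_gt0 ?p0 //.
    rewrite -[f p ^ j.+2]/(f p * f p ^ j.+1) !big_distrr; apply: eq_bigr => i _ /=; ring.
  apply: (@is_series_big k.+1 (fun i j => f p * (ln (INR p) * (f p ^ j.+1 * wt s i (p ^ j.+1)) * wt s (k - i) p)) (fun i => f p * (elog p i * wt s (k - i) p))) => i.
  apply: is_series_scal_l; apply: is_series_scal_r; apply: is_series_scal_l.
  exact: Series_correct (elog_ex i p1).
rewrite {}e2 /elog Series_incr_1; last exact: elog_ex.
by rewrite expn1 pow_1; ring.
Qed.

Definition bsieved P k : R := Series (fun j => sieved f P j.+1 * wt s k j.+1).

Lemma wt_dom k j : Rabs (wt s k j.+1) <= / INR j.+1 ^ 2.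
Proof. by rewrite Rabs_pos_eq; [exact: wt_le | exact: wt_ge0]. Qed.

Lemma bsieved_step P k : prime P.+1 ->
  bsieved P.+1 k = \big[Rplus/0]_(i < k.+1) (efac P.+1 i * bsieved P (k - i)).
Proof.
move=> pp; have [_] := @sieve_step f fM fb (wt s k) _ (wt_dom k) ex_series_inv_sq P pp.
rewrite -/(bsieved P.+1 k) -/(bsieved P k) => ->.
have -> : Series (fun j => sieved f P j.+1 * wt s k (P.+1 * j.+1)) =
    \big[Rplus/0]_(i < k.+1) (wt s i P.+1 * bsieved P (k - i)).
  apply: is_series_unique.
  apply: (is_series_ext (fun j => \big[Rplus/0]_(i < k.+1) (wt s i P.+1 * (sieved f P j.+1 * wt s (k - i) j.+1)))).
    by move=> j; rewrite wt_mult // big_distrr; apply: eq_bigr => i _ /=; ring.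
  apply: (@is_series_big k.+1 (fun i j => wt s i P.+1 * (sieved f P j.+1 * wt s (k - i) j.+1)) (fun i => wt s i P.+1 * bsieved P (k - i))) => i.
  apply: is_series_scal_l; apply: Series_correct.
  by apply/ex_series_abs/(@sieved_ex f fb (wt s (k - i)) _ (wt_dom _) ex_series_inv_sq).
have -> : \big[Rplus/0]_(i < k.+1) (efac P.+1 i * bsieved P (k - i)) =
   \big[Rplus/0]_(i < k.+1) ((if i == 0%N :> nat then bsieved P (k - i) else 0) + - (f P.+1 * (wt s i P.+1 * bsieved P (k - i)))).
  by apply: eq_bigr => i _; rewrite /efac; case: i => [[|i] ?] /=; ring.
rewrite (Rsum_add k.+1 (fun i => if i == 0%N then bsieved P (k - i) else 0) (fun i => - (f P.+1 * (wt s i P.+1 * bsieved P (k - i))))).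
rewrite (Rsum_opp _ _ (fun i : 'I_k.+1 => f P.+1 * (wt s i P.+1 * bsieved P (k - i)))).
rewrite (Rsum_mull k.+1 (f P.+1) (fun i => wt s i P.+1 * bsieved P (k - i))).
have -> : \big[Rplus/0]_(i < k.+1) (if i == 0%N :> nat then bsieved P (k - i) else 0) = bsieved P k.
  by rewrite big_ord_recl /= big1 => [|i _] //; rewrite subn0 Rplus_0_r.
by [].
Qed.

Lemma bsieved_skip P k : ~~ prime P.+1 -> bsieved P.+1 k = bsieved P k.
Proof. exact: sieve_skip. Qed.

Definition primesum P k : R := \big[Rplus/0]_(p < P.+1) (if prime p then elog p k else 0).

Lemma bsieved_LD h m P : LD (bsieved 0) h m -> LD (bsieved P) (fun k => h k - primesum P k) m.
Proof.
move=> H0; elim: P => [|P IH].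
  by apply: LD_ext H0 => // k _; rewrite /primesum (RsumS 0 (fun p => if prime p then elog p k else 0)) big_ord0 /=; ring.
case: (boolP (prime P.+1)) => pp.
  have p1 := prime_gt1 pp.
  have X := LD_conv (@efac_LD P.+1 m p1) IH.
  apply: LD_ext X => k _; first by rewrite bsieved_step.
  by rewrite /primesum (RsumS P.+1 (fun p => if prime p then elog p k else 0)) pp; ring.
apply: LD_ext IH => k _; first by rewrite bsieved_skip.
by rewrite /primesum (RsumS P.+1 (fun p => if prime p then elog p k else 0)) (negbTE pp); ring.
Qed.

(** Each prime subtracts its [elog] from h, while the sieved series tends to the constant 1, whose
    logarithmic derivative is 0. By [LD_lim0] the difference tends to 0, so no logarithm of L is
    formed. *)
Lemma primesum_lim h m k : LD (bsieved 0) h m -> (k < m)%N ->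
  is_lim_seq (fun P => primesum P k) (h k).
Proof.
move=> H0 km.
have lim j : is_lim_seq (fun P => bsieved P j) (wt s j 1).
  exact: (@sieve_lim f f1 fb (wt s j) _ (wt_dom j) ex_series_inv_sq).
have w0 : wt s 0 1 = 1 by rewrite /wt ln_1 Rmult_0_r exp_0 /=; field.
have wS j : wt s j.+1 1 = 0 by rewrite /wt ln_1 /= Rmult_0_l /Rdiv Rmult_0_l Rmult_0_r.
have L : is_lim_seq (fun P => h k - primesum P k) 0.
  apply: (@LD_lim0 bsieved (fun P k => h k - primesum P k) m) => //.
  - by move=> P; exact: bsieved_LD.
  - by rewrite -w0.
  by move=> j; rewrite -(wS j).
have := is_lim_seq_minus' _ _ _ _ (is_lim_seq_const (h k)) L; rewrite Rminus_0_r.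
by apply: is_lim_seq_ext => P; ring.
Qed.

End EulerFactor.

(** * Nonvanishing on Re s > 1/2 and its consequence for prime sums *)

Section Analytic.
Hypothesis grh : GRH.
Variables (f : nat -> R) (q : nat) (Q : R).
Hypothesis q0 : (0 < q)%N.
Hypothesis f1 : f 1%N = 1.
Hypothesis fM : forall m n, f (m * n)%N = f m * f n.
Hypothesis f3 : forall n, f n = 1 \/ f n = 0 \/ f n = -1.
Hypothesis fq : forall n, f (n + q)%N = f n.
Hypothesis fcop : forall n, f n <> 0 <-> coprime n q.
Hypothesis fQ : forall n, Rabs (psum f n) <= Q.

(** [GRH] covers the open strip. The line Re s = 1 is covered by the two classical arguments, and Re
    s > 1 by the sieve. *)
Lemma Lfun_nonvanishing (s : C) : 1 / 2 < Re s -> Lfun f s <> 0%C.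
Proof.
move=> s12 L0; have s0 : 0 < Re s by lra.
case: (Rtotal_order (Re s) 1) => [lt1|[eq1|gt1]].
- have H : forall s : C, 0 < Re s < 1 -> Lfun f s = RtoC 0 -> Re s = 1 / 2.
    apply: (grh (chi := fun n => RtoC (f n)) q0).
    + split=> [n|m n|n]; first by rewrite fq.
        by rewrite fM RtoC_mult.
      rewrite -fcop; split=> [h e|h /RtoC_inj//]; first by apply: h; rewrite e.
    + split=> s' hs; first by apply: (Lfun_Dirichlet fQ); lra.
      by move=> _; apply: (Lfun_ex_derive fQ).
  by have := H s (conj s0 lt1) L0; lra.
- case: s {s12 s0} eq1 L0 => x y /= -> L0.
  case: (Req_dec y 0) => [y0|y0].
    by apply: (Lfun_one_neq0 fQ f1 fM f3); rewrite -L0 y0.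
  exact: (Lfun_line_neq0 f1 fM f3 fQ y0 L0).
apply: (@Dsieved0_neq0 f f1 fM (f3_bound f3) s gt1).
by rewrite -(@Lfun_Dsieved f s gt1 Q fQ).
Qed.

Variables (N : R) (K : nat).
Hypothesis N4 : 4 <= N.
Hypothesis Q1 : 1 <= Q.

Let b := coefL f N.
(** On the disc of radius r about N one has Re s >= 1/2 + 1/N. For K = N^2, the margin 1/N costs
    only a constant factor in (N / r)^K. *)
Let r := N - 1 / 2 - / N.

Lemma r_bounds : 0 < r < N.
Proof.
have iN : 0 < / N <= / 4 by split; [apply: Rinv_0_lt_compat; lra | apply: Rinv_le_contravar; lra].
by rewrite /r; lra.
Qed.

Lemma coefL_eq_bsieved k : b k = bsieved f N 0 k.
Proof.
have N3 : 3 <= N by lra.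
rewrite /b (@coefL_series f Q N k N3 (f3_bound f3) fQ).
by apply: Series_ext => j; rewrite sieved0.
Qed.

Lemma coefL0_ge : 1 / 2 <= b 0%N.
Proof.
rewrite coefL_eq_bsieved /bsieved.
have N3 : 3 <= N by lra.
have ex : ex_series (fun j => sieved f 0 j.+1 * wt N 0 j.+1).
  exact/ex_series_abs/(@sieved_ex f (f3_bound f3) (wt N 0) _ (wt_dom N3 0) ex_series_inv_sq).
have w n : wt N 0 n = npw N n by rewrite /wt /npw /=; field.
rewrite Series_incr_1 // sieved0 f1 w npw1 Rmult_1_l.
have N1 : 1 < N by lra.
have iN : 0 < / (N - 1) by apply: Rinv_0_lt_compat; lra.
have [e1 h1] := @telescope_series (fun j => npw N j.+2) (fun j => npw (N - 1) j.+1 / (N - 1))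
  (fun i => conj (Rlt_le _ _ (npw_gt0 N i.+2)) (npw_telescope i N1))
  (fun i => Rlt_le _ _ (Rmult_lt_0_compat _ _ (npw_gt0 (N - 1) i.+1) iN)).
have h2 : / (N - 1) <= / 2 by apply: Rinv_le_contravar; lra.
have : Rabs (Series (fun k => sieved f 0 k.+2 * wt N 0 k.+2)) <= Series (fun j => npw N j.+2).
  apply: Series_dom => // k; rewrite w Rabs_mult (Rabs_pos_eq (npw _ _)); last exact/Rlt_le/npw_gt0.
  have := sieved_bound (f3_bound f3) 0 k.+2; have := npw_gt0 N k.+2; nra.
move: h1; rewrite npw1 /Rdiv !Rmult_1_l => h1 h3.
by have := Rle_abs (- Series (fun k => sieved f 0 k.+2 * wt N 0 k.+2)); rewrite Rabs_Ropp; lra.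
Qed.

Lemma prime_sum_GRH : exists h : R, is_lim_seq (fun P => primesum f N P K) (Rbar.Finite h) /\
  Rabs h * r ^ K.+1 <= 2 * INR K.+1 * ln (8 * Q * N).
Proof.
have N0 : 0 < N by lra.
have rr := r_bounds; have b0 := coefL0_ge.
have b0' : b 0%N <> 0 by lra.
have [h Hh] := LD_exists b0'.
have Q0 : 0 <= 2 * Q by lra.
have bb k : Rabs (b k) <= 2 * Q * / N ^ k by apply: coefL_bound.
have nz z : Cmod z <= r -> psC b z <> 0%C.
  move=> zr; rewrite -(Lfun_ps fQ N0); last lra.
  apply: Lfun_nonvanishing.
  have -> : Re (RtoC N - z)%C = N - Re z by case: (z).
  have := Rle_trans _ _ _ (Rle_abs _) (Rle_trans _ _ _ (re_le_Cmod z) zr).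
  have : 0 < / N by apply: Rinv_0_lt_compat.
  by rewrite /r; lra.
have [n [Kn nv]] := ppart_nonvanishing N0 bb rr nz K.
exists (h K); split.
  apply: (@primesum_lim f N _ f1 fM (f3_bound f3) h K.+1 K) => //; first lra.
  by apply: LD_ext (Hh K.+1) => // k _; exact: coefL_eq_bsieved.
have LDh k : (k <= K)%N -> INR k.+1 * b k.+1 = \big[Rplus/0]_(i < k.+1) (h i * b (k - i)%N).
  by move=> kK; apply: (Hh K.+1).
have bp : 0 < b 0%N by lra.
have H := LogDerBound.logder_bound (proj1 rr) bp Kn LDh nv (abs_coef_sum N0 bb rr n.+1 Q0).
rewrite Rabs_mult (Rabs_pos_eq (r ^ _)) in H; last by apply: pow_le; lra.
apply: Rle_trans H _; apply: Rmult_le_compat_l.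
  by apply: Rmult_le_pos; [lra | exact: pos_INR].
(* The sum of the absolute coefficients is at most 2 Q / (1 - r / N) <= 4 Q N, and division by b 0
   >= 1/2 makes it 8 Q N. *)
have e : 1 - r / N = (1 / 2 + / N) / N by rewrite /r; field; lra.
have iN : 0 < / N by apply: Rinv_0_lt_compat.
have h1 : 2 * Q / (1 - r / N) <= 4 * Q * N.
  rewrite e; apply: (proj2 (Rle_div_l _ _ _ _)); first by apply: Rdiv_lt_0_compat; lra.
  rewrite (_ : 4 * Q * N * _ = 2 * Q * (1 + 2 * / N)); last by field; lra.
  by nra.
have p1 : 0 < 2 * Q / (1 - r / N).
  by rewrite e; apply: Rdiv_lt_0_compat; [lra | apply: Rdiv_lt_0_compat; lra].
have h2 : ln (2 * Q / (1 - r / N)) <= ln (4 * Q * N) by apply: ln_le.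
have h3 : ln (1 / 2) <= ln (b 0%N) by apply: ln_le; lra.
have h4 : ln (8 * Q * N) = ln (4 * Q * N) - ln (1 / 2).
  rewrite -ln_div; [|nra|lra]; congr ln; field.
lra.
Qed.

End Analytic.

(** * Quadratic reciprocity *)

Module Legendre.
Import mathcomp.order.all_order mathcomp.fingroup.all_fingroup mathcomp.algebra.all_algebra mathcomp.solvable.all_solvable mathcomp.field.all_field.
Import GroupScope GRing.Theory.
Local Open Scope ring_scope.

Lemma natr_Fp_eq0 r m : prime r -> ((m%:R : 'F_r) == 0) = (r %| m)%N.
Proof. by move=> pr; rewrite -(dvdn_pcharf (pchar_Fp pr)). Qed.

(** The Legendre symbol (m / r), through Euler's criterion, so that it is multiplicative because
    powers are. *)
Definition leg (r m : nat) : int :=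
  if (m%:R : 'F_r) == 0 then 0 else if (m%:R : 'F_r) ^+ (r.-1)./2 == 1 then 1 else -1.

Section Leg.
Variable r : nat.
Hypothesis pr : prime r.
Hypothesis oddr : odd r.

Lemma r_gt2 : (2 < r)%N.
Proof. by have := prime_gt1 pr; case: r oddr => [|[|[|]]]. Qed.

Lemma half_r : ((r.-1)./2 + (r.-1)./2 = r.-1)%N.
Proof.
have := odd_double_half r.-1; rewrite -addnn.
by move: oddr; case: r => //= k /negbTE ->.
Qed.

Lemma Fp_expr (a : 'F_r) : a != 0 -> a ^+ r.-1 = 1.
Proof.
move=> a0.
have := expf_card a; rewrite card_Fp // => e.
apply: (mulfI a0); rewrite -exprS prednK ?prime_gt0 // mulr1; exact: e.
Qed.

Lemma one_neq_m1 : (1 : 'F_r) != -1.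
Proof.
rewrite -subr_eq0 opprK -(natrD _ 1 1) natr_Fp_eq0 //.
by apply/negP => d; have := dvdn_leq (isT : (0 < 1 + 1)%N) d; have := r_gt2; lia.
Qed.

Lemma Fp_half (a : 'F_r) : a != 0 -> a ^+ (r.-1)./2 = 1 \/ a ^+ (r.-1)./2 = -1.
Proof.
move=> a0; have : (a ^+ (r.-1)./2) ^+ 2 == 1 by rewrite -exprM muln2 -addnn half_r Fp_expr.
by rewrite sqrf_eq1 => /orP[/eqP|/eqP]; auto.
Qed.

Lemma leg_cases m : leg r m = 1 \/ leg r m = 0 \/ leg r m = -1.
Proof. by rewrite /leg; case: ifP => _; [|case: ifP => _]; auto. Qed.

Lemma leg_Fp m : (leg r m)%:~R = (m%:R : 'F_r) ^+ (r.-1)./2.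
Proof.
rewrite /leg; case: eqP => [->|/eqP m0].
  by rewrite expr0n; have := half_r; have := r_gt2; case: (_./2) => //=; lia.
case: eqP => [->|n1] //.
by case: (Fp_half m0) => // ->; rewrite mulrNz.
Qed.

Lemma leg_inj (a b : int) : (a = 1 \/ a = 0 \/ a = -1) -> (b = 1 \/ b = 0 \/ b = -1) ->
  (a%:~R = b%:~R :> 'F_r) -> a = b.
Proof.
have n1 := one_neq_m1; have n0 : (1 : 'F_r) != 0 := oner_neq0 _.
have n2 : (-1 : 'F_r) != 0 by rewrite oppr_eq0.
have m1 : (-1)%:~R = -1 :> 'F_r by rewrite mulrNz.
by move=> [->|[->|->]] [->|[->|->]] //; rewrite ?m1 => /eqP; rewrite ?(negbTE n1) ?(negbTE n0) ?(negbTE n2) // eq_sym ?(negbTE n1) ?(negbTE n0) ?(negbTE n2).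
Qed.

Lemma leg_mul m n : leg r (m * n) = leg r m * leg r n.
Proof.
apply: leg_inj; [exact: leg_cases | | by rewrite leg_Fp natrM exprMn intrM !leg_Fp].
by case: (leg_cases m) => [->|[->|->]]; case: (leg_cases n) => [->|[->|->]]; auto.
Qed.

Lemma leg1 : leg r 1 = 1.
Proof. by rewrite /leg oner_eq0 expr1n eqxx. Qed.

Lemma leg_eq0 m : (leg r m == 0) = (r %| m)%N.
Proof. by rewrite /leg -natr_Fp_eq0 //; case: ifP => // _; case: ifP. Qed.

Lemma leg_mod m n : (m%:R : 'F_r) = n%:R -> leg r m = leg r n.
Proof. by rewrite /leg => ->. Qed.

Lemma leg_addr m k : leg r (m + k * r) = leg r m.
Proof.
apply: leg_mod; rewrite natrD natrM.
by have /eqP -> : (r%:R : 'F_r) == 0 by [rewrite natr_Fp_eq0 // dvdnn]; rewrite mulr0 addr0.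
Qed.

Lemma Fp_gen : exists2 g : 'F_r, g != 0 & forall a : 'F_r, a != 0 -> exists i, a = g ^+ i.
Proof.
have /cyclicP[u Hu] := field_unit_group_cyclic [set: {unit 'F_r}]%G.
exists (val u); first by rewrite -unitfE; exact: valP.
move=> a a0; have ua : a \is a GRing.unit by rewrite unitfE.
have : FinRing.unit 'F_r ua \in <[u]> by rewrite -Hu inE.
by case/cycleP => i /(congr1 val) /= ->; exists i; rewrite FinRing.val_unitX.
Qed.

(** Otherwise all r - 1 nonzero elements would be roots of X^((r-1)/2) - 1, whose degree is too
    small. *)
Lemma Fp_gen_m1 (g : 'F_r) : g != 0 -> (forall a : 'F_r, a != 0 -> exists i, a = g ^+ i) -> g ^+ (r.-1)./2 = -1.
Proof.
move=> g0 H; case: (Fp_half g0) => // e; exfalso.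
have [i ei] := H (-1) ltac:(by rewrite oppr_eq0 oner_neq0).
have h : forall a : 'F_r, a != 0 -> a ^+ (r.-1)./2 = 1.
  by move=> a /H[j ->]; rewrite -exprM mulnC exprM e expr1n.
have := max_poly_roots (p := 'X^((r.-1)./2) - 1) (rs := enum [pred a : 'F_r | a != 0]).
have h0 : (0 < (r.-1)./2)%N by have := half_r; have := r_gt2; lia.
rewrite -size_poly_eq0 size_XnsubC // => /(_ isT).
have -> : all (root ('X^((r.-1)./2) - 1)) (enum [pred a : 'F_r | a != 0]).
  by apply/allP => a; rewrite mem_enum inE /root !hornerE => a0; rewrite h // subrr.
rewrite enum_uniq => /(_ isT isT).
rewrite -cardE; have -> : #|[pred a : 'F_r | a != 0]| = r.-1.
  by rewrite -[X in _ = X.-1](card_Fp pr) -(cardC1 (0 : 'F_r)); apply: eq_card => a; rewrite !inE.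
by have := half_r; lia.
Qed.

Lemma euler_criterion (a : 'F_r) : a != 0 -> a ^+ (r.-1)./2 = 1 -> exists x, a = x ^+ 2.
Proof.
move=> a0 ha; have [g g0 H] := Fp_gen; have gm := Fp_gen_m1 g0 H.
have [i ei] := H a a0; exists (g ^+ i./2).
case: (boolP (odd i)) => oi; last by rewrite ei -exprM muln2 even_halfK.
exfalso; move: ha; rewrite ei -exprM mulnC exprM gm -signr_odd oi expr1 => e.
by have := one_neq_m1; rewrite e eqxx.
Qed.

Lemma leg_m1 : exists2 a, (0 < a < r)%N & leg r a = -1.
Proof.
have [g g0 H] := Fp_gen; have gm := Fp_gen_m1 g0 H.
have ng : (nat_of_ord g)%:R = g by rewrite natr_Zp.
exists (nat_of_ord g).
  rewrite lt0n; apply/andP; split; last by rewrite -[X in (_ < X)%N](Fp_cast pr); exact: ltn_ord.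
  by apply: contra g0 => /eqP e; rewrite -ng e.
by rewrite /leg ng (negbTE g0) gm eq_sym (negbTE one_neq_m1).
Qed.

End Leg.
End Legendre.

(** * Gauss sums in characteristic p *)

Module Reciprocity.
Import mathcomp.order.all_order mathcomp.fingroup.all_fingroup mathcomp.algebra.all_algebra mathcomp.solvable.all_solvable mathcomp.field.all_field.
Import GroupScope GRing.Theory Legendre.
Local Open Scope ring_scope.

Section GaussSum.
Variables (p r : nat).
Hypothesis pp : prime p.
Hypothesis oddp : odd p.
Hypothesis pr : prime r.
Hypothesis oddr : odd r.
Hypothesis r14 : (r %% 4 = 1)%N.
Hypothesis pnr : p != r.
Variables (K : fieldType) (z : K).
Hypothesis chp : p \in [pchar K].
Hypothesis zr : z ^+ r = 1.
Hypothesis z1 : z != 1.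

Let e (a : 'F_r) : K := z ^+ (a : nat).
Let L (a : 'F_r) : K := (leg r a)%:~R.

Lemma natr_Fp (a : 'F_r) : (nat_of_ord a)%:R = a :> 'F_r.
Proof. by rewrite natr_Zp. Qed.

Lemma e_nat m : e m%:R = z ^+ m.
Proof. by rewrite /e val_Fp_nat // expr_mod. Qed.

Lemma eD a b : e (a + b) = e a * e b.
Proof. by rewrite -{1}(natr_Fp a) -{1}(natr_Fp b) -natrD e_nat exprD. Qed.

Lemma e0 : e 0 = 1.
Proof. by rewrite -[0]/(0%:R) e_nat. Qed.

Lemma L_mul a b : L (a * b) = L a * L b.
Proof.
rewrite /L -intrM -leg_mul //; congr (_%:~R); apply: leg_mod.
by rewrite natr_Fp natrM !natr_Fp.
Qed.

Lemma L_cases a : L a = 1 \/ L a = 0 \/ L a = -1.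
Proof. by rewrite /L; case: (leg_cases r a) => [->|[->|->]]; rewrite ?mulrNz; auto. Qed.

Lemma L_sqr a : a != 0 -> L a * L a = 1.
Proof.
move=> a0; have : leg r a != 0 by rewrite leg_eq0 // -natr_Fp_eq0 // natr_Fp.
rewrite /L; case: (leg_cases r a) => [->|[->|->]] //; rewrite ?mulr1 //.
by rewrite mulrNz mulrNN mulr1.
Qed.

Lemma L0 : L 0 = 0.
Proof. by rewrite /L /leg eqxx. Qed.

Lemma two_neq0 : (2%:R : K) != 0.
Proof.
rewrite -(dvdn_pcharf chp); apply/negP => /dvdn_leq -/(_ isT).
by have := prime_gt1 pp; have := oddp; case: p => [|[|[|]]].
Qed.

Lemma sum_L : \sum_c L c = 0.
Proof.
have [a /andP[a0 ar] La] := leg_m1 pr oddr.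
have ga : (a%:R : 'F_r) != 0 by rewrite natr_Fp_eq0 //; apply/negP => /(dvdn_leq a0); lia.
have Lg : L a%:R = -1.
  by rewrite /L (@leg_mod _ _ a) ?La ?mulrNz // natr_Fp.
have : \sum_c L c = - \sum_c L c.
  rewrite {1}(reindex_inj (mulfI ga)) /= -sumrN; apply: eq_bigr => c _.
  by rewrite L_mul Lg mulN1r.
move/eqP; rewrite -subr_eq0 opprK -mulr2n -mulr_natl mulf_eq0 (negbTE two_neq0).
by move/eqP.
Qed.

Lemma sum_e u : \sum_a e (a * u) = if u == 0 then r%:R else 0.
Proof.
case: eqP => [->|/eqP u0].
  rewrite (eq_bigr (fun _ => 1)) => [|a _]; last by rewrite mulr0 e0.
  by rewrite sumr_const -[X in X%:R](card_Fp pr).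
have -> : \sum_a e (a * u) = \sum_a e a by rewrite [RHS](reindex_inj (mulIf u0)).
have e1 : e 1 = z by rewrite -[1]/(1%:R) e_nat.
have : \sum_a e a = z * \sum_a e a.
  rewrite {1}(reindex_inj (addrI 1)) /= mulr_sumr; apply: eq_bigr => a _.
  by rewrite eD e1.
move/eqP; rewrite -subr_eq0 -{1}(mul1r (\sum_a e a)) -mulrBl mulf_eq0 subr_eq0 eq_sym (negbTE z1).
by move/eqP.
Qed.

Definition gauss : K := \sum_a L a * e a.

Lemma L_m1 : L (-1) = 1.
Proof.
rewrite /L /leg natr_Fp oppr_eq0 oner_eq0 -signr_odd.
suff -> : odd (r.-1)./2 = false by rewrite expr0 eqxx.
have := divn_eq r 4; rewrite r14 => ->.
by rewrite addn1 /= (_ : (r %/ 4 * 4 = (r %/ 4).*2.*2)%N) ?doubleK ?odd_double //; lia.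
Qed.

(** Substituting a c for the second variable leaves, for each c, a sum over a that is complete up to
    the term a = 0; complete sums vanish unless c = -1. As r is 1 modulo 4, L (-1) = 1, and the
    square is r rather than - r. *)
Lemma gauss_sqr : gauss * gauss = r%:R.
Proof.
have -> : gauss * gauss = \sum_(a | a != 0) \sum_c L c * e (a * (1 + c)).
  rewrite {1}/gauss mulr_suml (bigD1 0) //= L0 !mul0r add0r; apply: eq_bigr => a a0.
  rewrite /gauss mulr_sumr (reindex_inj (mulfI a0)) /=; apply: eq_bigr => c _.
  rewrite mulrDr mulr1 eD L_mul mulrACA mulrA (mulrA (L a)) (L_sqr a0) mul1r -mulrA.
  by [].
rewrite exchange_big /=.
have h c : \sum_(a | a != 0) L c * e (a * (1 + c)) = L c * (if c == -1 then r%:R else 0) - L c.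
  rewrite -mulr_sumr -[X in _ = _ - X]mulr1 -mulrBr; congr (_ * _).
  have := sum_e (1 + c); rewrite (bigD1 0) //= mul0r e0.
  have -> : (1 + c == 0) = (c == -1) by rewrite addrC addr_eq0.
  by move=> <-; rewrite addrAC subrr add0r.
rewrite (eq_bigr _ (fun c _ => h c)) sumrB sum_L subr0 (bigD1 (-1)) //= eqxx L_m1 mul1r.
by rewrite big1 ?addr0 // => c /negbTE ->; rewrite mulr0.
Qed.

(** Frobenius raises z to the power p and fixes the signs [L a]; replacing a by p a in the sum then
    produces the symbol (p / r). *)
Lemma gauss_frob : gauss ^+ p = (leg r p)%:~R * gauss.
Proof.
have pnz : (p%:R : 'F_r) != 0 by rewrite natr_Fp_eq0 // dvdn_prime2 // eq_sym.
have Lp : L p%:R = (leg r p)%:~R by rewrite /L (@leg_mod _ _ p) // natr_Fp.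
rewrite -(pFrobenius_autE chp) /gauss rmorph_sum /= [in RHS](reindex_inj (mulfI pnz)) mulr_sumr.
apply: eq_bigr => a _; rewrite pFrobenius_autE exprMn L_mul -Lp !mulrA L_sqr // mul1r.
congr (_ * _).
  case: (L_cases a) => [->|[->|->]]; first by rewrite expr1n.
    by rewrite expr0n; have := prime_gt0 pp; case: (p).
  by rewrite -signr_odd oddp.
by rewrite -[in RHS](natr_Fp a) -natrM e_nat /e -exprM mulnC.
Qed.

Lemma gauss_recip : (r%:R : K) ^+ (p.-1)./2 = (leg r p)%:~R.
Proof.
have r0 : (r%:R : K) != 0 by rewrite -(dvdn_pcharf chp) dvdn_prime2.
have g0 : gauss != 0 by apply: contra r0 => /eqP g0; rewrite -gauss_sqr g0 mulr0.
apply: (mulIf g0); rewrite -gauss_frob -gauss_sqr -expr2 -exprM -exprSr.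
congr (_ ^+ _); have := half_r oddp; have := prime_gt0 pp; lia.
Qed.

End GaussSum.

(** As r divides p^(r-1) - 1, Cauchy's theorem gives an r-th root of unity in the field with p^(r-1)
    elements. There the p-th power of the Gauss sum determines r^((p-1)/2), and equalities between
    naturals descend to F_p. The condition r = 1 mod 4 holds for the prime factors of F_n with n >=
    1. *)
Lemma reciprocity p r : prime p -> odd p -> prime r -> odd r -> (r %% 4 = 1)%N -> p != r ->
  (r%:R : 'F_p) ^+ (p.-1)./2 = (leg r p)%:~R.
Proof.
move=> pp oddp pr oddr r14 pnr.
have r1 : (0 < r.-1)%N by have := r_gt2 pr oddr; lia.
have [K chK cK] := PrimePowerField pp r1.
have rdvd : (r %| #|[set: {unit K}]|)%N.
  rewrite card_finField_unit cK -subn1 -eqn_mod_dvd ?expn_gt0 ?prime_gt0 //.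
  rewrite -(totient_prime pr) Euler_exp_totient //.
  by rewrite prime_coprime // dvdn_prime2.
have [u _ ou] := Cauchy pr rdvd.
have ur : (val u : K) ^+ r = 1 by rewrite -FinRing.val_unitX -ou expg_order.
have u1 : (val u : K) != 1.
  apply/eqP => e; have : u = 1%g by apply: val_inj.
  by move=> e1; move: ou; rewrite e1 order1 => r1'; move: pr; rewrite -r1'.
have := gauss_recip pp oddp pr oddr r14 pnr chK ur u1.
have chF := pchar_Fp pp.
have key (a b : nat) : (a%:R = b%:R :> K) -> (a%:R = b%:R :> 'F_p).
  wlog ab : a b / (b <= a)%N => [H|].
    by case: (leqP b a) => [/H//|/ltnW ba /esym/(H _ _ ba)/esym].
  move=> /eqP; rewrite -subr_eq0 -natrB // -(dvdn_pcharf chK) (dvdn_pcharf chF) natrB // subr_eq0.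
  by move/eqP.
case: (leg_cases r p) => [->|[->|->]].
- by rewrite -natrX => /(key _ 1%N); rewrite natrX.
- by rewrite -natrX => /(key _ 0%N); rewrite natrX.
move=> h; apply/eqP; rewrite mulrNz -subr_eq0 opprK -natrX -natrD; apply/eqP.
by apply: (key _ 0%N); rewrite natrD natrX h mulrNz addNr.
Qed.

End Reciprocity.

(** * Jacobi symbols modulo Fermat numbers *)

Module Jacobi.
Import mathcomp.order.all_order mathcomp.fingroup.all_fingroup mathcomp.algebra.all_algebra mathcomp.solvable.all_solvable mathcomp.field.all_field.
Import GroupScope GRing.Theory Legendre Reciprocity.
Local Open Scope ring_scope.

(** The Jacobi symbol (m / n); the modulus comes first. *)
Definition jac (n m : nat) : int := \prod_(q <- primes n) leg q m ^+ logn q n.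

Definition sgn3 (x : int) := x = 1 \/ x = 0 \/ x = -1.

Lemma sgn3M x y : sgn3 x -> sgn3 y -> sgn3 (x * y).
Proof. by rewrite /sgn3 => -[->|[->|->]] [->|[->|->]]; auto. Qed.

Lemma sgn3X x k : sgn3 x -> sgn3 (x ^+ k).
Proof. by move=> hx; elim: k => [|k IH]; [left | rewrite exprS; apply: sgn3M]. Qed.

Lemma sgn3_prod (I : Type) (s : seq I) (P : pred I) (F : I -> int) :
  (forall i, P i -> sgn3 (F i)) -> sgn3 (\prod_(i <- s | P i) F i).
Proof. by move=> h; elim/big_ind: _ => //; [left | exact: sgn3M]. Qed.

Lemma jac_cases n m : sgn3 (jac n m).
Proof. by apply: sgn3_prod => q _; apply: sgn3X; exact: leg_cases. Qed.

Lemma jac1 n : jac n 1 = 1.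
Proof.
by rewrite /jac big_seq big1 // => q; rewrite mem_primes => /andP[pq _]; rewrite leg1 ?expr1n.
Qed.

Lemma jac_add n m k : jac n (m + k * n) = jac n m.
Proof.
rewrite /jac; apply: eq_big_seq => q; rewrite mem_primes => /and3P[pq _ /dvdnP[d ->]].
by rewrite mulnA leg_addr.
Qed.

Lemma natr_Fp_mod q a b : prime q -> a = b %[mod q] -> a%:R = b%:R :> 'F_q.
Proof. by move=> pq e; apply: val_inj; rewrite /= !val_Fp_nat. Qed.

Section Odd.
Variable n : nat.
Hypothesis oddn : odd n.

Lemma odd_n_gt0 : (0 < n)%N.
Proof. exact: odd_gt0. Qed.

Lemma prime_odd q : q \in primes n -> prime q /\ odd q.
Proof.
rewrite mem_primes => /and3P[pq _ qn]; split=> //.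
exact: dvdn_odd qn oddn.
Qed.

Lemma jac_mul m k : jac n (m * k) = jac n m * jac n k.
Proof.
rewrite /jac -big_split; apply: eq_big_seq => q /prime_odd[pq oq] /=.
by rewrite leg_mul // exprMn.
Qed.

Lemma jac_eq0 m : (jac n m == 0) = ~~ coprime m n.
Proof.
rewrite /jac prodf_seq_eq0; apply/hasP/idP => [[q qn /=]|].
  have [pq oq] := prime_odd qn.
  rewrite expf_eq0 leg_eq0 // => /andP[_ qm].
  rewrite /coprime; apply/eqP => g1.
  have : (q %| gcdn m n)%N by rewrite dvdn_gcd qm; move: qn; rewrite mem_primes => /and3P[].
  by rewrite g1 dvdn1 => /eqP q1; move: pq; rewrite q1.
move=> cm; have g1 : (1 < gcdn m n)%N.
  by rewrite ltn_neqAle eq_sym cm gcdn_gt0 odd_n_gt0 orbT.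
have pq := pdiv_prime g1; have := pdiv_dvd (gcdn m n); rewrite dvdn_gcd => /andP[qm qn].
have qp : pdiv (gcdn m n) \in primes n by rewrite mem_primes pq odd_n_gt0 qn.
exists (pdiv (gcdn m n)) => //=; have [_ oq] := prime_odd qp.
by rewrite expf_eq0 leg_eq0 // qm andbT logn_gt0.
Qed.

(** Some prime q divides n to an odd power. By the Chinese remainder theorem there is an a that is a
    nonresidue modulo q and 1 modulo the part of n prime to q. *)
Lemma jac_nonprincipal : (forall k, n <> (k ^ 2)%N) -> exists2 a, coprime a n & jac n a = -1.
Proof.
move=> nsq; have n0 := odd_n_gt0.
have /hasP[q qn oq] : has (fun q => odd (logn q n)) (primes n).
  apply/negP => /negP/hasPn H.
  apply: (nsq (\prod_(q <- primes n) q ^ (logn q n)./2)%N).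
  rewrite -mulnn -big_split {1}(prod_prime_decomp n0) prime_decompE big_map /=.
  apply: eq_big_seq => q /H oq; rewrite -expnD addnn; congr (q ^ _)%N.
  by rewrite -[LHS]odd_double_half (negbTE oq).
have [pq oddq] := prime_odd qn.
have [g g0 lg] := leg_m1 pq oddq.
pose n' := (n`_q^')%N.
pose nq := (n`_q)%N.
have nE : (nq * n' = n)%N by rewrite /nq /n' partnC.
have cop : coprime nq n' by rewrite /nq /n' coprime_partC.
have np : nq = (q ^ logn q n)%N by rewrite /nq p_part.
pose a := chinese nq n' g 1.
have lq : leg q a = -1.
  rewrite -lg; apply: leg_mod; have := chinese_modl cop g 1; rewrite -/a => e.
  have qd : (q %| nq)%N by rewrite np dvdn_exp // lt0n; case: (logn q n) oq.
  have e2 : a = g %[mod q] by rewrite -(modn_dvdm a qd) e modn_dvdm.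
  exact: natr_Fp_mod.
have lo q' : q' \in primes n -> q' != q -> leg q' a = 1.
  move=> q'n ne; have [pq' oq'] := prime_odd q'n.
  rewrite -(leg1 q'); apply: leg_mod; have := chinese_modr cop g 1; rewrite -/a => e.
  have qd : (q' %| n')%N.
    move: q'n; rewrite mem_primes => /and3P[_ _]; rewrite -nE Euclid_dvdM // np Euclid_dvdX //.
    by rewrite dvdn_prime2 // (negbTE ne).
  have e2 : a = 1 %[mod q'] by rewrite -(modn_dvdm a qd) e modn_dvdm.
  exact: natr_Fp_mod.
have ja : jac n a = -1.
  rewrite /jac (bigD1_seq q) ?primes_uniq //= lq -signr_odd oq expr1 big1_seq ?mulr1 // => q' /andP[ne q'n].
  by rewrite lo // expr1n.
by exists a => //; have := jac_eq0 a; rewrite ja => /esym/negbFE.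
Qed.

End Odd.

(** * Fermat numbers and their characters *)

Lemma fermat_odd n : odd (fermat n).
Proof. by rewrite /fermat oddD oddX /= orbF expn_eq0. Qed.

Lemma fermat_gt1 n : (1 < fermat n)%N.
Proof. by rewrite /fermat addn1 ltnS expn_gt0. Qed.

(** For n > 0, F_n = u^2 + 1 with u > 0 lies strictly between consecutive squares. *)
Lemma fermat_nonsquare n k : (0 < n)%N -> fermat n <> (k ^ 2)%N.
Proof.
case: n => // n _; rewrite /fermat expnS mulnC expnM.
have : (0 < 2 ^ (2 ^ n))%N by rewrite expn_gt0.
move: (2 ^ (2 ^ n))%N => u u0; rewrite -!mulnn => e.
case: (leqP k u) => ku; first by have := leq_mul ku ku; lia.
by have := leq_mul ku ku; lia.
Qed.

Lemma fermat_prod n k : (\prod_(i < k) fermat (n + i) * (2 ^ (2 ^ n) - 1) = 2 ^ (2 ^ (n + k)) - 1)%N.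
Proof.
elim: k => [|k IH]; first by rewrite big_ord0 mul1n addn0.
rewrite big_ord_recr /= mulnAC IH /fermat (addnS n k) (expnS 2 (n + k)) (mulnC 2 (2 ^ _)%N) (expnM 2 _ 2).
have : (0 < 2 ^ (2 ^ (n + k)))%N by rewrite expn_gt0.
by move: (2 ^ (2 ^ (n + k)))%N => u u0; rewrite -!mulnn; nia.
Qed.

Lemma fermat_coprime m n : m != n -> coprime (fermat m) (fermat n).
Proof.
wlog mn : m n / (m < n)%N => [H|_].
  by move=> ne; have := ne; rewrite neq_ltn => /orP[mn|nm]; [exact: H | rewrite coprime_sym; apply: H; rewrite // eq_sym].
have d : (fermat m %| 2 ^ (2 ^ n) - 1)%N.
  have -> : n = (m + (n - m))%N by lia.
  rewrite -(fermat_prod m (n - m)); apply: dvdn_mulr.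
  have k0 : (0 < n - m)%N by lia.
  by rewrite (bigD1 (Ordinal k0)) //= addn0 dvdn_mulr.
have e : fermat n = (2 ^ (2 ^ n) - 1 + 2)%N by rewrite /fermat; have : (0 < 2 ^ (2 ^ n))%N by [rewrite expn_gt0]; lia.
have [c dc] := dvdnP d.
by rewrite /coprime e dc gcdnMDl -/(coprime _ 2) coprimen2 fermat_odd.
Qed.

(** -1 is the square of 2^(2^(n-1)) modulo q, so (-1)^((q-1)/2) = 1. *)
Lemma fermat_prime_factor n q : (0 < n)%N -> prime q -> (q %| fermat n)%N -> odd q /\ (q %% 4 = 1)%N.
Proof.
case: n => // n _ pq qf.
have oq : odd q by apply: dvdn_odd qf (fermat_odd _).
split=> //.
pose u : 'F_q := (2 ^ (2 ^ n))%:R.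
have u2 : u ^+ 2 = -1.
  apply/eqP; rewrite -subr_eq0 opprK /u -natrX -(natrD _ _ 1) natr_Fp_eq0 // -expnM mulnC -expnS.
  by move: qf; rewrite /fermat.
have u0 : u != 0 by apply: contraTneq isT => e; move/eqP: u2; rewrite e expr0n /= eq_sym oppr_eq0 oner_eq0.
have := Fp_expr pq u0; rewrite -(half_r oq) addnn -mul2n exprM u2 -signr_odd.
case oh : (odd _); first by rewrite expr1 => /esym/eqP; rewrite (negbTE (one_neq_m1 pq oq)).
move=> _; have h := half_r oq; have q0 := prime_gt0 pq.
have := odd_double_half (q.-1)./2; rewrite oh add0n => h2.
have : q = (4 * (q.-1)./2./2 + 1)%N by lia.
by move=> ->; rewrite mulnC modnMDl.
Qed.

Lemma jac_fermat_recip n p : (0 < n)%N -> prime p -> odd p -> coprime (fermat n) p ->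
  (fermat n)%:R ^+ (p.-1)./2 = (jac (fermat n) p)%:~R :> 'F_p.
Proof.
move=> n0 pp op cp; have f0 := odd_gt0 (fermat_odd n).
rewrite {1}(prod_prime_decomp f0) prime_decompE big_map /= /jac natr_prod rmorph_prod /= -prodrXl.
apply: eq_big_seq => q qf; have := qf; rewrite mem_primes => /and3P[pq _ qd].
have [oq q4] := fermat_prime_factor n0 pq qd.
rewrite natrX rmorphXn /= -exprM mulnC exprM (reciprocity pp op pq oq q4) //.
apply: contraTneq cp => ->; rewrite /coprime; apply/eqP => g1.
have : (q %| gcdn (fermat n) q)%N by rewrite dvdn_gcd qd dvdnn.
by rewrite g1 dvdn1 => /eqP q1; move: pq; rewrite q1.
Qed.

Lemma nonresidue_jac n p : (0 < n)%N -> prime p -> odd p -> quadratic_nonresidue p (fermat n) ->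
  jac (fermat n) p = -1.
Proof.
move=> n0 pp op [cp nr].
have fn0 : (fermat n)%:R != 0 :> 'F_p.
  by rewrite natr_Fp_eq0 // -prime_coprime // coprime_sym.
have := jac_fermat_recip n0 pp op cp.
case: (Fp_half pp op fn0) => h.
  have [x hx] := euler_criterion pp op fn0 h.
  case: nr; exists x; have : (x ^ 2)%:R = (fermat n)%:R :> 'F_p by rewrite natrX natr_Zp -hx.
  by move/(congr1 val); rewrite /= !val_Fp_nat.
rewrite h => e; apply: (leg_inj pp op); [exact: jac_cases | by right; right |].
by rewrite -e mulrNz.
Qed.

(* [2 ^ (2 ^ n)] modulo [p] depends on [2 ^ n] modulo [p - 1] only, that is, for [n >= y], modulo its odd part. *)
Lemma fermat_periodic p y n N : prime p -> odd p -> ~~ (2 ^ y %| p.-1)%N -> (y <= n)%N ->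
  exists2 n', (N <= n')%N & fermat n' = fermat n %[mod p].
Proof.
move=> pp op ny yn.
have p1 : (0 < p.-1)%N by have := prime_gt1 pp; lia.
pose k := (p.-1`_2^')%N.
pose t := (p.-1`_2)%N.
have kE : (t * k = p.-1)%N by rewrite /t /k partnC.
have ok : coprime 2 k.
  by rewrite /k coprime_sym; apply: p'nat_coprime (part_pnat _ _) _; rewrite pnat_id.
have tE : t = (2 ^ logn 2 p.-1)%N by rewrite /t p_part.
have tn : (t %| 2 ^ n)%N.
  rewrite tE dvdn_exp2l //; apply: leq_trans yn; rewrite leqNgt; apply: contra ny => /ltnW h.
  by rewrite pfactor_dvdn.
have k0 : (0 < k)%N by exact: part_gt0.
exists (n + N * totient k)%N.
  by have := totient_gt0 k; rewrite k0 => h; have := leq_pmulr N h; lia.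
have e : (2 ^ (n + N * totient k) = 2 ^ n %[mod p.-1])%N.
  rewrite -kE; apply/eqP; rewrite eqn_mod_dvd; last by rewrite leq_exp2l //; lia.
  rewrite Gauss_dvd; last first.
    by rewrite tE; apply: coprimeXl.
  apply/andP; split; first by rewrite dvdn_sub // expnD dvdn_mulr.
  rewrite -eqn_mod_dvd; last by rewrite leq_exp2l //; lia.
  rewrite expnD mulnC expnM -modnMml.
  have -> : ((2 ^ N) ^ totient k %% k = 1 %% k)%N by apply: Euler_exp_totient; rewrite coprimeXl.
  by rewrite modnMml mul1n.
have p2 : (2%:R : 'F_p) != 0.
  by rewrite natr_Fp_eq0 //; apply/negP => /dvdn_leq -/(_ isT); have := r_gt2 pp op; lia.
have e2 : (2%:R : 'F_p) ^+ (2 ^ (n + N * totient k)) = 2%:R ^+ (2 ^ n).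
  by rewrite -(expr_mod _ (Fp_expr pp p2)) e expr_mod // Fp_expr.
have : (fermat (n + N * totient k))%:R = (fermat n)%:R :> 'F_p by rewrite /fermat !natrD !natrX e2.
by move/(congr1 val); rewrite /= !val_Fp_nat.
Qed.

(** Eliteness speaks of large indices only; periodicity carries the nonresidue back to every n >=
    y. *)
Lemma elite_jac p y n : elite_prime p -> odd p -> ~~ (2 ^ y %| p.-1)%N -> (0 < n)%N -> (y <= n)%N ->
  jac (fermat n) p = -1.
Proof.
move=> [pp [N HN]] op ny n0 yn; apply: nonresidue_jac => //.
have [n' Nn' e] := fermat_periodic N pp op ny yn.
have [c nr] := HN n' Nn'; split.
  by rewrite -coprime_modl -e coprime_modl.
by case=> x hx; apply: nr; exists x; rewrite hx e.
Qed.

Definition fermat_modulus y m (S : {set 'I_m}) : nat := \prod_(i in S) fermat (y + i).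

Definition fermat_char y m (S : {set 'I_m}) (k : nat) : int := \prod_(i in S) jac (fermat (y + i)) k.

Section Char.
Variables (y m : nat) (S : {set 'I_m}).
Hypothesis y0 : (0 < y)%N.

Lemma fermat_modulus_gt0 : (0 < fermat_modulus y S)%N.
Proof. by apply: prodn_gt0 => i; apply: ltnW; exact: fermat_gt1. Qed.

Lemma fermat_char_cases k : sgn3 (fermat_char y S k).
Proof. by apply: sgn3_prod => i _; exact: jac_cases. Qed.

Lemma fermat_char1 : fermat_char y S 1 = 1.
Proof. by rewrite /fermat_char big1 // => i _; exact: jac1. Qed.

Lemma fermat_charM k l : fermat_char y S (k * l) = fermat_char y S k * fermat_char y S l.
Proof.
by rewrite /fermat_char -big_split; apply: eq_bigr => i _; rewrite jac_mul ?fermat_odd.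
Qed.

Lemma fermat_char_add k : fermat_char y S (k + fermat_modulus y S) = fermat_char y S k.
Proof.
apply: eq_bigr => i iS; rewrite /fermat_modulus (bigD1 i) //= mulnC jac_add //.
Qed.

Lemma fermat_char_eq0 k : (fermat_char y S k == 0) = ~~ coprime k (fermat_modulus y S).
Proof.
rewrite /fermat_char /fermat_modulus (big_morph _ (coprimeMr k) (coprimen1 k)).
rewrite (big_morph _ negb_and (erefl (~~ true))) (big_morph _ (@mulf_eq0 int) (oner_eq0 int)).
by apply: eq_bigr => i _; rewrite jac_eq0 ?fermat_odd.
Qed.

Lemma jac_modn n k : jac n (k %% n) = jac n k.
Proof. by rewrite [in RHS](divn_eq k n) addnC jac_add. Qed.

(** Pairwise coprimality lets a be chosen with symbol -1 modulo one factor F_(y+i0) and equal to 1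
    modulo the others. *)
Lemma fermat_char_nonprincipal : S != set0 ->
  exists2 a, coprime a (fermat_modulus y S) & fermat_char y S a = -1.
Proof.
case/set0Pn => i0 i0S.
have [a0 ca0 ja0] := jac_nonprincipal (fermat_odd (y + i0)) (fun k => @fermat_nonsquare (y + i0) k (ltn_addr i0 y0)).
pose M := (\prod_(i in S | i != i0) fermat (y + i))%N.
have cM : coprime (fermat (y + i0)) M.
  rewrite /M (big_morph _ (coprimeMr _) (coprimen1 _)) big_andE.
  apply/forall_inP => i /andP[_ ne]; apply: fermat_coprime.
  by rewrite eqn_add2l eq_sym.
pose a := chinese (fermat (y + i0)) M a0 1.
have c : fermat_char y S a = -1.
  rewrite /fermat_char (bigD1 i0) //= -jac_modn (chinese_modl cM) jac_modn ja0.
  rewrite big1 ?mulr1 // => i /andP[iS ne].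
  have d : (fermat (y + i) %| M)%N by rewrite /M (bigD1 i) ?iS //= dvdn_mulr.
  rewrite -jac_modn -(modn_dvdm a d) (chinese_modr cM) (modn_dvdm _ d) jac_modn.
  exact: jac1.
by exists a => //; have := fermat_char_eq0 a; rewrite c => /esym/negbFE.
Qed.

End Char.

(** * Character sums over a period *)

Section PeriodSum.
Variables (f : nat -> int) (q a : nat).
Hypothesis q0 : (0 < q)%N.
Hypothesis fM : forall m n, f (m * n)%N = f m * f n.
Hypothesis fq : forall n, f (n + q)%N = f n.
Hypothesis caq : coprime a q.
Hypothesis fa : f a = -1.
Hypothesis f3 : forall n, sgn3 (f n).

Lemma period_mod n : f (n %% q)%N = f n.
Proof.
rewrite [in RHS](divn_eq n q) addnC; elim: (n %/ q)%N => [|k IH]; first by rewrite mul0n addn0.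
by rewrite mulSn addnCA addnC fq.
Qed.

(** Multiplication by a permutes the residues modulo q and reverses the sign of f. *)
Lemma period_sum0 : \sum_(k < q) f k = 0.
Proof.
pose h (k : 'I_q) : 'I_q := Ordinal (ltn_pmod (a * k) q0).
have hi : injective h.
  move=> i j /(congr1 val) /= e; apply: val_inj => /=.
  wlog ij : i j e / (i <= j)%N => [H|].
    by case: (leqP i j) => [/H|/ltnW/H h']; [apply | apply/esym; exact: h'].
  move/eqP: e; rewrite eq_sym eqn_mod_dvd ?leq_mul2l ?ij ?orbT // -mulnBr.
  rewrite Gauss_dvdr; last by rewrite coprime_sym.
  have jq := ltn_ord j; case: (posnP (j - i)) => [|p /(dvdn_leq p)]; lia.
have : \sum_(k < q) f k = - \sum_(k < q) f k.
  by rewrite {1}(reindex_inj hi) -sumrN; apply: eq_bigr => k _ /=; rewrite period_mod fM fa mulN1r.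
by lia.
Qed.

Lemma period_shift c : \sum_(k < q) f (k + c)%N = 0.
Proof.
elim: c => [|c IH].
  by rewrite -[RHS]period_sum0; apply: eq_bigr => k _; rewrite addn0.
have : \sum_(k < q.+1) f (k + c)%N = f c by rewrite big_ord_recr /= IH add0r addnC fq.
rewrite big_ord_recl /= add0n => e.
have H : \sum_(k < q) f (bump 0 k + c)%N = 0 by move: e; set u := \sum_(_ < _) _; lia.
by rewrite -[RHS]H; apply: eq_bigr => k _; rewrite /bump /= add1n addnS addSn.
Qed.

(** Whole periods cancel, and fewer than q terms of absolute value at most 1 remain. *)
Lemma period_psum n : (`|(\sum_(k < n) f k.+1)%R| <= q)%N.
Proof.
elim: n {-2}n (leqnn n) => [|N IH] n nN.
  by move: nN; rewrite leqn0 => /eqP ->; rewrite big_ord0.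
case: (ltnP n q) => nq.
  apply: leq_trans (ltnW nq); elim: (n) => [|k IHk]; first by rewrite big_ord0.
  rewrite big_ord_recr /=; have := f3 k.+1; rewrite /sgn3.
  by move: IHk; set u := \sum_(_ < _) _; lia.
have e : (n = (n - q) + q)%N by lia.
have -> : \sum_(k < n) f k.+1 = \sum_(k < n - q) f k.+1.
  move: (n - q)%N e => d ->; rewrite big_split_ord /= -[RHS]addr0; congr (_ + _).
  by rewrite -[RHS](period_shift d.+1); apply: eq_bigr => k _; rewrite addnS addnC.
by apply: IH; lia.
Qed.

End PeriodSum.

End Jacobi.

Module IntR.
Import ssralg ssrnum ssrint order.
Import GRing.Theory Num.Theory.
Local Open Scope ring_scope.

Definition toR (x : int) : R := x%:~R.

Lemma toRM x y : toR (x * y) = Rmult (toR x) (toR y).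
Proof. by rewrite /toR intrM. Qed.

Lemma toR1 : toR 1 = IZR 1.
Proof. by []. Qed.

Lemma toR0 : toR 0 = IZR 0.
Proof. by []. Qed.

Lemma toRN1 : toR (-1) = IZR (-1).
Proof. by rewrite /toR mulrNz. Qed.

Lemma toR_sum n (f : nat -> int) : \big[Rplus/IZR 0]_(k < n) toR (f k) = toR (\sum_(k < n) f k).
Proof. by rewrite /toR rmorph_sum. Qed.

Lemma toR_abs x : Rabs (toR x) = INR `|x|%N.
Proof. by rewrite -[LHS]/(`|x%:~R : R|) -intr_norm -abszE INRE. Qed.

Lemma toR_prod (I : finType) (P : pred I) (F : I -> int) :
  toR (\prod_(i | P i) F i) = \big[Rmult/IZR 1]_(i | P i) toR (F i).
Proof. by rewrite /toR rmorph_prod. Qed.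

Lemma toR_eq0 x : toR x = IZR 0 -> x = 0.
Proof. by move/eqP; rewrite /toR intr_eq0 => /eqP. Qed.

End IntR.
Import IntR.

Section FChar.
Variables (y m : nat).
Hypothesis y0 : (0 < y)%N.

Definition jchar (i : nat) (n : nat) : R := toR (Jacobi.jac (fermat (y + i)) n).

Definition fchar (S : {set 'I_m}) (n : nat) : R := toR (Jacobi.fermat_char y S n).

Lemma fcharE S n : fchar S n = \big[Rmult/1]_(i in S) jchar i n.
Proof. by rewrite /fchar toR_prod. Qed.

Lemma toR_sgn3 x : Jacobi.sgn3 x -> toR x = 1 \/ toR x = 0 \/ toR x = -1.
Proof. by case=> [->|[->|->]]; rewrite ?toR1 ?toR0 ?toRN1; auto. Qed.

Lemma jchar_cases i n : jchar i n = 1 \/ jchar i n = 0 \/ jchar i n = -1.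
Proof. exact: toR_sgn3 (Jacobi.jac_cases _ _). Qed.

Lemma fchar_cases S n : fchar S n = 1 \/ fchar S n = 0 \/ fchar S n = -1.
Proof. exact: toR_sgn3 (Jacobi.fermat_char_cases _ _ _). Qed.

Lemma fchar1 S : fchar S 1 = 1.
Proof. by rewrite /fchar Jacobi.fermat_char1. Qed.

Lemma fcharM S k n : fchar S (k * n) = fchar S k * fchar S n.
Proof. by rewrite /fchar Jacobi.fermat_charM toRM. Qed.

Lemma fchar_add S n : fchar S (n + Jacobi.fermat_modulus y S) = fchar S n.
Proof. by rewrite /fchar Jacobi.fermat_char_add. Qed.

Lemma fchar_coprime S n : fchar S n <> 0 <-> coprime n (Jacobi.fermat_modulus y S).
Proof.
have h := Jacobi.fermat_char_eq0 y S n; split=> [fn|cn fn].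
  by apply/negPn; rewrite -h; apply/eqP => e; apply: fn; rewrite /fchar e.
by move: h; rewrite (toR_eq0 fn) eqxx cn.
Qed.

Lemma fchar_psum S n : S != set0 -> Rabs (psum (fchar S) n) <= INR (Jacobi.fermat_modulus y S).
Proof.
move=> Sn; have [a ca fa] := Jacobi.fermat_char_nonprincipal y0 Sn.
rewrite /psum (toR_sum n (fun k => Jacobi.fermat_char y S k.+1)) toR_abs; apply: le_INR; apply/leP.
apply: (@Jacobi.period_psum (Jacobi.fermat_char y S) _ a).
- exact: Jacobi.fermat_modulus_gt0.
- exact: Jacobi.fermat_charM.
- exact: Jacobi.fermat_char_add.
- exact: ca.
- exact: fa.
- exact: Jacobi.fermat_char_cases.
Qed.

Lemma fermat_modulus_le (S : {set 'I_m}) : (Jacobi.fermat_modulus y S <= 2 ^ (2 ^ (y + m)))%N.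
Proof.
apply: leq_trans (_ : \prod_(i < m) fermat (y + i) <= _)%N.
  rewrite /Jacobi.fermat_modulus [X in (_ <= X)%N](bigID (mem S)) /= leq_pmulr //.
  by apply: prodn_gt0 => i; apply: ltnW; exact: Jacobi.fermat_gt1.
have := Jacobi.fermat_prod y m; set p := (\prod_(i < m) _)%N.
have h : (2 <= 2 ^ (2 ^ y))%N by rewrite -{1}(expn1 2) leq_exp2l // expn_gt0.
have h2 : (0 < 2 ^ (2 ^ (y + m)))%N by rewrite expn_gt0.
move: (2 ^ (2 ^ y))%N (2 ^ (2 ^ (y + m)))%N h h2 => a b h h2; nia.
Qed.

Lemma fchar_primesum (S : {set 'I_m}) (N : R) K : GRH -> S != set0 -> 4 <= N ->
  exists h : R, is_lim_seq (fun P => primesum (fchar S) N P K) (Rbar.Finite h) /\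
  Rabs h * (N - 1 / 2 - / N) ^ K.+1 <= 2 * INR K.+1 * ln (8 * INR (2 ^ (2 ^ (y + m))) * N).
Proof.
move=> grh Sn N4; apply: (@prime_sum_GRH grh (fchar S) (Jacobi.fermat_modulus y S)) => //.
- exact: Jacobi.fermat_modulus_gt0.
- exact: fchar1.
- exact: fcharM.
- exact: fchar_cases.
- exact: fchar_add.
- exact: fchar_coprime.
- move=> n; apply: Rle_trans (fchar_psum n Sn) _; apply: le_INR; apply/leP; exact: fermat_modulus_le.
by apply: (le_INR 1); apply/leP; rewrite expn_gt0.
Qed.

End FChar.

(** * Chebyshev bound *)

Lemma prime_dvd_fact p n : prime p -> (p %| n`!)%N -> (p <= n)%N.
Proof.
move=> pp; elim: n => [|n IH]; first by rewrite fact0 dvdn1 => /eqP e; move: pp; rewrite e.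
rewrite factS Euclid_dvdM // => /orP[/dvdn_leq -> //|/IH]; exact: leqW.
Qed.

Lemma prod_primes_dvd (s : seq nat) M : uniq s -> (forall p, p \in s -> prime p /\ (p %| M)%N) ->
  (\prod_(p <- s) p %| M)%N.
Proof.
elim: s => [|p s IH] /=; first by rewrite big_nil dvd1n.
case/andP=> ps us H; rewrite big_cons.
have [pp pM] := H p (mem_head _ _).
have Hs q : q \in s -> prime q /\ (q %| M)%N by move=> qs; apply: H; rewrite in_cons qs orbT.
rewrite Gauss_dvd ?pM ?IH //.
rewrite prime_coprime //; apply/negP => /= d.
have : exists2 q, q \in s & (p %| q)%N.
  elim: s d {us IH H} ps Hs => [|q s IHs] /=; first by rewrite big_nil dvdn1 => /eqP e; move: pp; rewrite e.
  rewrite big_cons Euclid_dvdM // => /orP[pq|d] pqs Hs; first by exists q; rewrite ?mem_head.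
  have [||q' q's h] := IHs d; last by exists q'; rewrite ?in_cons ?q's ?orbT.
    by move: pqs; rewrite in_cons negb_or => /andP[].
  by move=> q' q's; apply: Hs; rewrite in_cons q's orbT.
case=> q qs; have [pq _] := Hs q qs; rewrite dvdn_prime2 // => /eqP e.
by move: ps; rewrite e qs.
Qed.

(** The coefficient occurs twice, at m and at m + 1, in the row of sum 2^(2 m + 1). *)
Lemma bin_odd_le m : ('C(m.*2.+1, m) <= 4 ^ m)%N.
Proof.
have : (\sum_(i < m.*2.+2) 'C(m.*2.+1, i) = 2 ^ m.*2.+1)%N.
  have := expnDn 1 1 m.*2.+1; rewrite addn1 => ->.
  by apply: eq_bigr => i _; rewrite !exp1n !muln1.
have i1 : (m < m.*2.+2)%N by lia. have i2 : (m.+1 < m.*2.+2)%N by lia.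
rewrite (bigD1 (Ordinal i1)) //= (bigD1 (Ordinal i2)) /=; last by rewrite -(inj_eq val_inj) /= neq_ltn ltnSn orbT.
have -> : 'C(m.*2.+1, m.+1) = 'C(m.*2.+1, m).
  by rewrite -bin_sub; [congr ('C(_, _)); lia | lia].
move: (\sum_(i < _ | _) _)%N => rest.
have e4 : (2 ^ m.*2.+1 = 2 * 4 ^ m)%N by rewrite expnS -mul2n expnM.
by rewrite e4 addnA => h; lia.
Qed.

Definition primorial n := (\prod_(p <- iota 0 n.+1 | prime p) p)%N.

Lemma primorialS k : primorial k.+1 = (primorial k * (if prime k.+1 then k.+1 else 1))%N.
Proof.
by rewrite /primorial -{1}(addn1 k.+1) iotaD big_cat add0n; congr muln; rewrite big_mkcond big_seq1.
Qed.

(** Erdos's argument: the primes in (m + 1, 2 m + 1] all divide the binomial coefficient of 2 m + 1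
    over m, which is at most 4^m, and the primes up to m + 1 are left to the induction. *)
Lemma primorial_le n : (primorial n <= 4 ^ n)%N.
Proof.
have p0 k : (0 < primorial k)%N by apply: prodn_cond_gt0 => i /prime_gt0.
elim: n {-2}n (leqnn n) => [|N IH] n nN.
  by move: nN; rewrite leqn0 => /eqP ->; rewrite /primorial big_mkcond big_seq1.
case: n nN => [|[|[|n]]] nN; [by rewrite ?primorialS /primorial big_mkcond big_seq1.. | ].
case: (boolP (odd n)) => on.
  rewrite primorialS ifF; last first.
    apply/negbTE/negP => pn; have := prime_gt1 pn.
    have := even_prime pn; rewrite /= on /=; lia.
  rewrite muln1; apply: leq_trans (IH _ _) _; [lia | by rewrite leq_exp2l].
pose m := n./2.+1; have nE : n.+3 = m.*2.+1 by have := odd_double_half n; rewrite (negbTE on) /m; lia.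
have split : primorial n.+3 = (primorial m.+1 * \prod_(p <- iota m.+2 m | prime p) p)%N.
  rewrite /primorial (_ : n.+4 = m.+2 + m)%N; last by lia.
  by rewrite iotaD big_cat.
rewrite split nE (_ : m.*2.+1 = m.+1 + m)%N; last by lia.
rewrite expnD; apply: leq_mul; first by apply: IH; lia.
apply: leq_trans (bin_odd_le m); apply: dvdn_leq; first by rewrite bin_gt0; lia.
rewrite -big_filter; apply: prod_primes_dvd; first by rewrite filter_uniq // iota_uniq.
move=> p; rewrite mem_filter mem_iota => /andP[pp pm]; split=> //.
have : (p %| (m.*2.+1)`!)%N by apply: dvdn_fact; lia.
rewrite -(@bin_fact m.*2.+1 m); last by lia.
rewrite Euclid_dvdM // => /orP[//|]; rewrite Euclid_dvdM // => /orP[]/(prime_dvd_fact pp); lia.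
Qed.

Definition lnp p : R := if prime p then ln (INR p) else 0.

Lemma lnp_ge0 p : 0 <= lnp p.
Proof.
rewrite /lnp; case: ifP => [pp|_]; last lra.
by rewrite -ln_1; apply: ln_le; [lra | apply: (le_INR 1); have := prime_gt0 pp; lia].
Qed.

Lemma chebyshev n : \big[Rplus/0]_(p < n.+1) lnp p <= INR n * ln 4.
Proof.
have -> : \big[Rplus/0]_(p < n.+1) lnp p = ln (INR (primorial n)).
  elim: n => [|n IH].
    by rewrite (RsumS 0 lnp) big_ord0 /lnp /primorial /= !big_cons big_nil /= ln_1; ring.
  rewrite (RsumS n.+1 lnp) IH primorialS /lnp.
  case: ifP => pn; last by rewrite muln1; lra.
  rewrite mult_INR ln_mult //; apply: lt_0_INR; apply/ltP; last exact: prime_gt0.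
  by apply: prodn_cond_gt0 => i /prime_gt0.
rewrite (_ : INR n * ln 4 = ln (INR (4 ^ n))).
  apply: ln_le; last by apply: le_INR; apply/leP; exact: primorial_le.
  by apply: lt_0_INR; apply/ltP; apply: prodn_cond_gt0 => i /prime_gt0.
have e : INR (4 ^ n) = 4 ^ n.
  by elim: n => // n IH; rewrite expnS mult_INR IH /=; ring.
by rewrite e ln_pow //; lra.
Qed.

(** Abel summation in the form of an induction that carries the nonnegative slack (n ln 4 - A n) V
    n, with A the Chebyshev function; V decreasing lets the slack pass from n to n + 1. *)
Lemma abel_chebyshev (V : nat -> R) P : (forall n, 0 <= V n) -> (forall n, V n.+1 <= V n) ->
  \big[Rplus/0]_(p < P.+1) (lnp p * V p) <= ln 4 * \big[Rplus/0]_(n < P) V n.+1.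
Proof.
move=> V0 Vd; pose A n := \big[Rplus/0]_(p < n.+1) lnp p.
have AS n : A n.+1 = A n + lnp n.+1 by rewrite /A (RsumS n.+1 lnp).
have H n : \big[Rplus/0]_(p < n.+1) (lnp p * V p) <= ln 4 * \big[Rplus/0]_(k < n) V k.+1 - (INR n * ln 4 - A n) * V n.
  elim: n => [|n IH].
    rewrite (RsumS 0 (fun p => lnp p * V p)) /A (RsumS 0 lnp) !big_ord0 /lnp /=; lra.
  rewrite (RsumS n.+1 (fun p => lnp p * V p)) (RsumS n (fun k => V k.+1)) AS S_INR.
  have h := chebyshev n; rewrite -/(A n) in h.
  have := Rmult_le_compat_l (INR n * ln 4 - A n) _ _ ltac:(lra) (Vd n); lra.
apply: Rle_trans (H P) _.
have h := chebyshev P; rewrite -/(A P) in h.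
by have := Rmult_le_pos (INR P * ln 4 - A P) _ ltac:(lra) (V0 P); lra.
Qed.

(** * The weights *)

Lemma exp_mono a b : a <= b -> exp a <= exp b.
Proof. by case=> [h|->]; [exact/Rlt_le/exp_increasing | lra]. Qed.

Lemma ln_le_sub1 u : 0 < u -> ln u <= u - 1.
Proof. by move=> h; have := exp_ineq1_le (ln u); rewrite exp_ln //; lra. Qed.

Lemma ln_ge_frac u : 0 < u -> 1 - / u <= ln u.
Proof.
move=> h; have := ln_le_sub1 (Rinv_0_lt_compat _ h); rewrite ln_Rinv //; lra.
Qed.

Lemma neg_ln_le d : 0 <= d <= 1 / 2 -> - ln (1 - d) <= d + 2 * d ^ 2.
Proof.
move=> h; have := @ln_ge_frac (1 - d) ltac:(lra).
have : / (1 - d) <= 1 + d + 2 * d ^ 2.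
  apply: (Rmult_le_reg_l (1 - d)); first lra.
  rewrite Rinv_r; last lra.
  have : 0 <= d ^ 2 * (1 - 2 * d) by apply: Rmult_le_pos; [exact: pow2_ge_0 | lra].
  lra.
lra.
Qed.

(** This is ln (1 + u) >= 2 u / (2 + u) at u = 1 / n. The shift by 1/2 yields the factor sqrt n in
    the upper Stirling bound [ln_fact_le]. *)
Lemma ln_succ_sub n : (0 < n)%N -> 1 <= (INR n + 1 / 2) * (ln (INR n.+1) - ln (INR n)).
Proof.
move=> n0; have h0 := INR_gt0 n0; rewrite S_INR; move: (INR n) h0 => t h0.
pose g y := 2 * y / (2 + y) - ln (1 + y).
have gd y : 0 <= y -> is_derive g y (4 / (2 + y) ^ 2 - / (1 + y)).
  by move=> hy; rewrite /g; auto_derive; [lra | field; lra].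
have it := Rinv_0_lt_compat _ h0.
have g1 : g (/ t) <= g 0.
  apply: (@nonincr_of_derive g (fun y => 4 / (2 + y) ^ 2 - / (1 + y))); [lra | by move=> y hy; apply: gd; lra | ].
  move=> y [hy _].
  have -> : 4 / (2 + y) ^ 2 - / (1 + y) = - (y ^ 2 * / ((2 + y) ^ 2 * (1 + y))) by field; lra.
  have : 0 <= y ^ 2 * / ((2 + y) ^ 2 * (1 + y)); last lra.
  apply: Rmult_le_pos; first exact: pow2_ge_0.
  by apply/Rlt_le/Rinv_0_lt_compat/Rmult_lt_0_compat; [apply: pow_lt; lra | lra].
move: g1; rewrite /g !Rplus_0_r ln_1.
have -> : ln (1 + / t) = ln (t + 1) - ln t.
  by rewrite -ln_div; [congr ln; field; lra | lra | lra].
have -> : 2 * / t / (2 + / t) = / (t + 1 / 2) by field; lra.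
move=> h; apply: (Rmult_le_reg_l (/ (t + 1 / 2))); first by apply: Rinv_0_lt_compat; lra.
by rewrite -Rmult_assoc Rinv_l; lra.
Qed.

Lemma ln_fact_le n : (0 < n)%N -> ln (INR (fact n)) <= 1 + (INR n + 1 / 2) * ln (INR n) - INR n.
Proof.
elim: n => // [[|n]] IH _.
  have e : INR 1 = 1 by [].
  by rewrite (_ : fact 1 = 1%N) // e ln_1; lra.
rewrite (_ : fact n.+2 = (n.+2 * fact n.+1)%N) // mult_INR ln_mult; last 2 first.
- exact: INR_gt0.
- exact: INR_fact_pos.
have := IH isT; have := @ln_succ_sub n.+1 isT; rewrite (S_INR n.+1); move: (INR n.+1) => t; lra.
Qed.

Lemma sum_inv_sq_le (x : R) P : 0 < x -> \big[Rplus/0]_(n < P) (/ (x + INR n.+1) ^ 2) <= / x.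
Proof.
move=> x0; have := @telescope_bound (fun n => / (x + INR n.+1) ^ 2) (fun n => / (x + INR n)) P.
rewrite Rplus_0_r; apply=> i.
  rewrite S_INR; have := pos_INR i; move: (INR i) => t ht.
  have -> : / (x + t) - / (x + (t + 1)) = / ((x + t) * (x + (t + 1))) by field; lra.
  by apply: Rinv_le_contravar; [apply: Rmult_lt_0_compat; lra | nra].
by have := pos_INR i => ?; apply/Rlt_le/Rinv_0_lt_compat; lra.
Qed.

Section Weights.
Variable N : nat.
Hypothesis N4 : (4 <= N)%N.
Local Notation nu := (INR N).
Local Notation K := (N * N)%N.

Lemma nu4 : 4 <= nu.
Proof. by have := le_INR 4 N (elimT leP N4); rewrite [INR 4]/=; lra. Qed.

Definition wmax : R := nu ^ K * exp (- (nu * nu)) / INR (fact K).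

Lemma wmax_gt0 : 0 < wmax.
Proof.
have h := nu4; apply: Rdiv_lt_0_compat; last exact: INR_fact_pos.
by apply: Rmult_lt_0_compat; [apply: pow_lt; lra | exact: exp_pos].
Qed.

(* The weight [wt] at [n = exp v] divided by [wmax], its maximum, which is attained at [v = nu]. *)
Definition wnorm (v : R) : R := exp (nu * nu - nu * v) * (v / nu) ^ K.

Lemma wt_wnorm n : wt nu K n = wmax * wnorm (ln (INR n)).
Proof.
have h := nu4; have f0 := INR_fact_pos K.
rewrite /wt /wmax /wnorm; move: (ln _) => v.
have -> : exp (nu * nu - nu * v) = exp (nu * nu) * exp (- nu * v) by rewrite -exp_plus; congr exp; ring.
rewrite exp_Ropp /Rdiv Rpow_mult_distr pow_inv.
have e0 := exp_pos (nu * nu); have p0 : nu ^ K <> 0 by apply: pow_nonzero; lra.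
by field; repeat split => //; lra.
Qed.

Lemma wnorm_exp v : 0 < v -> wnorm v = exp (nu * nu * (1 - v / nu + ln (v / nu))).
Proof.
move=> v0; have h := nu4; have vn : 0 < v / nu by apply: Rdiv_lt_0_compat; lra.
rewrite /wnorm -(@Rpower_pow K) // /Rpower -exp_plus mult_INR; congr exp.
by field; lra.
Qed.

Lemma wnorm_0 : wnorm 0 = 0.
Proof. by rewrite /wnorm /Rdiv Rmult_0_l pow_i ?Rmult_0_r //; apply/ltP; nia. Qed.

Lemma wnorm_le1 v : 0 <= v -> wnorm v <= 1.
Proof.
case=> [v0|<-]; last by rewrite wnorm_0; lra.
have h := nu4; rewrite wnorm_exp // -[X in _ <= X]exp_0; apply: exp_mono.
have vn : 0 < v / nu by apply: Rdiv_lt_0_compat; lra.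
by rewrite -(Rmult_0_r (nu * nu)); have := ln_le_sub1 vn => l; apply: Rmult_le_compat_l; [nra | lra].
Qed.

(* [ln] lies below its tangent at [1 / (1 - 2 / nu)]. *)
Lemma wnorm_le_sq v : 0 <= v -> wnorm v <= exp (8 + 2 * (nu - v)).
Proof.
case=> [v0|<-]; last by rewrite wnorm_0; exact/Rlt_le/exp_pos.
have h := nu4; rewrite wnorm_exp //; apply: exp_mono.
have vn : 0 < v / nu by apply: Rdiv_lt_0_compat; lra.
have i0 : 0 < / nu by apply: Rinv_0_lt_compat; lra.
have i4 : / nu <= / 4 by apply: Rinv_le_contravar; lra.
(* At d = 2 / nu the error term 2 d^2 of [neg_ln_le], multiplied by nu^2, is the 8 of the
   statement. *)
have d1 := @neg_ln_le (2 * / nu) ltac:(lra).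
have a0 : 0 < 1 - 2 * / nu by lra.
have t1 := @ln_le_sub1 ((1 - 2 * / nu) * (v / nu)) ltac:(exact: Rmult_lt_0_compat).
rewrite ln_mult // in t1.
have e : 8 + 2 * (nu - v) = nu * nu * (8 * (/ nu) ^ 2 + 2 * / nu * (1 - v / nu)) by field; lra.
rewrite e; apply: Rmult_le_compat_l; first nra.
move: d1 t1; move: (ln (v / nu)) => a; move: (ln (1 - _)) => b; move: (v / nu) => c; move: (/ nu) => d; lra.
Qed.

(** The exponent nu^2 (1 - v / nu + ln (v / nu)) has second derivative -1 at its maximum v = nu.
    This is the reason for K = nu^2: the peak has width of order 1 in ln n, so the loss on
    [nu, nu + 1] does not depend on nu. *)
Lemma wnorm_ge v : nu <= v <= nu + 1 -> exp (-1) <= wnorm v.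
Proof.
move=> hv; have h := nu4; rewrite wnorm_exp; last lra.
apply: exp_mono.
have vn : 0 < v / nu by apply: Rdiv_lt_0_compat; lra.
have l := ln_ge_frac vn.
have e : nu * nu * (1 - v / nu + (1 - / (v / nu))) = - (v - nu) ^ 2 * (nu / v) by field; lra.
have nv : 0 <= nu / v <= 1.
  split; first by apply: Rdiv_le_0_compat; lra.
  by apply: (proj2 (Rle_div_l _ _ _ _)); lra.
have sq : 0 <= (v - nu) ^ 2 <= 1 by split; [exact: pow2_ge_0 | nra].
apply: (Rle_trans _ (nu * nu * (1 - v / nu + (1 - / (v / nu))))).
  by rewrite e; move: (nu / v) ((v - nu) ^ 2) nv sq => a b; nra.
by apply: Rmult_le_compat_l; [nra | lra].
Qed.

(** The weight increases up to exp nu, so Abel summation needs a decreasing majorant. This one joins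
    the bounds [wnorm_le1] and [wnorm_le_sq]; the 4 comes from (x + n)^2 <= 4 max (x, n)^2. *)
Definition wmaj (n : nat) : R := 4 * exp 8 * exp nu ^ 2 / (exp nu + INR n) ^ 2.

Lemma wnorm_le_wmaj n : (0 < n)%N -> wnorm (ln (INR n)) <= wmaj n.
Proof.
move=> n0; have h0 := INR_gt0 n0; have x0 := exp_pos nu.
have v0 : 0 <= ln (INR n) by case: n n0 {h0} => // n _; exact: ln_INR_ge0.
have e8 : 1 <= exp 8 by rewrite -exp_0; apply: exp_mono; lra.
have l1 := wnorm_le1 v0; have l2 := wnorm_le_sq v0.
have e2 : exp (8 + 2 * (nu - ln (INR n))) = exp 8 * (exp nu / INR n) ^ 2.
  rewrite exp_plus; congr (_ * _).
  rewrite (_ : 2 * (nu - ln (INR n)) = (nu + - ln (INR n)) + (nu + - ln (INR n))); last ring.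
  by rewrite !exp_plus exp_Ropp exp_ln //; field; lra.
rewrite e2 in l2; rewrite /wmaj; move: (exp nu) (INR n) h0 x0 l1 l2 => x t h0 x0 l1 l2.
have [tx|xt] := Rle_lt_dec t x.
  apply: Rle_trans l1 _; apply: (proj1 (Rle_div_r _ _ _ _)); first nra.
  have : (x + t) ^ 2 <= 4 * x ^ 2 by nra.
  have : 0 <= x ^ 2 by nra.
  by move: (exp 8) e8 => E; nra.
apply: Rle_trans l2 _; apply: (proj1 (Rle_div_r _ _ _ _)); first nra.
have -> : exp 8 * (x / t) ^ 2 * (x + t) ^ 2 = exp 8 * x ^ 2 * ((x + t) / t) ^ 2 by field; lra.
have q : 0 <= (x + t) / t <= 2.
  split; first by apply: Rdiv_le_0_compat; lra.
  by apply: (proj2 (Rle_div_l _ _ _ _)); lra.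
have -> : 4 * exp 8 * x ^ 2 = exp 8 * x ^ 2 * 4 by ring.
by apply: Rmult_le_compat_l; [apply: Rmult_le_pos; nra | nra].
Qed.

Lemma wmaj_le_inv n : (0 < n)%N -> wmaj n <= exp 8 * exp nu / INR n.
Proof.
move=> n0; have h0 := INR_gt0 n0; have x0 := exp_pos nu; have e0 := exp_pos 8.
rewrite /wmaj; move: (exp nu) (INR n) (exp 8) h0 x0 e0 => x t E h0 x0 e0.
apply: (proj2 (Rle_div_l _ _ _ _)); first nra.
have -> : E * x / t * (x + t) ^ 2 = E * x * ((x + t) ^ 2 / t) by field; lra.
have -> : 4 * E * x ^ 2 = E * x * (4 * x) by ring.
apply: Rmult_le_compat_l; first nra.
have sq := pow2_ge_0 (x - t); apply: (proj1 (Rle_div_r _ _ _ h0)); lra.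
Qed.

Lemma wmaj_ge0 n : 0 <= wmaj n.
Proof.
have x0 := exp_pos nu; have e0 := exp_pos 8; have := pos_INR n => t0.
apply: Rdiv_le_0_compat; first by apply: Rmult_le_pos; [lra | exact: pow2_ge_0].
by apply: pow_lt; lra.
Qed.

Lemma wmaj_decr n : wmaj n.+1 <= wmaj n.
Proof.
have x0 := exp_pos nu; have e0 := exp_pos 8; have := pos_INR n => t0.
rewrite /wmaj S_INR; apply: Rmult_le_compat_l; first by apply: Rmult_le_pos; [lra | exact: pow2_ge_0].
by apply: Rinv_le_contravar; [apply: pow_lt; lra | nra].
Qed.

(** The second summand covers the powers p^j with j >= 2: by [wmaj_le_inv] they are dominated by a
    geometric series of ratio 1/2, whose sum is the factor 2. *)
Lemma elog1_le p : prime p ->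
  elog (fun=> 1) nu p K <= wmax * (lnp p * (wmaj p + 2 * exp 8 * exp nu * / INR p ^ 2)).
Proof.
move=> pp; have p1 := prime_gt1 pp; have p0 := prime_gt0 pp; have h := nu4.
have f1 n : Rabs ((fun _ : nat => 1) n) <= 1 by rewrite Rabs_R1; lra.
have M0 := wmax_gt0; have lp := lnp_ge0 p; rewrite /lnp pp in lp.
have wle n : (0 < n)%N -> wt nu K n <= wmax * wmaj n.
  by move=> n0; rewrite wt_wnorm; apply: Rmult_le_compat_l; [lra | exact: wnorm_le_wmaj].
have ip : 0 < INR p by exact: INR_gt0.
rewrite /elog /lnp pp -Rmult_assoc (Rmult_comm wmax) Rmult_assoc; apply: Rmult_le_compat_l => //.
rewrite Series_incr_1; last by apply: elog_ex => //; lra.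
rewrite pow1 Rmult_1_l expn1 Rmult_plus_distr_l; apply: Rplus_le_compat; first exact: wle.
set c := wmax * (exp 8 * exp nu * / INR p ^ 2).
have c0 : 0 <= c.
  apply: Rmult_le_pos; first lra.
  apply: Rmult_le_pos; first by apply: Rmult_le_pos; exact/Rlt_le/exp_pos.
  by apply/Rlt_le/Rinv_0_lt_compat; apply: pow_lt.
have geo : is_series (fun j => (/ 2) ^ j) (/ (1 - / 2)) by apply: is_series_geom; rewrite Rabs_right; lra.
have -> : wmax * (2 * exp 8 * exp nu * / INR p ^ 2) = Series (fun j => c * (/ 2) ^ j).
  by rewrite Series_scal_l (is_series_unique _ _ geo) /c; field; lra.
apply: Rle_trans (Rle_abs _) _.
apply: Series_dom => [j|]; last by apply: ex_series_scal_l; eexists; exact: geo.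
rewrite pow1 Rmult_1_l Rabs_pos_eq; last exact: wt_expn_ge0.
have pj0 : (0 < p ^ j.+2)%N by rewrite expn_gt0 p0.
apply: Rle_trans (wle _ pj0) _; rewrite /c Rmult_assoc; apply: Rmult_le_compat_l; first lra.
apply: Rle_trans (wmaj_le_inv pj0) _; rewrite Rmult_assoc; apply: Rmult_le_compat_l.
  by apply: Rmult_le_pos; exact/Rlt_le/exp_pos.
have p2 : 2 <= INR p by apply: (le_INR 2); apply/leP.
have -> : INR (p ^ j.+2) = INR p ^ 2 * INR p ^ j.
  by elim: j {pj0} => [|j IH]; rewrite expnS mult_INR ?IH -?(tech_pow_Rmult _ j); [rewrite expn1 /=; ring | ring].
rewrite pow_inv -Rinv_mult; apply: Rinv_le_contravar.
  by apply: Rmult_lt_0_compat; apply: pow_lt; lra.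
by apply: Rmult_le_compat_l; [exact: pow2_ge_0 | apply: pow_incr; lra].
Qed.

Lemma primesum1_le P : primesum (fun=> 1) nu P K <= wmax * (ln 4 * (12 * exp 8 * exp nu)).
Proof.
have h := nu4; have M0 := wmax_gt0; have x0 := exp_pos nu; have e0 := exp_pos 8.
(* 8 / (1 + n)^2 dominates the 2 / n^2 of [elog1_le] for n >= 1 and decreases from n = 0 on, where
   [abel_chebyshev] starts. The two parts then sum to 4 + 8 = 12. *)
pose U n := wmaj n + 8 * exp 8 * exp nu * / (1 + INR n) ^ 2.
have U0 n : 0 <= U n.
  apply: Rplus_le_le_0_compat; first exact: wmaj_ge0.
  apply: Rmult_le_pos; first by apply: Rmult_le_pos; lra.
  by have := pos_INR n => ?; apply/Rlt_le/Rinv_0_lt_compat/pow_lt; lra.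
have Ud n : U n.+1 <= U n.
  apply: Rplus_le_compat; first exact: wmaj_decr.
  apply: Rmult_le_compat_l; first by apply: Rmult_le_pos; lra.
  have := pos_INR n => ?; rewrite S_INR.
  by apply: Rinv_le_contravar; [apply: pow_lt; lra | nra].
apply: (Rle_trans _ (wmax * \big[Rplus/0]_(p < P.+1) (lnp p * U p))).
  rewrite -(Rsum_mull P.+1 wmax (fun p => lnp p * U p)); apply: Rsum_le => i _.
  case: ifP => [pp|np]; last by rewrite /lnp np; lra.
  apply: Rle_trans (elog1_le pp) _; apply: Rmult_le_compat_l; first lra.
  apply: Rmult_le_compat_l; first exact: lnp_ge0.
  apply: Rplus_le_compat_l.
  have i1 : 1 <= INR i by apply: (le_INR 1); apply/leP; exact: prime_gt0.
  have -> : 8 * exp 8 * exp nu = 2 * exp 8 * exp nu * 4 by ring.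
  rewrite [X in _ <= X]Rmult_assoc; apply: Rmult_le_compat_l; first by apply: Rmult_le_pos; lra.
  move: (INR i) i1 => t t1.
  apply: (Rmult_le_reg_l (t ^ 2)); first by apply: pow_lt; lra.
  rewrite Rinv_r; last by apply: pow_nonzero; lra.
  have -> : t ^ 2 * (4 * / (1 + t) ^ 2) = (2 * t) ^ 2 / (1 + t) ^ 2 by field; lra.
  by apply: (proj1 (Rle_div_r _ _ _ _)); nra.
apply: Rmult_le_compat_l; first lra.
apply: Rle_trans (abel_chebyshev P U0 Ud) _.
apply: Rmult_le_compat_l; first by rewrite -ln_1; apply: ln_le; lra.
rewrite /U /wmaj.
rewrite (Rsum_add P (fun n => 4 * exp 8 * exp nu ^ 2 / (exp nu + INR n.+1) ^ 2)
  (fun n => 8 * exp 8 * exp nu * / (1 + INR n.+1) ^ 2)).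
rewrite (Rsum_mull P (4 * exp 8 * exp nu ^ 2) (fun n => / (exp nu + INR n.+1) ^ 2)).
rewrite (Rsum_mull P (8 * exp 8 * exp nu) (fun n => / (1 + INR n.+1) ^ 2)).
have s1 := sum_inv_sq_le P x0; have s2 := @sum_inv_sq_le 1 P ltac:(lra).
have -> : 12 * exp 8 * exp nu = 4 * exp 8 * exp nu ^ 2 * / exp nu + 8 * exp 8 * exp nu * / 1 by field; lra.
apply: Rplus_le_compat; apply: Rmult_le_compat_l => //.
  by apply: Rmult_le_pos; [lra | nra].
by apply: Rmult_le_pos; lra.
Qed.

(** Here x^(1/2) = exp (nu / 2) arises: ln (nu / r) is 1 / (2 nu) + O(nu^(-2)) for the radius r, and
    K = nu^2. *)
Lemma ratio_le : nu / (nu - 1 / 2 - / nu) <= 2 /\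
  (nu / (nu - 1 / 2 - / nu)) ^ K <= exp (nu / 2 + 3).
Proof.
have h := nu4; have i0 : 0 < / nu by apply: Rinv_0_lt_compat; lra.
have i4 : / nu <= / 4 by apply: Rinv_le_contravar; lra.
split; first by apply: (proj2 (Rle_div_l _ _ _ _)); lra.
have q0 : 0 < nu / (nu - 1 / 2 - / nu) by apply: Rdiv_lt_0_compat; lra.
rewrite -Rpower_pow // /Rpower mult_INR; apply: exp_mono.
pose d := 1 / 2 * / nu + (/ nu) ^ 2.
have d0 : 0 <= d <= 1 / 2 by rewrite /d; nra.
have -> : ln (nu / (nu - 1 / 2 - / nu)) = - ln (1 - d).
  rewrite -ln_Rinv; last lra.
  have -> : 1 - d = (nu - 1 / 2 - / nu) / nu by rewrite /d; field; lra.
  by rewrite /Rdiv Rinv_mult Rinv_inv Rmult_comm.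
have l := neg_ln_le d0.
apply: (Rle_trans _ (nu * nu * (d + 2 * d ^ 2))); first by apply: Rmult_le_compat_l; nra.
have -> : nu * nu * (d + 2 * d ^ 2) = nu / 2 + 1 + 2 * (1 / 2 + / nu) ^ 2 by rewrite /d; field; lra.
nra.
Qed.

(** As nu^K [wmax] = K^K e^(-K) / K!, this is Stirling's upper bound for K!, with sqrt K = nu. *)
Lemma wmax_stirling : 1 <= exp 1 * nu * nu ^ K * wmax.
Proof.
have h := nu4; have f0 := INR_fact_pos K.
have l := @ln_fact_le K ltac:(nia).
rewrite mult_INR ln_mult in l; try lra.
have nK : nu ^ K = exp (nu * nu * ln nu).
  by rewrite -Rpower_pow /Rpower ?mult_INR; last lra.
have : INR (fact K) <= exp 1 * nu * nu ^ K * (nu ^ K * exp (- (nu * nu))).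
  rewrite -[X in X <= _](exp_ln _ f0) -[X in _ * X * _ * _ ](@exp_ln nu); last lra.
  by rewrite nK -!exp_plus; apply: exp_mono; move: l; move: (ln nu) (ln _) => a b; lra.
rewrite /wmax => F; have -> : exp 1 * nu * nu ^ K * (nu ^ K * exp (- (nu * nu)) / INR (fact K)) =
  exp 1 * nu * nu ^ K * (nu ^ K * exp (- (nu * nu))) / INR (fact K) by rewrite /Rdiv; ring.
by apply: (proj1 (Rle_div_r _ _ _ _)) => //; rewrite Rmult_1_l.
Qed.

(** The constant collects the initial 2, K + 1 <= 2 nu^2, one factor nu / r <= 2, the e of
    [wmax_stirling] and the e^3 of [ratio_le]. *)
Lemma coef_le (h A : R) : 0 <= A ->
  Rabs h * (nu - 1 / 2 - / nu) ^ K.+1 <= 2 * INR K.+1 * A ->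
  Rabs h <= wmax * (8 * exp 4 * nu ^ 2 * exp (nu / 2) * A).
Proof.
move=> A0 H; have n4 := nu4; have M0 := wmax_gt0.
have i4 : / nu <= / 4 by apply: Rinv_le_contravar; lra.
have [q1 q2] := ratio_le; have st := wmax_stirling; have e1 := exp_pos 1.
set r := nu - 1 / 2 - / nu in H q1 q2; have r0 : 0 < r by rewrite /r; lra.
have rK : 0 < r ^ K by apply: pow_lt.
have nK : 0 < nu ^ K by apply: pow_lt; lra.
have K1 : INR K.+1 <= 2 * nu ^ 2 by rewrite S_INR mult_INR; nra.
have q0 : 0 <= nu / r by apply: Rdiv_le_0_compat; lra.
have h1 : Rabs h <= 2 * INR K.+1 * A / (r * r ^ K).
  by apply: (proj1 (Rle_div_r _ _ _ _)); [exact: Rmult_lt_0_compat | rewrite tech_pow_Rmult].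
apply: Rle_trans h1 _.
have c0 : 0 <= 2 * INR K.+1 * A / (r * r ^ K).
  apply: Rdiv_le_0_compat; last exact: Rmult_lt_0_compat.
  by apply: Rmult_le_pos => //; have := pos_INR K.+1; lra.
apply: (Rle_trans _ (2 * INR K.+1 * A / (r * r ^ K) * (exp 1 * nu * nu ^ K * wmax))).
  by rewrite -{1}(Rmult_1_r (_ / _)); apply: Rmult_le_compat_l.
have -> : 2 * INR K.+1 * A / (r * r ^ K) * (exp 1 * nu * nu ^ K * wmax) =
  wmax * (2 * exp 1 * A * (INR K.+1 * ((nu / r) * (nu / r) ^ K))).
  by rewrite /Rdiv Rpow_mult_distr pow_inv; field; lra.
have -> : 8 * exp 4 * nu ^ 2 * exp (nu / 2) * A =
  2 * exp 1 * A * (2 * nu ^ 2 * (2 * exp (nu / 2 + 3))).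
  rewrite exp_plus (_ : 4 = 1 + 3); last ring.
  by rewrite (exp_plus 1 3); ring.
apply: Rmult_le_compat_l; first lra.
apply: Rmult_le_compat_l; first by nra.
apply: Rmult_le_compat => //; first exact: pos_INR.
  by apply: Rmult_le_pos => //; apply: pow_le.
by apply: Rmult_le_compat => //; apply: pow_le.
Qed.

End Weights.

(** * Counting elite primes *)

Lemma Series_bigsum (I : Type) (s : seq I) (F : I -> nat -> R) : (forall i, ex_series (F i)) ->
  is_series (fun j => \big[Rplus/0]_(i <- s) F i j) (\big[Rplus/0]_(i <- s) Series (F i)).
Proof.
move=> eF; elim: s => [|i s IH].
  rewrite big_nil; apply: (@is_series_ext _ _ (fun=> 0)) => [j|]; first by rewrite big_nil.
  change (is_lim_seq (sum_n (fun=> 0)) 0).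
  apply: (is_lim_seq_ext (fun=> 0)); last exact: is_lim_seq_const.
  by move=> n; rewrite sum_n_const; ring.
rewrite big_cons.
apply: (@is_series_ext _ _ (fun j => F i j + \big[Rplus/0]_(i <- s) F i j)) => [j|]; first by rewrite big_cons.
exact: is_series_plus (Series_correct _ (eF i)) IH.
Qed.

Lemma Rsum_widen (f : nat -> R) P Q : (forall i, 0 <= f i) -> (P <= Q)%N ->
  \big[Rplus/0]_(i < P) f i <= \big[Rplus/0]_(i < Q) f i.
Proof.
move=> f0; elim: Q => [|Q IH]; first by rewrite leqn0 => /eqP ->; lra.
rewrite leq_eqVlt => /orP[/eqP ->|/IH h]; first lra.
by rewrite (RsumS Q f); have := f0 Q; lra.
Qed.

Lemma INR_expn a n : INR (a ^ n) = INR a ^ n.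
Proof. by elim: n => // n IH; rewrite expnS mult_INR IH. Qed.

(** * The signed sum over characters *)

Section MainSum.
Variables (y m N : nat).
Hypothesis y0 : (0 < y)%N.
Hypothesis N4 : (4 <= N)%N.
Local Notation nu := (INR N).
Local Notation K := (N * N)%N.

Definition fsign (S : {set 'I_m}) : R := \big[Rmult/1]_(i in S) (-1).

Lemma fsign_abs S : Rabs (fsign S) = 1.
Proof.
rewrite /fsign; elim/big_ind: _ => [|a b ha hb|i _]; first exact: Rabs_R1.
  by rewrite Rabs_mult ha hb; ring.
by rewrite Rabs_Ropp Rabs_R1.
Qed.

Lemma fchar_expand p k :
  \big[Rplus/0]_(S : {set 'I_m}) (fsign S * fchar y S p ^ k) = \big[Rmult/1]_(i < m) (1 - jchar y i p ^ k).
Proof.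
rewrite (eq_bigr (fun i : 'I_m => - jchar y i p ^ k + 1)); last by move=> i _; ring.
rewrite bigA_distr; apply: eq_bigr => S _.
rewrite fcharE -big_mkcond /fsign.
rewrite (big_morph (fun t => t ^ k) (id1 := 1) (op1 := Rmult)); last 2 first.
- by move=> a b; rewrite Rpow_mult_distr.
- exact: pow1.
by rewrite -big_split; apply: eq_bigr => i _ /=; ring.
Qed.

Definition good_prime (p : nat) : bool := [&& `[< elite_prime p >], odd p & ~~ (2 ^ y %| p.-1)%N].

Lemma good_primeP p : good_prime p -> prime p /\ forall i : nat, jchar y i p = -1.
Proof.
case/and3P => /asboolP ep op ny; split; first by case: ep.
by move=> i; rewrite /jchar (Jacobi.elite_jac ep op ny) ?toRN1 //; lia.
Qed.

(** Every product of the 1 - chi_i(p)^j is nonnegative, so dropping the powers j >= 2, and all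
    powers of a prime that is not good, only lowers the sum. At a good prime the term j = 1 is
    exact. *)
Lemma signed_elog_ge p : prime p ->
  (if good_prime p then 2 ^ m * (ln (INR p) * wt nu K p) else 0) <=
  \big[Rplus/0]_(S : {set 'I_m}) (fsign S * elog (fchar y S) nu p K).
Proof.
move=> pp; have p1 := prime_gt1 pp; have n4 := nu4 N4.
have fb (S : {set 'I_m}) n : Rabs (fchar y S n) <= 1.
  by case: (fchar_cases y S n) => [->|[->|->]]; rewrite ?Rabs_Ropp ?Rabs_R1 ?Rabs_R0; lra.
have ex (S : {set 'I_m}) : ex_series (fun j => fchar y S p ^ j.+1 * wt nu K (p ^ j.+1)).
  by apply: elog_ex => //; lra.
pose F (S : {set 'I_m}) j := fsign S * (fchar y S p ^ j.+1 * wt nu K (p ^ j.+1)).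
pose G j := \big[Rmult/1]_(i < m) (1 - jchar y i p ^ j.+1) * wt nu K (p ^ j.+1).
have eG : is_series G (\big[Rplus/0]_(S : {set 'I_m}) Series (F S)).
  apply: is_series_ext (@Series_bigsum _ _ F _) => [j|S]; last by apply: ex_series_scal_l; exact: ex.
  rewrite /G -fchar_expand big_distrl; apply: eq_bigr => S _; rewrite /F /=; ring.
have -> : \big[Rplus/0]_(S : {set 'I_m}) (fsign S * elog (fchar y S) nu p K) = ln (INR p) * Series G.
  rewrite (is_series_unique _ _ eG) big_distrr; apply: eq_bigr => S _.
  by rewrite /elog /F Series_scal_l /=; ring.
have fac i j : 0 <= 1 - jchar y i p ^ j.
  have : Rabs (jchar y i p ^ j) <= 1.
    rewrite -RPow_abs -(pow1 j); apply: pow_incr; split; first exact: Rabs_pos.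
    by case: (jchar_cases y i p) => [->|[->|->]]; rewrite ?Rabs_Ropp ?Rabs_R1 ?Rabs_R0; lra.
  by have := Rle_abs (jchar y i p ^ j); lra.
have G0 j : 0 <= G j.
  apply: Rmult_le_pos; last exact: wt_expn_ge0.
  by elim/big_ind: _ => [|a b|i _]; [lra | exact: Rmult_le_pos | exact: fac].
have l0 : 0 <= ln (INR p) by case: (p) p1 => // p' _; exact: ln_INR_ge0.
have sG : G 0%N <= Series G.
  have := @partial_le_Series G 1 G0 ltac:(by eexists; exact: eG).
  by rewrite big_ord1.
case: ifP => gp; last by apply: Rmult_le_pos => //; have := G0 0%N; lra.
have [_ gj] := good_primeP gp.
rewrite -Rmult_assoc (Rmult_comm _ (ln _)) Rmult_assoc; apply: Rmult_le_compat_l => //.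
apply: Rle_trans sG; rewrite /G expn1; right; congr (_ * _).
rewrite (eq_bigr (fun=> 2)); last by move=> i _; rewrite gj /=; ring.
by rewrite big_const card_ord; elim: (m) => //= k ->.
Qed.

Lemma fchar_set0 : fchar y (set0 : {set 'I_m}) = fun=> 1.
Proof. by apply/funext => n; rewrite fcharE big_set0. Qed.

Definition good_sum P : R := \big[Rplus/0]_(p < P.+1) (if good_prime p then ln (INR p) * wt nu K p else 0).

Lemma good_term_ge0 p : 0 <= (if good_prime p then ln (INR p) * wt nu K p else 0).
Proof.
case: ifP => gp; last lra.
have [pp _] := good_primeP gp; have := prime_gt0 pp; case: (p) => // p' _.
by apply: Rmult_le_pos; [exact: ln_INR_ge0 | exact: wt_ge0].
Qed.

Lemma good_sum_le P : 2 ^ m * good_sum P <=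
  wmax N * (ln 4 * (12 * exp 8 * exp nu)) +
  \big[Rplus/0]_(S : {set 'I_m} | S != set0) Rabs (primesum (fchar y S) nu P K).
Proof.
apply: (Rle_trans _ (\big[Rplus/0]_(S : {set 'I_m}) (fsign S * primesum (fchar y S) nu P K))).
  rewrite /good_sum /primesum.
  rewrite (eq_bigr (fun S : {set 'I_m} => \big[Rplus/0]_(p < P.+1) (if prime p then fsign S * elog (fchar y S) nu p K else 0))); last first.
    move=> S _; rewrite big_distrr; apply: eq_bigr => p _ /=.
    by case: ifP => _; rewrite ?Rmult_0_r.
  rewrite exchange_big big_distrr /=; apply: Rsum_le => p _.
  case: (boolP (prime p)) => pp; first by move: (signed_elog_ge pp); case: ifP => _; rewrite ?Rmult_0_r.
  rewrite big1 // ifF; last by apply/negbTE/negP => /good_primeP[]; rewrite (negbTE pp).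
  lra.
rewrite (bigD1 set0) //=; apply: Rplus_le_compat.
  by rewrite /fsign big_set0 Rmult_1_l fchar_set0; exact: primesum1_le.
apply: Rsum_le => S _; apply: Rle_trans (Rle_abs _) _.
by rewrite Rabs_mult fsign_abs; lra.
Qed.

Definition char_bound : R := 8 * exp 4 * nu ^ 2 * exp (nu / 2) * ln (8 * INR (2 ^ (2 ^ (y + m))) * nu).

Lemma log_modulus_ge0 : 0 <= ln (8 * INR (2 ^ (2 ^ (y + m))) * nu).
Proof.
have n4 := nu4 N4; rewrite -ln_1; apply: ln_le; first lra.
have : 1 <= INR (2 ^ (2 ^ (y + m))) by apply: (le_INR 1); apply/leP; rewrite expn_gt0.
nra.
Qed.

Lemma char_bound_ge0 : 0 <= char_bound.
Proof.
apply: Rmult_le_pos; last exact: log_modulus_ge0.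
apply: Rmult_le_pos; last exact/Rlt_le/exp_pos.
by apply: Rmult_le_pos; [have := exp_pos 4; lra | exact: pow2_ge_0].
Qed.

(** The bound from [GRH] is for the limit in P. As there are finitely many S, beyond a common P0 all
    partial sums are within [wmax N] of their limits, whence the + 1; and P may be enlarged because
    [good_sum] increases. *)
Lemma good_sum_GRH P : GRH -> 2 ^ m * good_sum P <=
  wmax N * (ln 4 * (12 * exp 8 * exp nu) + 2 ^ m * (char_bound + 1)).
Proof.
move=> grh; have n4 := nu4 N4; have M0 := wmax_gt0 N4.
have A0 := log_modulus_ge0.
have lim (S : {set 'I_m}) : exists P0, S != set0 -> forall P, (P0 <= P)%N ->
    Rabs (primesum (fchar y S) nu P K) <= wmax N * (char_bound + 1).
  case: (boolP (S != set0)) => [Sn|_]; last by exists 0%N.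
  have [h [hl hb]] := fchar_primesum y0 K grh Sn n4.
  have hw : Rabs h <= wmax N * char_bound := coef_le N4 A0 hb.
  have [P0 HP] := (is_lim_seq_epsP _ _).1 hl (wmax N) M0.
  exists P0 => _ Q QP; have := HP Q QP; have := Rabs_triang_inv (primesum (fchar y S) nu Q K) h.
  move: (Rabs _) (Rabs _) (Rabs _) hw => a b c hw; lra.
have [f Hf] := choice lim; pose P0 := \max_(S : {set 'I_m}) f S.
have HP0 (S : {set 'I_m}) : S != set0 -> forall P, (P0 <= P)%N ->
    Rabs (primesum (fchar y S) nu P K) <= wmax N * (char_bound + 1).
  by move=> Sn Q PQ; apply: Hf => //; apply: leq_trans PQ; exact: leq_bigmax.
apply: (Rle_trans _ (2 ^ m * good_sum (maxn P P0))).
  apply: Rmult_le_compat_l; first by apply: pow_le; lra.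
  apply: (Rsum_widen (f := fun p => if good_prime p then ln (INR p) * wt nu K p else 0)); last by lia.
  exact: good_term_ge0.
apply: Rle_trans (good_sum_le _) _; rewrite Rmult_plus_distr_l; apply: Rplus_le_compat_l.
apply: (Rle_trans _ (\big[Rplus/0]_(S : {set 'I_m} | S != set0) (wmax N * (char_bound + 1)))).
  by apply: Rsum_le => S Sn; apply: HP0 => //; exact: leq_maxr.
have c0 : 0 <= wmax N * (char_bound + 1).
  by apply: Rmult_le_pos; have := char_bound_ge0; lra.
have -> : wmax N * (2 ^ m * (char_bound + 1)) = \big[Rplus/0]_(S : {set 'I_m}) (wmax N * (char_bound + 1)).
  rewrite big_const -cardsT -powersetT card_powerset cardsT card_ord.
  have -> n c : iter n (Rplus c) 0 = INR n * c by elim: n => [|n IH]; rewrite ?S_INR /= ?IH; ring.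
  by rewrite INR_expn (_ : INR 2 = 2) //; ring.
by rewrite [X in _ <= X](bigD1 set0) // -[X in X <= _]Rplus_0_l; apply: Rplus_le_compat => //; exact: Rle_refl.
Qed.

End MainSum.

(** * From weighted sums to counting *)

Definition nat_floor (x : R) : nat := Z.to_nat (Int_part x).

Lemma nat_floorP x p : 0 <= x -> (p <= nat_floor x)%N <-> INR p <= x.
Proof.
move=> x0; have [h1 h2] := base_Int_part x; rewrite /nat_floor INR_IZR_INZ.
have z0 : (0 <= Int_part x)%Z by apply/Z.lt_succ_r/lt_IZR; rewrite succ_IZR; lra.
split=> [pf|px].
  have : (Z.of_nat p <= Int_part x)%Z by lia.
  by move/IZR_le; lra.
have : (Z.of_nat p < Int_part x + 1)%Z by apply: lt_IZR; rewrite plus_IZR; lra.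
lia.
Qed.

Definition ind (b : bool) : R := if b then 1 else 0.

Lemma ind_ge0 b : 0 <= ind b. Proof. by case: b; rewrite /ind; lra. Qed.

Lemma INR_count (a : pred nat) n : INR (count a (iota 0 n)) = \big[Rplus/0]_(p < n) ind (a p).
Proof.
elim: n => [|n IH]; first by rewrite big_ord0.
rewrite -addn1 iotaD count_cat plus_INR IH addn1 (RsumS n (fun p => ind (a p))) /= addn0.
by case: (a n).
Qed.

(** The guard excludes p = 0, where [p.-1] is 0 and would count as a multiple of d. *)
Lemma count_multiples d n : (0 < d)%N ->
  \big[Rplus/0]_(p < n.+1) ind ((0 < p)%N && (d %| p.-1)%N) <= INR n / INR d + 1.
Proof.
move=> d0; have dp := INR_gt0 d0.
have H k : \big[Rplus/0]_(p < k.+1) ind ((0 < p)%N && (d %| p.-1)%N) = INR ((k + d.-1) %/ d).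
  elim: k => [|k IH].
    by rewrite (RsumS 0 (fun p => ind ((0 < p)%N && (d %| p.-1)%N))) big_ord0 add0n divn_small /ind /=; [lra | lia].
  rewrite (RsumS k.+1 (fun p => ind ((0 < p)%N && (d %| p.-1)%N))) IH /=.
  rewrite addSn divnS // plus_INR.
  rewrite (_ : (k + d.-1).+1 = (k + d)%N); last by lia.
  by rewrite dvdn_addl // Rplus_comm; case: (d %| k)%N.
rewrite H; apply: (Rmult_le_reg_r (INR d)) => //.
rewrite Rmult_plus_distr_r /Rdiv Rmult_assoc Rinv_l; last lra.
rewrite -mult_INR Rmult_1_r Rmult_1_l -plus_INR; apply: le_INR; apply/leP.
by apply: leq_trans (leq_trunc_div _ _) _; rewrite leq_add2l leq_pred.
Qed.

Lemma Rsum_truncate (f : nat -> R) P Q : (forall p, 0 <= f p) ->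
  \big[Rplus/0]_(p < P) (if (p <= Q)%N then f p else 0) <= \big[Rplus/0]_(p < Q.+1) f p.
Proof.
move=> f0; elim: P => [|P IH]; first by rewrite big_ord0; apply: Rsum_ge0 => i _; exact: f0.
have [PQ|QP] := leqP P Q; last first.
  by rewrite (RsumS P (fun p => if (p <= Q)%N then f p else 0)) leqNgt QP Rplus_0_r.
apply: Rle_trans (Rsum_widen f0 (_ : P.+1 <= Q.+1)%N) => //.
by apply: Rsum_le => p _; case: ifP => _; [lra | exact: f0].
Qed.

Section Interval.
Variables (y m N : nat).
Hypothesis grh : GRH.
Hypothesis y0 : (0 < y)%N.
Hypothesis N4 : (4 <= N)%N.
Local Notation nu := (INR N).
Local Notation K := (N * N)%N.

Lemma elite_interval :
  INR (elite_count (exp (nu + 1))) <= INR (elite_count (exp nu)) + (exp (nu + 1) / 2 ^ y + 1) +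
    exp 1 / nu * (ln 4 * (12 * exp 8 * exp nu) / 2 ^ m + (char_bound y m N + 1)).
Proof.
have n4 := nu4 N4; have M0 := wmax_gt0 N4; have e1 := exp_pos 1.
have x0 := exp_pos nu; have x1 := exp_pos (nu + 1).
rewrite /elite_count -!/(nat_floor _) !INR_count.
set P := nat_floor (exp (nu + 1)); set P1 := nat_floor (exp nu).
pose el p := ind `[< elite_prime p >].
pose f1 p := if (p <= P1)%N then el p else 0.
pose f2 p := ind ((0 < p)%N && (2 ^ y %| p.-1)%N).
(* Normalized so that a good prime in (exp nu, exp (nu + 1)] counts at least 1: there ln p >= nu and
   [wnorm] is at least 1/e. *)
pose f3 p := exp 1 / (nu * wmax N) * (if good_prime y p then ln (INR p) * wt nu K p else 0).
have c0 : 0 < exp 1 / (nu * wmax N) by apply: Rdiv_lt_0_compat => //; apply: Rmult_lt_0_compat; lra.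
have pt p : (p <= P)%N -> el p <= f1 p + f2 p + f3 p.
  move=> pP; have f30 : 0 <= f3 p by apply: Rmult_le_pos; [lra | exact: good_term_ge0].
  have f20 : 0 <= f2 p by exact: ind_ge0.
  have f10 : 0 <= f1 p by rewrite /f1; case: ifP => _; [exact: ind_ge0 | lra].
  case: (boolP `[< elite_prime p >]) => ep; last by rewrite /el (negbTE ep) /ind; lra.
  have el1 : el p = 1 by rewrite /el ep.
  case: (boolP (p <= P1)%N) => [pP1|pP1]; first by move: f20 f30; rewrite /f1 pP1; lra.
  have px : exp nu < INR p by apply: Rnot_le_lt => /(nat_floorP p (Rlt_le _ _ x0)) h; rewrite h in pP1.
  have px1 : INR p <= exp (nu + 1) by apply/(nat_floorP p (Rlt_le _ _ x1)).
  have ex5 : nu + 1 <= exp nu by have := exp_ineq1_le nu; lra.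
  have p2 : (2 < p)%N by apply/ltP; apply: INR_lt; rewrite (_ : INR 2 = 2) //; lra.
  case: (boolP (2 ^ y %| p.-1)%N) => yp; first by rewrite el1 /f2 yp (ltn_trans _ p2) // /ind /=; move: f10 f30; lra.
  have gp : good_prime y p.
    rewrite /good_prime ep yp andbT /=; have [pp _] : elite_prime p by apply/asboolP.
    by case: (even_prime pp) => [e|//]; rewrite e in p2.
  have p0 : 0 < INR p by lra.
  have lv : nu <= ln (INR p) <= nu + 1.
    split; first by rewrite -[X in X <= _]ln_exp; apply: ln_le; lra.
    by rewrite -[X in _ <= X]ln_exp; apply: ln_le; lra.
  have hw := wnorm_ge N4 lv.
  have f31 : 1 <= f3 p.
    rewrite /f3 gp wt_wnorm //.
    have e : exp 1 / (nu * wmax N) * (nu * (wmax N * exp (-1))) = exp 1 * exp (-1) by field; lra.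
    rewrite -exp_plus (_ : 1 + -1 = 0) ?exp_0 in e; last ring.
    rewrite -[X in X <= _]e.
    apply: Rmult_le_compat_l; first lra.
    apply: Rmult_le_compat; [lra | | lra | ].
      by apply: Rmult_le_pos; [lra | exact/Rlt_le/exp_pos].
    by apply: Rmult_le_compat_l; [lra | exact: hw].
  rewrite el1; lra.
apply: (Rle_trans _ (\big[Rplus/0]_(p < P.+1) (f1 p + f2 p + f3 p))).
  by apply: Rsum_le => p _; apply: pt; rewrite -ltnS.
rewrite (Rsum_add P.+1 (fun p => f1 p + f2 p) f3) (Rsum_add P.+1 f1 f2).
apply: Rplus_le_compat; first apply: Rplus_le_compat.
- by apply: Rsum_truncate => p; exact: ind_ge0.
- apply: Rle_trans (@count_multiples (2 ^ y) P _) _; first by rewrite expn_gt0.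
  apply: Rplus_le_compat_r; rewrite INR_expn (_ : INR 2 = 2) //.
  apply: Rmult_le_compat_r; first by apply/Rlt_le/Rinv_0_lt_compat/pow_lt; lra.
  by apply/(nat_floorP P (Rlt_le _ _ x1)).
rewrite (Rsum_mull P.+1 _ (fun p => if good_prime y p then ln (INR p) * wt nu K p else 0)).
rewrite -/(good_sum y N P).
have m0 : 0 < 2 ^ m by apply: pow_lt; lra.
have H := good_sum_GRH m y0 N4 P grh.
have -> : exp 1 / (nu * wmax N) * good_sum y N P = exp 1 / (nu * wmax N * 2 ^ m) * (2 ^ m * good_sum y N P) by field; lra.
have -> : exp 1 / nu * (ln 4 * (12 * exp 8 * exp nu) / 2 ^ m + (char_bound y m N + 1)) =
  exp 1 / (nu * wmax N * 2 ^ m) * (wmax N * (ln 4 * (12 * exp 8 * exp nu) + 2 ^ m * (char_bound y m N + 1))).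
  by field; lra.
apply: Rmult_le_compat_l => //.
by apply/Rlt_le/Rdiv_lt_0_compat => //; apply: Rmult_lt_0_compat => //; apply: Rmult_lt_0_compat; lra.
Qed.

End Interval.

Lemma exp_mul_INR x k : exp (x * INR k) = exp x ^ k.
Proof. by rewrite -Rpower_pow /Rpower ?ln_exp 1?Rmult_comm //; exact: exp_pos. Qed.

Lemma pow2_bracket t : 1 <= t -> exists k, 2 ^ k <= t < 2 ^ k.+1.
Proof.
move=> t1.
have [n tn] : exists n, t < 2 ^ n.
  have [n Hn] := Pow_x_infinity 2 ltac:(rewrite Rabs_right; lra) (t + 1).
  by exists n; have := Hn n (le_n n); rewrite Rabs_pos_eq; [lra | apply: pow_le; lra].
elim: n tn => [|n IH] tn; first by move: tn => /=; lra.
by case: (Rlt_le_dec t (2 ^ n)) => [/IH //|h]; exists n.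
Qed.

(** 2 e + 1 accounts for the primes 1 modulo 2^y, 24 = 2 * 12 for the trivial character and 72 = 8 *
    9 for the others. The factors 2 in 2 e and in 24 are lost in rounding to powers of 2. *)
Definition interval_const : R := 2 * exp 1 + 1 + exp 1 * (24 * ln 4 * exp 8 + 72 * exp 4 + 1).

Lemma elite_interval_le N : GRH -> (72 <= N)%N ->
  INR (elite_count (exp (INR N + 1))) <= INR (elite_count (exp (INR N))) + interval_const * exp (5 / 6) ^ N.
Proof.
move=> grh N72; have N4 : (4 <= N)%N by lia.
have n72 : 72 <= INR N by have := le_INR 72 N (elimT leP N72); rewrite INR_IZR_INZ.
pose s := exp (INR N / 6).
have ep k : exp (INR N / 6 * INR k) = s ^ k by rewrite exp_mul_INR.
(* The quadratic term of the exponential series gives s >= N^2 / 72, which is at least N from N = 72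
   on. *)
have sN : INR N <= s.
  have := @pow_fact_le_exp (INR N / 6) 2 ltac:(lra); rewrite -/s (_ : INR (fact 2) = 2) //.
  by move: (s) => t; nra.
have s0 : 0 < s by exact: exp_pos.
have e5 : exp (5 / 6) ^ N = s ^ 5.
  by rewrite -exp_mul_INR -ep; congr exp; rewrite /=; field.
have e6 : exp (INR N) = s ^ 6 by rewrite -ep; congr exp; rewrite /=; field.
have e3 : exp (INR N / 2) = s ^ 3 by rewrite -ep; congr exp; rewrite /=; field.
have [y [y1 y2]] := @pow2_bracket s ltac:(lra).
have [m [m1 m2]] := @pow2_bracket (s / INR N) ltac:(by apply: (proj1 (Rle_div_r _ _ _ _)); lra).
have y0 : (0 < y)%N by case: (y) y2 => //= y2; lra.
have H := elite_interval m grh y0 N4.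
have e1 := exp_pos 1; have e4 := exp_pos 4; have e8 := exp_pos 8.
have l4 : 0 <= ln 4 by rewrite -ln_1; apply: ln_le; lra.
have s5 : 0 < s ^ 5 by exact: pow_lt.
have py : 0 < 2 ^ y by apply: pow_lt; lra.
have pm : 0 < 2 ^ m by apply: pow_lt; lra.
have pn : 0 < INR N by lra.
have sm1 : 2 ^ m * INR N <= s by apply: (proj2 (Rle_div_r _ _ _ pn)).
have sm2 : s <= 2 * 2 ^ m * INR N by apply: (proj1 (Rle_div_l _ _ _ pn)); rewrite /= in m2; lra.
have H1 : exp (INR N + 1) / 2 ^ y <= 2 * exp 1 * s ^ 5.
  apply: (proj2 (Rle_div_l _ _ _ py)); rewrite exp_plus e6.
  have -> : s ^ 6 * exp 1 = exp 1 * s ^ 5 * s by ring.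
  have -> : 2 * exp 1 * s ^ 5 * 2 ^ y = exp 1 * s ^ 5 * (2 * 2 ^ y) by ring.
  by apply: Rmult_le_compat_l; [nra | rewrite tech_pow_Rmult; lra].
have H2 : exp 1 / INR N * (ln 4 * (12 * exp 8 * exp (INR N)) / 2 ^ m) <= exp 1 * (24 * ln 4 * exp 8) * s ^ 5.
  rewrite e6.
  have -> : exp 1 / INR N * (ln 4 * (12 * exp 8 * s ^ 6) / 2 ^ m) =
    exp 1 * (12 * ln 4 * exp 8) * s ^ 5 * (s / (2 ^ m * INR N)) by field; lra.
  have -> : exp 1 * (24 * ln 4 * exp 8) * s ^ 5 = exp 1 * (12 * ln 4 * exp 8) * s ^ 5 * 2 by ring.
  apply: Rmult_le_compat_l.
    apply: Rmult_le_pos; last lra.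
    by apply: Rmult_le_pos; [lra | apply: Rmult_le_pos; lra].
  by apply: (proj2 (Rle_div_l _ _ _ _)); [exact: Rmult_lt_0_compat | lra].
(* The logarithm is at most 8 N + 2^(y+m), and both N and 2^(y+m) are at most s^2 / N. *)
have lA : ln (8 * INR (2 ^ (2 ^ (y + m))) * INR N) <= 9 * (s ^ 2 / INR N).
  rewrite INR_expn (_ : INR 2 = 2) //.
  have p0 : 0 < 2 ^ (2 ^ (y + m))%N by apply: pow_lt; lra.
  have -> : 8 * 2 ^ (2 ^ (y + m))%N * INR N = (8 * INR N) * 2 ^ (2 ^ (y + m))%N by ring.
  rewrite ln_mult //; last lra.
  rewrite ln_pow; last lra.
  rewrite INR_expn (_ : INR 2 = 2) // pow_add.
  have l8 := @ln_le_sub1 (8 * INR N) ltac:(lra).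
  have l2 := @ln_le_sub1 2 ltac:(lra).
  have a1 : INR N <= s ^ 2 / INR N by apply: (proj1 (Rle_div_r _ _ _ pn)); nra.
  have a2 : 2 ^ y * 2 ^ m <= s ^ 2 / INR N.
    apply: (proj1 (Rle_div_r _ _ _ pn)); rewrite Rmult_assoc /= Rmult_1_r.
    by apply: Rmult_le_compat => //; apply: Rlt_le => //; exact: Rmult_lt_0_compat.
  have p1 : 0 < 2 ^ y * 2 ^ m by exact: Rmult_lt_0_compat.
  move: (2 ^ y * 2 ^ m) (s ^ 2 / INR N) (ln 2) (ln (8 * INR N)) l8 l2 a1 a2 p1 => a b c d l8 l2 a1 a2 p1.
  nra.
have H3 : char_bound y m N / INR N <= 72 * exp 4 * s ^ 5.
  rewrite /char_bound e3.
  have -> : 72 * exp 4 * s ^ 5 = 8 * exp 4 * INR N ^ 2 * s ^ 3 * (9 * (s ^ 2 / INR N)) / INR N by field; lra.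
  apply: Rmult_le_compat_r; first exact/Rlt_le/Rinv_0_lt_compat.
  apply: Rmult_le_compat_l; last exact: lA.
  apply: Rmult_le_pos; last by apply: pow_le; lra.
  by apply: Rmult_le_pos; [lra | exact: pow2_ge_0].
have H4 : 1 <= s ^ 5 by apply: pow_R1_Rle; lra.
have H5 : exp 1 / INR N <= exp 1.
  by apply: (proj2 (Rle_div_l _ _ _ pn)); nra.
rewrite e5 /interval_const.
apply: Rle_trans H _.
have -> : exp 1 / INR N * (ln 4 * (12 * exp 8 * exp (INR N)) / 2 ^ m + (char_bound y m N + 1)) =
  exp 1 / INR N * (ln 4 * (12 * exp 8 * exp (INR N)) / 2 ^ m) + exp 1 * (char_bound y m N / INR N) + exp 1 / INR N.
  by field; lra.
have H6 := Rmult_le_compat_l _ _ _ (Rlt_le _ _ e1) H3.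
have H7 := Rmult_le_compat_l _ _ _ (Rlt_le _ _ e1) H4.
lra.
Qed.

Theorem theorem2 :
  GRH ->
  exists K x0 : R, forall x : R, (x0 <= x)%R ->
    (INR (elite_count x) <= K * Rpower x (5 / 6))%R.
Proof.
(* [C] satisfies C q^N + [interval_const] q^N = C q^(N+1), so the geometric sum over the intervals
   telescopes. *)
move=> grh; pose q := exp (5 / 6); pose C := interval_const / (q - 1).
have q1 : 1 < q by rewrite /q -exp_0; apply: exp_increasing; lra.
have C0 : 0 <= C.
  apply: Rdiv_le_0_compat; last lra.
  have := exp_pos 1; have := exp_pos 8; have := exp_pos 4; rewrite /interval_const => a b c.
  have l4 : 0 <= ln 4 by rewrite -ln_1; apply: ln_le; lra.
  have d := Rmult_le_pos _ _ l4 (Rlt_le _ _ b).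
  by have := @Rmult_le_pos (exp 1) (24 * (ln 4 * exp 8) + 72 * exp 4 + 1) ltac:(lra) ltac:(lra); lra.
have H N : (72 <= N)%N -> INR (elite_count (exp (INR N))) <= INR (elite_count (exp (INR 72))) + C * q ^ N.
  elim: N => // N IH; rewrite leq_eqVlt => /orP[/eqP <-|].
    by have : 0 <= C * q ^ 72; [apply: Rmult_le_pos => //; apply: pow_le; lra | lra].
  rewrite ltnS => N72; have := elite_interval_le grh N72; have := IH N72.
  rewrite (S_INR N) -tech_pow_Rmult -/q.
  have -> : interval_const = C * (q - 1) by rewrite /C; field; lra.
  move: (q ^ N) => t; lra.
(* The factor q pays for rounding ln x up to the next integer, and the primes below exp 72 are
   absorbed because q^N >= 1. *)
exists (INR (elite_count (exp (INR 72))) + C * q), (exp (INR 72)) => x hx.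
have x0 : 0 < x by have := exp_pos (INR 72); lra.
pose N := nat_floor (ln x).
have l72 : INR 72 <= ln x by rewrite -(ln_exp (INR 72)); apply: ln_le => //; exact: exp_pos.
have l0 : 0 <= ln x by have := pos_INR 72; lra.
have N1 : INR N <= ln x by apply/(nat_floorP N l0).
have N2 : ln x < INR N + 1.
  by rewrite -S_INR; apply: Rnot_le_lt => /(nat_floorP N.+1 l0); rewrite ltnn.
have N72 : (72 <= N)%N by apply/(nat_floorP 72 l0).
have mono a b : 0 <= a -> a <= b -> INR (elite_count a) <= INR (elite_count b).
  move=> a0 ab; rewrite /elite_count !INR_count; apply: (Rsum_widen (f := fun p => ind `[< elite_prime p >])).
    by move=> p; exact: ind_ge0.
  rewrite ltnS; apply/(nat_floorP (nat_floor a)); first lra.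
  by apply: Rle_trans ab; apply/(nat_floorP (nat_floor a)).
have xe : x <= exp (INR N.+1) by rewrite -(exp_ln x) // S_INR; apply: exp_mono; lra.
apply: Rle_trans (mono x (exp (INR N.+1)) ltac:(lra) xe) _.
apply: Rle_trans (H N.+1 (leqW N72)) _.
have qN : 1 <= q ^ N by apply: pow_R1_Rle; lra.
have qx : q ^ N <= Rpower x (5 / 6).
  by rewrite /q -exp_mul_INR /Rpower; apply: exp_mono; apply: Rmult_le_compat_l; [lra | exact: N1].
rewrite -tech_pow_Rmult -Rmult_assoc; have := pos_INR (elite_count (exp (INR 72))).
move: (INR (elite_count _)) => c c0.
have Cq : 0 <= C * q by apply: Rmult_le_pos; lra.
move: (q ^ N) (Rpower x _) (C * q) qN qx Cq => a b d ha ab hd.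
have := Rmult_le_compat_l _ _ _ hd ab; have := Rmult_le_compat_l _ _ _ c0 (Rle_trans _ _ _ ha ab); lra.
Qed.
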